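(* Assume that the initial-boundary value problem $$\frac{\partial^2u}{\partial t^2}-\left(\alpha(t)+\beta(t)\iint_\Omega|\nabla u|^2\,dx\,dy\right)\Delta u=f,\qquad u(0)=u_0,\quad \partial_tu(0)=v_0,\quad u(t)|_{\partial\Omega}=0\ \ (t\in[0,T]),$$ is well posed, with exact solution $u$, and suppose that: (i) $u_0\in D(\mathcal L_0)$; $v_0,w_0\in C^1(\overline\Omega)$; $u_x$ and $u_y$ have continuous second temporal derivatives; for every $t\in[0,T]$, $f(t)\in C^1(\overline\Omega)$ with $f(t)|_{\partial\Omega}=0$, the spatial derivatives of $f(t)$ being bounded uniformly in $t$; and moreover $u_0\in D(\mathcal L^2)$, $v_0\in D(\mathcal L)$, $f\in C([0,T];D(\mathcal L^{1/2}))$ with $f(0)\in D(\mathcal L)$. (ii) $u(t)$ is three times continuously differentiable with respect to $t$, and $u_{ttt}(t)$ is Lipschitz continuous in $t$ as a map into $L^2(\Omega)$. (iii) $u_{xx}(t)$ and $u_{yy}(t)$ are continuously differentiable with respect to $t$, and $u_{xxt}(t)$ and $u_{yyt}(t)$ are Lipschitz continuous in $t$ as maps into $L^2(\Omega)$. Then the central-difference approximation of $u_t(t_k)$ computed from the solution sequences $\{u_k\}_{k=0}^n$ of the nonlinear scheme is second-order accurate in time on a local interval: there exists $\overline T\in(0,T]$ such that, with $m=[\overline T/\tau]$ ($[\cdot]$ the integer part), $$\max_{1\le k\le m-1}\left\|u_t(t_k)-\frac{u_{k+1}-u_{k-1}}{2\tau}\right\|=O(\tau^2),$$ i.e. the left-hand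 side is at most $C\tau^2$ with $C$ independent of $\tau=T/n$.
   Context: $\Omega\subset\mathbb R^2$ is a bounded convex domain; $\|\cdot\|$ is the norm of $L^2(\Omega)$. Functions $u$ and $f$ are regarded as functions of $t$ with values in a space of functions on $\Omega$; subscripts $x,y,t$ on $u$ denote partial derivatives. $\mathcal L_0=-\Delta$ with $D(\mathcal L_0)=\{u\in C^2(\overline\Omega):u|_{\partial\Omega}=0\}$; $\mathcal L$ is its Friedrichs extension, i.e. the unique self-adjoint positive definite operator in $L^2(\Omega)$ associated with the form $a(u,v)=(\nabla u,\nabla v)$ on $H^1_0(\Omega)$; $D(\mathcal L^{1/2})=H_0^1(\Omega)$, $\|\mathcal L^{1/2}u\|=\|\nabla u\|$, and powers $\mathcal L^a$, $a>0$, with their domains are defined by the spectral calculus. $T>0$; $\alpha,\beta\in C^1([0,T])$ are real-valued with $\min_{[0,T]}\alpha>0$ and $\min_{[0,T]}\beta>0$; $f\in C([0,T];L^2(\Omega))$. For an integer $n>1$, $\tau=T/n$, $t_k=k\tau$, $\alpha_k=\alpha(t_k)$, $\beta_k=\beta(t_k)$, $f_k=f(t_k)$. Further, $$w_0=f_0+q_0\Delta u_0,\qquad q_0=\alpha_0+\beta_0\iint_\Omega|\nabla u_0|^2\,dx\,dy .$$ A solution sequence of the nonlinear scheme is a sequence $u_0,\dots,u_n\in D(\mathcal L)$ with the given $u_0$, with $u_1=u_0+\tau v_0+\frac{\tau^2}{2}w_0$ and, for $k=1,\dots,n-1$, $$\frac{u_{k+1}-2u_k+u_{k-1}}{\tau^2}+\frac12\left(\alpha_k+\frac{\beta_k}{2}\left(\|\mathcal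 L^{1/2}u_{k+1}\|^2+\|\mathcal L^{1/2}u_{k-1}\|^2\right)\right)\left(\mathcal L u_{k+1}+\mathcal L u_{k-1}\right)=f_k .$$ *)

(* Defs.v *)
From HB Require Import structures.
From mathcomp Require Export all_boot all_order all_algebra.
From mathcomp Require Export all_classical all_reals all_analysis.
Export numFieldNormedType.Exports.

Set Implicit Arguments.
Unset Strict Implicit.
Unset Printing Implicit Defensive.

Import Order.TTheory GRing.Theory Num.Theory.

Local Open Scope classical_set_scope.
Local Open Scope ring_scope.

(** Elements of [L^2(Omega)] are represented by functions on the whole plane;
    values outside [Omega] are irrelevant and equality in [L^2(Omega)] is
    almost-everywhere equality on [Omega].  An [L^2(Omega)]-valued function of
    time is a [u : R -> R * R -> R], considered on [[0, T]] only. *)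

Definition mu2 (R : realType) :
    {measure set (measurableTypeR R * measurableTypeR R) -> \bar R} :=
  ((@lebesgue_measure R) \x (@lebesgue_measure R))%E.
Arguments mu2 : clear implicits.

Definition e1 (R : realType) : R * R := (1, 0).
Definition e2 (R : realType) : R * R := (0, 1).
Definition dirs (R : realType) : set (R * R) := [set e1 R; e2 R].
Arguments e1 : clear implicits.
Arguments e2 : clear implicits.
Arguments dirs : clear implicits.

(** [C^k] on the closure of an open set [D]: the partial derivatives of order
    [<= k] exist in [D] and extend continuously to the closure of [D].  It is
    used in the plane (directions [e1], [e2]) and on the line (direction [1],
    [D = ]0, T[], so that the closure is [[0, T]]). *)
Fixpoint Ck_closure (R : realType) (V : normedModType R) (E D : set V)
    (k : nat) (u : V -> R) : Prop :=
  {within closure D, continuous u} /\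
  if k is k'.+1 then
    forall e, E e -> (forall p, D p -> derivable u p e) /\
      exists2 g, Ck_closure E D k' g & forall p, D p -> g p = 'D_e u p
  else True.

Definition C1_segment (R : realType) (T : R) (a : R -> R) : Prop :=
  Ck_closure [set 1 : R] `]0, T[ 1 a.

Section Domain.
Context (R : realType) (Omega : set (R * R)).
Implicit Types (u v w f g : R * R -> R) (e : R * R).

Definition convex_domain : Prop :=
  [/\ Omega !=set0, open Omega, bounded_set Omega
    & convex_set (Omega : set (convex_lmodType (R * R)%type))].

Definition eqL2 u v : Prop := {ae mu2 R, forall p, Omega p -> u p = v p}.

Definition inL2 u : Prop := (u \_ Omega) \in Lfun (mu2 R) 2%:E.

Definition normL2 u : R := fine ('N[mu2 R]_2%:E [EFin \o (u \_ Omega)])%E.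

Definition dotL2 u v : R := \int[mu2 R]_(p in Omega) (u p * v p).

Definition Ck_bar (k : nat) u : Prop := Ck_closure (dirs R) Omega k u.

Definition zero_on_boundary u : Prop :=
  forall p, (closure Omega `\` Omega) p -> u p = 0.

Definition laplace u p : R := 'D_(e1 R) ('D_(e1 R) u) p + 'D_(e2 R) ('D_(e2 R) u) p.

(** Domain of [L_0 = - Delta]. *)
Definition in_D_L0 u : Prop := Ck_bar 2 u /\ zero_on_boundary u.

(** [C^oo_c(Omega)]. *)
Definition test_fun (phi : R * R -> R) : Prop :=
  [/\ forall k, Ck_closure (dirs R) setT k phi,
      compact (closure [set p | phi p != 0])
    & closure [set p | phi p != 0] `<=` Omega].

Definition is_weakD e u g : Prop :=
  inL2 g /\ forall phi, test_fun phi -> dotL2 u ('D_e phi) = - dotL2 g phi.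

Definition weakly_derivable e u : Prop := exists g, is_weakD e u g.

(** Weak partial derivative in [L^2(Omega)], determined up to [eqL2]. *)
Definition weakD e u : R * R -> R := xget (cst 0) [set g | is_weakD e u g].

Definition in_H10 u : Prop :=
  [/\ inL2 u, forall e, dirs R e -> weakly_derivable e u
    & exists phi : nat -> R * R -> R,
      [/\ forall n, test_fun (phi n),
          (fun n => normL2 (phi n \- u)) @ \oo --> (0 : R)
        & forall e, dirs R e ->
            (fun n => normL2 ('D_e (phi n) \- weakD e u)) @ \oo --> (0 : R)]].

(** The form [a(u, v) = (grad u, grad v)] on [H^1_0]. *)
Definition dirichlet u v : R :=
  dotL2 (weakD (e1 R) u) (weakD (e1 R) v) +
  dotL2 (weakD (e2 R) u) (weakD (e2 R) v).

(** [|| L^(1/2) u || = || grad u ||], with [D(L^(1/2)) = H^1_0]. *)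
Definition norm_Lhalf u : R := Num.sqrt (dirichlet u u).

(** The operator [L] associated with the form [a] on [H^1_0]. *)
Definition is_L u w : Prop :=
  inL2 w /\ forall v, in_H10 v -> dirichlet u v = dotL2 w v.

Definition in_D_L u : Prop := in_H10 u /\ exists w, is_L u w.

Definition opL u : R * R -> R := xget (cst 0) [set w | is_L u w].

Definition in_D_L2 u : Prop := in_D_L u /\ in_D_L (opL u).

(** [u_xx] and [u_yy] exist in [L^2(Omega)]. *)
Definition has_pure_second_derivatives u : Prop :=
  forall e, dirs R e -> weakly_derivable e u /\ weakly_derivable e (weakD e u).

Definition weak_laplace u : R * R -> R :=
  weakD (e1 R) (weakD (e1 R) u) \+ weakD (e2 R) (weakD (e2 R) u).

End Domain.

Section Time.
Context (R : realType) (Omega : set (R * R)) (T : R).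
Implicit Types (u v f : R -> R * R -> R).

Definition L2_valued u : Prop := forall t, t \in `[0, T] -> inL2 Omega (u t).

Definition continuous_in_time (N : (R * R -> R) -> R) u : Prop :=
  forall t, t \in `[0, T] ->
    (fun s => N (u s \- u t)) @ within `[0, T] (nbhs t) --> (0 : R).

Definition lipschitz_in_time (N : (R * R -> R) -> R) u : Prop :=
  exists K : R, forall s t, s \in `[0, T] -> t \in `[0, T] ->
    N (u s \- u t) <= K * `|s - t|.

(** Derivative in [L^2(Omega)], one-sided at [0] and [T]. *)
Definition is_timeD u (t : R) (d : R * R -> R) : Prop :=
  inL2 Omega d /\
  (fun s => normL2 Omega ((s - t)^-1 \*o (u s \- u t) \- d))
    @ within `[0, T] t^' --> (0 : R).

Definition timeD u : R -> R * R -> R :=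
  fun t => xget (cst 0) [set d | is_timeD u t d].

(** [u] is in [C^k([0, T]; L^2(Omega))]. *)
Fixpoint Ck_time (k : nat) u : Prop :=
  [/\ L2_valued u, continuous_in_time (normL2 Omega) u
    & if k is k'.+1 then
        (forall t, t \in `[0, T] -> exists d, is_timeD u t d) /\
        Ck_time k' (timeD u)
      else True].

(** [f] is in [C([0, T]; D(L^(1/2)))], with the graph norm on [D(L^(1/2))]. *)
Definition C_D_Lhalf f : Prop :=
  [/\ forall t, t \in `[0, T] -> in_H10 Omega (f t),
      continuous_in_time (normL2 Omega) f
    & continuous_in_time (norm_Lhalf Omega) f].

(** Equation and initial conditions hold in [L^2(Omega)]; [u_t] is the
    [L^2]-valued derivative, space derivatives are weak, and [u(t) = 0] on the
    boundary means [u(t)] in [H^1_0].  Classical solutions are covered. *)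
Definition is_solution (alpha beta : R -> R) f (u0 v0 : R * R -> R) u : Prop :=
  [/\ Ck_time 2 u,
      forall t, t \in `[0, T] ->
        in_H10 Omega (u t) /\ has_pure_second_derivatives Omega (u t),
      forall t, t \in `[0, T] ->
        eqL2 Omega
          (fun p => timeD (timeD u) t p
             - (alpha t + beta t * dirichlet Omega (u t) (u t))
               * weak_laplace Omega (u t) p)
          (f t),
      eqL2 Omega (u 0) u0
    & eqL2 Omega (timeD u 0) v0].

(** Hadamard well-posedness at the data [(f, u0, v0)]: existence, uniqueness,
    and continuous dependence, for data in
    [C([0, T]; D(L^(1/2))) * D(L) * D(L^(1/2))] and solutions in the energy
    norm.  Since [Omega] is bounded, the homogeneous norms below are equivalent
    to the graph norms. *)
Definition well_posed (alpha beta : R -> R) f (u0 v0 : R * R -> R) : Prop :=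
  [/\ exists u, is_solution alpha beta f u0 v0 u,
      forall u u', is_solution alpha beta f u0 v0 u ->
        is_solution alpha beta f u0 v0 u' ->
        forall t, t \in `[0, T] -> eqL2 Omega (u t) (u' t)
    & forall eps : R, 0 < eps -> exists2 delta : R, 0 < delta &
        forall f' u0' v0' u u',
          C_D_Lhalf f' -> in_D_L Omega u0' -> in_H10 Omega v0' ->
          (forall t, t \in `[0, T] -> norm_Lhalf Omega (f' t \- f t) < delta) ->
          normL2 Omega (opL Omega u0' \- opL Omega u0) < delta ->
          norm_Lhalf Omega (v0' \- v0) < delta ->
          is_solution alpha beta f u0 v0 u ->
          is_solution alpha beta f' u0' v0' u' ->
          forall t, t \in `[0, T] ->
            normL2 Omega (timeD u' t \- timeD u t) < eps /\
            norm_Lhalf Omega (u' t \- u t) < eps].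

(** [U 0, ..., U n] is a solution sequence of the scheme with step [T / n]. *)
Definition is_scheme_solution (alpha beta : R -> R) f (u0 v0 w0 : R * R -> R)
    (n : nat) (U : nat -> R * R -> R) : Prop :=
  let tau := T / n%:R in
  let t k := k%:R * tau in
  [/\ forall k, (k <= n)%N -> in_D_L Omega (U k),
      eqL2 Omega (U 0%N) u0,
      eqL2 Omega (U 1%N)
        (fun p => u0 p + tau * v0 p + tau ^+ 2 / 2 * w0 p)
    & forall k, (1 <= k < n)%N ->
      eqL2 Omega
        (fun p => (U k.+1 p - 2 * U k p + U k.-1 p) / tau ^+ 2
           + 2^-1 * (alpha (t k) + beta (t k) / 2 *
                 (norm_Lhalf Omega (U k.+1) ^+ 2
                  + norm_Lhalf Omega (U k.-1) ^+ 2))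
             * (opL Omega (U k.+1) p + opL Omega (U k.-1) p))
        (f (t k))].

End Time.

(* Main.v *)
Require Import Defs.
From mathcomp Require Import measurable_realfun ring lra.

Set Implicit Arguments.
Unset Strict Implicit.
Unset Printing Implicit Defensive.

Import Order.TTheory GRing.Theory Num.Theory.

Local Open Scope classical_set_scope.
Local Open Scope ring_scope.

(** The proof is an energy argument for the error [z_k = u(t_k) - U_k].

    Put [n_k = |grad u(t_k)|^2], [A_k = |grad z_k|^2] and
    [b_k = (grad u(t_k), grad z_k)], so that
    [|grad U_k|^2 = n_k - 2 b_k + A_k].  Subtract the scheme from the equation
    of [u] at [t_k] and test with [z_(k+1) - z_(k-1)].  The second difference
    yields the increment of [|z_(k+1) - z_k|^2 / tau^2].  The elliptic term
    carries a coefficient that depends on the unknown through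
    [A_(k+1) + A_(k-1)], and multiplies [A_(k+1) - A_(k-1)]: the product is a
    difference of squares, so that the nonlinearity adds the nonnegative
    quartic part [beta_k / 4 (A_(k+1)^2 + A_k^2)] to the energy instead of
    spoiling the estimate ([energy_increment]).  All that is left is of size
    [tau] times the energy, up to the truncation error ([energy_step]), and a
    discrete Gronwall inequality concludes ([scheme_energy_bound]).

    This requires the coefficient [alpha_k + beta_k / 2 (n_(k+1) + n_(k-1))
    - beta_k (b_(k+1) + b_(k-1))] of the quadratic part of the energy to stay
    above a positive constant and to vary by [O(tau)].  Since
    [b_k = (L u(t_k), z_k)] by Green's formula, both follow from a bound on the
    discrete velocity of [z], which the same estimate provides when it is
    applied with [0] in place of [u] ([scheme_velocity_bound]): then [b = 0].
    As [z_0 = 0], on a short time interval [z_k], hence [b_k], is small.  This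
    is why the result is local in time.  The velocity of [z] then is
    [O(tau^2)] ([scheme_convergence]), and adding Taylor's formula for [u] gives
    the theorem.

    The scheme is consistent for two reasons.  The truncation error is
    [O(tau^2)] because [u] is of class [C^(3,1)] and [L u] of class [C^(1,1)] in
    time ([residual_bound]); Taylor's formula in [L^2] is the real one applied
    to the product with the remainder ([taylor_L2]).  The starting error is
    [O(tau^3)] in [L^2] and [O(tau^2)] in the energy norm because
    [w_0 = u_tt(0)] ([start_error]).

    In the last point [w_0] is made of classical derivatives of [u_0] and
    [u_tt(0)] of weak ones.  They are compared through Green's formula for
    functions that are smooth up to the boundary, which on a convex domain is
    the fundamental theorem of calculus on chords followed by Fubini
    ([integration_by_parts_plane]), and through duality.  Let [N] be the set of
    the functions of [L^2] that are orthogonal to all test functions.  Weak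
    derivatives are determined modulo [N] by their definition, whereas
    functions in [H^1_0], their weak derivatives, and the time derivatives of
    both belong to the closed space orthogonal to [N] ([test_span]).  Two
    candidates in this space that agree modulo [N] are equal. *)

(** * Semi-inner products on a predicate *)

Lemma subrACA (V : zmodType) (x y z t : V) : x - y - (z - t) = x - z - (y - t).
Proof. by rewrite !opprD !opprK addrACA. Qed.

(** Elements of [L^2] are represented by functions on the whole plane, on which
    the scalar product is linear only under an integrability condition and is
    not definite.  Hence a predicate [S] that is stable under linear
    combinations takes the place of a subspace. *)
Record semi_inner (R : realType) (V : lmodType R) (S : V -> Prop)
    (d : V -> V -> R) : Prop := SemiInner {
  sinner0 : S 0;
  sinnerP : forall a x y, S x -> S y -> S (a *: x + y);
  sinnerC : forall x y, d x y = d y x;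
  sinner_linear : forall a x y z, S x -> S y -> S z ->
    d (a *: x + y) z = a * d x z + d y z;
  sinner_ge0 : forall x, S x -> 0 <= d x x }.

Section SemiInnerTheory.
Context (R : realType) (V : lmodType R) (S : V -> Prop) (d : V -> V -> R).
Hypothesis sd : semi_inner S d.
Implicit Types (x y z : V) (a b : R).

Let S0 := sinner0 sd.
Let SP := sinnerP sd.

Lemma sinner_memZ a x : S x -> S (a *: x).
Proof. by move=> Sx; rewrite -[_ *: _]addr0; apply: SP. Qed.

Lemma sinner_memD x y : S x -> S y -> S (x + y).
Proof. by move=> Sx Sy; rewrite -[x]scale1r; apply: SP. Qed.

Lemma sinner_memN x : S x -> S (- x).
Proof. by move=> Sx; rewrite -scaleN1r; apply: sinner_memZ. Qed.

Lemma sinner_memB x y : S x -> S y -> S (x - y).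
Proof. by move=> Sx Sy; apply: sinner_memD => //; apply: sinner_memN. Qed.

Lemma sinnerDl x y z : S x -> S y -> S z -> d (x + y) z = d x z + d y z.
Proof.
by move=> Sx Sy Sz; rewrite -[x in LHS]scale1r (sinner_linear sd) ?mul1r.
Qed.

Lemma sinner0l z : S z -> d 0 z = 0.
Proof.
move=> Sz; have := sinnerDl S0 S0 Sz; rewrite addr0 => h.
by apply: (addrI (d 0 z)); rewrite addr0 -h.
Qed.

Lemma sinnerZl a x z : S x -> S z -> d (a *: x) z = a * d x z.
Proof.
move=> Sx Sz; rewrite -[_ *: _]addr0 (sinner_linear sd) //.
by rewrite sinner0l ?addr0.
Qed.

Lemma sinnerNl x z : S x -> S z -> d (- x) z = - d x z.
Proof. by move=> Sx Sz; rewrite -scaleN1r sinnerZl ?mulN1r. Qed.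

Lemma sinnerBl x y z : S x -> S y -> S z -> d (x - y) z = d x z - d y z.
Proof.
by move=> Sx Sy Sz; rewrite sinnerDl ?sinnerNl //; apply: sinner_memN.
Qed.

Lemma sinnerDr x y z : S x -> S y -> S z -> d x (y + z) = d x y + d x z.
Proof. by move=> *; rewrite !(sinnerC sd x) sinnerDl. Qed.

Lemma sinnerBr x y z : S x -> S y -> S z -> d x (y - z) = d x y - d x z.
Proof. by move=> *; rewrite !(sinnerC sd x) sinnerBl. Qed.

Lemma sinnerZr a x z : S x -> S z -> d x (a *: z) = a * d x z.
Proof. by move=> *; rewrite !(sinnerC sd x) sinnerZl. Qed.

Lemma sinner_subr_sqr x y : S x -> S y -> d (x - y) (x + y) = d x x - d y y.
Proof.
move=> Sx Sy; rewrite sinnerBl ?sinnerDr //; last exact: sinner_memD.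
by rewrite (sinnerC sd y x); ring.
Qed.

Definition snorm x : R := Num.sqrt (d x x).

Lemma snorm_ge0 x : 0 <= snorm x. Proof. exact: sqrtr_ge0. Qed.

Lemma snorm_sqr x : S x -> snorm x ^+ 2 = d x x.
Proof. by move=> Sx; rewrite sqr_sqrtr ?(sinner_ge0 sd). Qed.

(** The quadratic polynomial in [a] equal to [d (a *: x + y) (a *: x + y)] is
    nonnegative; when [d x x = 0] it is affine, hence constant. *)
Lemma sinner_CauchySchwarz x y : S x -> S y -> d x y ^+ 2 <= d x x * d y y.
Proof.
move=> Sx Sy.
have quad a : 0 <= d x x * a ^+ 2 + 2 * d x y * a + d y y.
  have Sax := sinner_memZ a Sx.
  have /(sinner_ge0 sd) := sinner_memD Sax Sy.
  rewrite sinnerDl ?sinnerDr ?(sinnerZl, sinnerZr) //;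
    do ?by apply: sinner_memD.
  by rewrite (sinnerC sd y x); congr (_ <= _); ring.
have := sinner_ge0 sd Sx; rewrite le_eqVlt => /predU1P[dxx|dxx].
  rewrite -dxx mul0r.
  have [->|dxy] := eqVneq (d x y) 0; first by rewrite expr0n.
  have := quad (- (d y y + 1) / (2 * d x y)).
  rewrite -dxx mul0r add0r mulrC divfK ?mulf_neq0 ?pnatr_eq0 //; lra.
have := quad (- d x y / d x x).
move=> /(mulr_ge0 (ltW dxx)); rewrite -[in X in _ -> X]subr_ge0.
by congr (_ <= _); field; rewrite gt_eqF.
Qed.

Lemma sinner_le x y : S x -> S y -> `|d x y| <= snorm x * snorm y.
Proof.
move=> Sx Sy; rewrite -(@ler_pXn2r _ 2) ?nnegrE ?mulr_ge0 ?snorm_ge0 //.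
by rewrite exprMn !snorm_sqr // real_normK ?num_real // sinner_CauchySchwarz.
Qed.

Lemma snormD x y : S x -> S y -> snorm (x + y) <= snorm x + snorm y.
Proof.
move=> Sx Sy; have Sxy := sinner_memD Sx Sy.
rewrite -(@ler_pXn2r _ 2) ?nnegrE ?addr_ge0 ?snorm_ge0 //.
rewrite sqrrD !snorm_sqr // sinnerDl // !sinnerDr // (sinnerC sd y x).
have := le_trans (ler_norm _) (sinner_le Sx Sy).
rewrite mulr2n; lra.
Qed.

Lemma snormZ a x : S x -> snorm (a *: x) = `|a| * snorm x.
Proof.
move=> Sx; have Sax := sinner_memZ a Sx.
rewrite /snorm sinnerZl // sinnerZr // mulrA -expr2.
by rewrite sqrtrM ?sqr_ge0 // sqrtr_sqr.
Qed.

Lemma snormN x : S x -> snorm (- x) = snorm x.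
Proof. by move=> Sx; rewrite -scaleN1r snormZ // normrN1 mul1r. Qed.

Lemma snormB x y : S x -> S y -> snorm (x - y) <= snorm x + snorm y.
Proof.
move=> Sx Sy; rewrite -(snormN Sy); apply: snormD => //.
exact: sinner_memN.
Qed.

Lemma snorm_dist x y : S x -> S y -> `|snorm x - snorm y| <= snorm (x - y).
Proof.
move=> Sx Sy; have Sxy := sinner_memB Sx Sy.
have := snormD Sxy Sy; rewrite subrK.
have := snormD (sinner_memN Sxy) Sx; rewrite snormN // opprB subrK.
rewrite ler_norml; lra.
Qed.

(** Taking the remainder itself as the test vector turns a bound on its
    products into a bound on its norm. *)
Lemma snorm_le_dual x c : S x -> 0 <= c ->
  (forall y, S y -> d x y <= c * snorm y) -> snorm x <= c.
Proof.
move=> Sx c0 /(_ x Sx); rewrite -snorm_sqr // expr2.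
have := snorm_ge0 x; rewrite le_eqVlt => /predU1P[<-//|x0].
by rewrite ler_pM2r.
Qed.

End SemiInnerTheory.

(** The gradient is treated as a pair of functions, and the Dirichlet form as
    the product of gradients. *)
Lemma semi_inner_pair (R : realType) (V : lmodType R) (S : V -> Prop)
    (d : V -> V -> R) : semi_inner S d ->
  semi_inner (V := (V * V)%type) (fun w => S w.1 /\ S w.2)
    (fun w w' => d w.1 w'.1 + d w.2 w'.2).
Proof.
move=> sd; split.
- by split; exact: (sinner0 sd).
- by move=> a x y [? ?] [? ?]; split; exact: (sinnerP sd).
- by move=> x y; rewrite (sinnerC sd x.1) (sinnerC sd x.2).
- move=> a x y z [? ?] [? ?] [? ?].
  by rewrite !(sinner_linear sd) // mulrDr addrACA.
- by move=> x [? ?]; rewrite addr_ge0 ?(sinner_ge0 sd).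
Qed.

(** * The energy of a Kirchhoff-type scheme *)

(** The implicit term [e k.+1] is absorbed because [C * h] is small, and the
    total growth factor stays below [2] because [C * h * m] is: over a short
    time no exponential is needed. *)
Lemma discrete_gronwall (R : realFieldType) (e : nat -> R) (C h r : R) (m : nat) :
  0 <= C -> 0 <= h -> 0 <= r ->
  (forall k, (k < m)%N -> 0 <= e k) ->
  C * h * m%:R <= 8^-1 ->
  (forall k, (k.+1 < m)%N -> e k.+1 <= e k + C * h * (e k.+1 + e k) + h * r) ->
  forall k, (k < m)%N -> e k <= 2 * e 0%N + 4 * (m%:R * h) * r.
Proof.
move=> C0 h0 r0 e0 Chm step.
have Ch0 : 0 <= C * h by exact: mulr_ge0.
have small k : (k < m)%N -> C * h * k.+1%:R <= 8^-1.
  by move=> km; apply: le_trans Chm; rewrite ler_wpM2l // ler_nat.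
have rec k : (k < m)%N ->
    e k <= (1 + 8 * (C * h * k%:R)) * (e 0%N + 2 * (k%:R * h) * r).
  elim: k => [_|k IH km]; first by rewrite mulr0 mul0r !mulr0 mul0r !addr0 mul1r.
  have /IH {}IH := ltn_trans (ltnSn k) km.
  have := step _ km; have := small _ (ltn_trans (ltnSn k) km).
  rewrite -natr1; have k0 : 0 <= k%:R :> R by [].
  set x := C * h in Ch0 IH *; set y := k%:R in k0 IH *.
  set E := e 0%N + 2 * (y * h) * r in IH *.
  have E0 : 0 <= E by rewrite addr_ge0 ?e0 ?mulr_ge0 //; case: (m) km.
  move=> xy st.
  have x8 : x <= 8^-1.
    apply: le_trans xy; rewrite mulrDr mulr1 lerDr; exact: mulr_ge0.
  have xy0 : 0 <= x * y by exact: mulr_ge0.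
  (* dividing by 1 - x, as (1 + x) / (1 - x) <= 1 + 4 x *)
  have st1 : e k.+1 <= (1 + 4 * x) * e k + 2 * (h * r).
    have xek := mulr_ge0 Ch0 (e0 _ (ltn_trans (ltnSn k) km)).
    have xek' := mulr_ge0 Ch0 (e0 _ km).
    have hr := mulr_ge0 h0 r0.
    have x1 : 0 < 1 - x by lra.
    rewrite -(ler_pM2l x1).
    have xx : x * (x * e k) <= 8^-1 * (x * e k) by rewrite ler_wpM2r.
    have xhr : x * (h * r) <= 8^-1 * (h * r) by rewrite ler_wpM2r.
    rewrite (_ : (1 - x) * ((1 + 4 * x) * e k + 2 * (h * r)) =
      e k + 3 * (x * e k) - 4 * (x * (x * e k)) + 2 * (h * r) - 2 * (x * (h * r)));
      last by ring.
    lra.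
  apply: le_trans st1 _.
  have x4 : 0 <= 1 + 4 * x by lra.
  apply: (@le_trans _ _ ((1 + 4 * x) * ((1 + 8 * (x * y)) * E) + 2 * (h * r))).
    by rewrite lerD2r ler_wpM2l.
  have -> : e 0%N + 2 * ((y + 1) * h) * r = E + 2 * (h * r) by rewrite /E; ring.
  have hr := mulr_ge0 h0 r0.
  have xxy : x * (x * y) <= 8^-1 * x.
    rewrite [leRHS]mulrC ler_wpM2l //; move: xy; rewrite mulrDr mulr1; lra.
  have p1 : 0 <= (4 * x - 32 * (x * (x * y))) * E by apply: mulr_ge0 => //; lra.
  have p2 : 0 <= h * r * (x * y + x) by rewrite mulr_ge0 // addr_ge0.
  lra.
move=> k km; apply: le_trans (rec k km) _.
have kh : k%:R * h * r <= m%:R * h * r.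
  by rewrite ler_wpM2r // ler_wpM2r // ler_nat ltnW.
have k0 : 0 <= k%:R * h * r by rewrite !mulr_ge0.
have lek : 1 + 8 * (C * h * k%:R) <= 2.
  have := small _ km; rewrite -natr1 mulrDr; lra.
apply: (@le_trans _ _ (2 * (e 0%N + 2 * (k%:R * h) * r))).
  apply: ler_wpM2r => //; rewrite addr_ge0 ?e0 ?mulr_ge0 //; exact: leq_ltn_trans km.
lra.
Qed.

Section Energy.
Context (R : realFieldType) (nd A b nn al be s rho : nat -> R).

(** Here [nd] is the norm of the discrete velocity of the error, [A] and [nn]
    are the squared norms of the gradients of the error and of the exact
    solution, [b] is the product of these gradients, and [s], [rho] are the
    products of [L u] and of the truncation error with the test vector. *)
Definition exact_coeff k : R := al k + be k / 2 * (nn k.+1 + nn k.-1).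

(** The coefficient of the scheme, as
    [|grad U|^2 = |grad u|^2 - (2 b - A)]. *)
Definition scheme_coeff k : R :=
  exact_coeff k - be k / 2 * (2 * b k.+1 - A k.+1 + (2 * b k.-1 - A k.-1)).

Definition energy_coeff k : R := exact_coeff k - be k * (b k.+1 + b k.-1).

Definition energy k : R := nd k ^+ 2 + energy_coeff k / 2 * (A k.+1 + A k)
  + be k / 4 * (A k.+1 ^+ 2 + A k ^+ 2).

(** The error equation tested with [z_(k+1) - z_(k-1)]. *)
Definition energy_balance k : Prop :=
  nd k ^+ 2 - nd k.-1 ^+ 2 + scheme_coeff k / 2 * (A k.+1 - A k.-1)
  + (exact_coeff k - scheme_coeff k) / 2 * s k = rho k.

(** The nonlinear part of [scheme_coeff] contributes
    [(A (k+1) + A (k-1)) (A (k+1) - A (k-1))], the increment of the quartic part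
    of the energy. *)
Lemma energy_increment k : energy_balance k.+1 ->
  energy k.+1 - energy k =
    (energy_coeff k.+1 - energy_coeff k) / 2 * (A k.+1 + A k)
    + (be k.+1 - be k) / 4 * (A k.+1 ^+ 2 + A k ^+ 2)
    - be k.+1 / 4 * ((2 * b k.+2 - A k.+2 + (2 * b k - A k)) * s k.+1)
    + rho k.+1.
Proof.
rewrite /energy_balance /= => <-.
rewrite /scheme_coeff /energy /energy_coeff /=.
have : (2 : R) != 0 by rewrite pnatr_eq0.
set q := exact_coeff _; set q' := exact_coeff _.
by move=> ?; field.
Qed.

Context (c K B S r n0 h : R).
Hypotheses (c_gt0 : 0 < c) (h_ge0 : 0 <= h) (K_ge0 : 0 <= K) (B_ge0 : 0 <= B)
  (S_ge0 : 0 <= S) (n0_ge0 : 0 <= n0).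
Hypotheses (nd_ge0 : forall k, 0 <= nd k) (A_ge0 : forall k, 0 <= A k).

(** The first summand comes from the variation of the coefficients, the second
    from the part of the nonlinear term that does not telescope, the last from
    Young's inequality for the truncation error. *)
Definition energy_const : R :=
  2 * K / c + B * S / 8 * ((32 * n0 + 16) / c + 2) + 2^-1.

Lemma energy_const_ge0 : 0 <= energy_const.
Proof.
have c0 := ltW c_gt0.
by rewrite /energy_const !(addr_ge0, mulr_ge0, invr_ge0).
Qed.

Lemma energy_lower k : c <= energy_coeff k -> c <= be k ->
  nd k ^+ 2 + c / 2 * (A k.+1 + A k) + c / 4 * (A k.+1 ^+ 2 + A k ^+ 2)
  <= energy k.
Proof.
move=> pc bc; rewrite /energy; apply: lerD; first apply: lerD => //.
  by rewrite ler_wpM2r ?addr_ge0 // ler_wpM2r // invr_ge0.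
by rewrite ler_wpM2r ?addr_ge0 ?sqr_ge0 // ler_wpM2r // invr_ge0.
Qed.

(** Every term of [energy_increment] is bounded by the energy: [b ^+ 2 <= n0 * A]
    makes [2 b - A] of the order of the square root of the energy, and so is
    [s / h]. *)
Lemma energy_step k :
  energy_balance k.+1 ->
  c <= energy_coeff k -> c <= energy_coeff k.+1 ->
  `|energy_coeff k.+1 - energy_coeff k| <= K * h ->
  c <= be k -> c <= be k.+1 -> be k.+1 <= B -> `|be k.+1 - be k| <= K * h ->
  b k ^+ 2 <= n0 * A k -> b k.+2 ^+ 2 <= n0 * A k.+2 ->
  `|s k.+1| <= S * h * (nd k.+1 + nd k) ->
  `|rho k.+1| <= h * r * (nd k.+1 + nd k) ->
  energy k.+1 <=
    energy k + energy_const * h * (energy k.+1 + energy k) + h * r ^+ 2.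
Proof.
move=> /energy_increment inc pk pk' dp bk bk' bB db bA bA' sk rk.
have E1 := energy_lower pk bk; have E2 := energy_lower pk' bk'.
set X := A k.+1 ^+ 2 + A k ^+ 2 in inc E1.
have X0 : 0 <= X by rewrite addr_ge0 ?sqr_ge0.
have Y0 : 0 <= A k.+1 + A k by rewrite addr_ge0.
set E := energy k in inc E1 *; set E' := energy k.+1 in inc E2 *.
set Y := A k.+1 + A k in inc Y0 E1.
have Z0 : 0 <= A k.+2 ^+ 2 + A k.+1 ^+ 2 by rewrite addr_ge0 ?sqr_ge0.
have W0 : 0 <= A k.+2 + A k.+1 by rewrite addr_ge0.
have cY : 0 <= c * Y by rewrite mulr_ge0 // ltW.
have cX : 0 <= c * X by rewrite mulr_ge0 // ltW.
have cZ : 0 <= c * (A k.+2 ^+ 2 + A k.+1 ^+ 2) by rewrite mulr_ge0 // ltW.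
have cW : 0 <= c * (A k.+2 + A k.+1) by rewrite mulr_ge0 // ltW.
have N1 := sqr_ge0 (nd k); have N2 := sqr_ge0 (nd k.+1).
have E0 : 0 <= E by apply: le_trans E1; lra.
have E0' : 0 <= E' by apply: le_trans E2; lra.
have ic0 : 0 < c^-1 by rewrite invr_gt0.
have cV x y a : c * x <= a * y -> x <= a * (c^-1 * y).
  by rewrite mulrCA ler_pdivlMl.
have YE : Y <= 2 * (c^-1 * E).
  by apply: cV; lra.
have XE : X <= 4 * (c^-1 * E).
  by apply: cV; lra.
have Kh0 : 0 <= K * h by rewrite mulr_ge0.
have t3 : (energy_coeff k.+1 - energy_coeff k) / 2 * Y <= K * h / c * E.
  apply: (@le_trans _ _ (K * h / 2 * Y)).
    rewrite ler_wpM2r // ler_wpM2r ?invr_ge0 //.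
    exact: le_trans (ler_norm _) dp.
  have := ler_wpM2l Kh0 YE; lra.
have t4 : (be k.+1 - be k) / 4 * X <= K * h / c * E.
  apply: (@le_trans _ _ (K * h / 4 * X)).
    rewrite ler_wpM2r // ler_wpM2r ?invr_ge0 //.
    exact: le_trans (ler_norm _) db.
  have := ler_wpM2l Kh0 XE; lra.
have t2 : rho k.+1 <= h * r ^+ 2 + 2^-1 * h * (E' + E).
  apply: le_trans (ler_norm _) (le_trans rk _).
  have := sqr_ge0 (r - nd k.+1); have := sqr_ge0 (r - nd k) => a1 a2.
  have : r * (nd k.+1 + nd k) <= r ^+ 2 + 2^-1 * (E' + E).
    move: a1 a2; rewrite !sqrrB; lra.
  move=> /(ler_wpM2l h_ge0); lra.
set w := 2 * b k.+2 - A k.+2 + (2 * b k - A k) in inc.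
have w2 : w ^+ 2 <= (32 * n0 + 16) / c * (E' + E).
  apply: (@le_trans _ _ (4 * (4 * (n0 * A k.+2) + A k.+2 ^+ 2 + (4 * (n0 * A k) + A k ^+ 2)))).
    have := sqr_ge0 (2 * b k.+2 + A k.+2); have := sqr_ge0 (2 * b k + A k).
    have := sqr_ge0 (2 * b k.+2 - A k.+2 - (2 * b k - A k)).
    rewrite /w; lra.
  have AE : A k <= 2 * (c^-1 * E) by have := A_ge0 k.+1; move: YE; rewrite /Y; lra.
  have AE2 : A k ^+ 2 <= 4 * (c^-1 * E).
    by have := sqr_ge0 (A k.+1); move: XE; rewrite /X; lra.
  have AE' : A k.+2 <= 2 * (c^-1 * E').
    apply: cV; have := mulr_ge0 (ltW c_gt0) (A_ge0 k.+1); lra.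
  have AE2' : A k.+2 ^+ 2 <= 4 * (c^-1 * E').
    apply: cV; have := mulr_ge0 (ltW c_gt0) (sqr_ge0 (A k.+1)); lra.
  have := ler_wpM2l n0_ge0 AE; have := ler_wpM2l n0_ge0 AE'; lra.
have t1 : - (be k.+1 / 4 * (w * s k.+1)) <=
    B * S / 8 * ((32 * n0 + 16) / c + 2) * h * (E' + E).
  apply: le_trans (ler_norm _) _; rewrite normrN normrM.
  have b4 : `|be k.+1 / 4| <= B / 4.
    by rewrite ger0_norm ?ler_wpM2r ?invr_ge0 ?divr_ge0 //; apply: le_trans (ltW c_gt0) _.
  apply: (@le_trans _ _ (B / 4 * (`|w| * (S * h * (nd k.+1 + nd k))))).
    by apply: ler_pM => //; rewrite normrM ler_wpM2l.
  have wn : `|w| * (nd k.+1 + nd k) <=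
      2^-1 * (((32 * n0 + 16) / c + 2) * (E' + E)).
    have := sqr_ge0 (`|w| - (nd k.+1 + nd k)).
    have := sqr_ge0 (nd k.+1 - nd k).
    move: w2; rewrite -[w ^+ 2]real_normK ?num_real //; lra.
  have BS : 0 <= B / 4 * (S * h) by rewrite !mulr_ge0 ?invr_ge0.
  have := ler_wpM2l BS wn; lra.
have KhE : 0 <= K * h / c * E' by rewrite mulr_ge0 // mulr_ge0 // ltW.
have KhE2 : 0 <= K * h / c * E by rewrite mulr_ge0 // mulr_ge0 // ltW.
rewrite /energy_const; move: inc t1 t2 t3 t4 KhE KhE2.
lra.
Qed.

End Energy.

(** * Energy estimate for an abstract scheme *)

Section SchemeEnergy.
Context (R : realType) (V W : lmodType R) (S : V -> Prop) (S' : W -> Prop).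
Context (d : V -> V -> R) (a : W -> W -> R).
Hypotheses (sd : semi_inner S d) (sa : semi_inner S' a).

(** Green's formula [a(x, y) = (L x, y)], where [gx] and [gy] are the gradients
    of [x] and [y]. *)
Definition green (L : nat -> V) (gx : nat -> W) (y : nat -> V)
    (gy : nat -> W) : Prop :=
  forall k j, a (gx k) (gy j) = d (L k) (y j).

Context (x X L LX f : nat -> V) (gx gX : nat -> W) (al be : nat -> R)
  (h : R) (m : nat).
Hypotheses (h_gt0 : 0 < h).
Hypotheses (Sx : forall k, S (x k)) (SX : forall k, S (X k))
  (SL : forall k, S (L k)) (SLX : forall k, S (LX k)) (Sf : forall k, S (f k))
  (Sgx : forall k, S' (gx k)) (SgX : forall k, S' (gX k)).
Hypotheses (gxx : green L gx x gx) (gxX : green L gx X gX)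
  (gXx : green LX gX x gx) (gXX : green LX gX X gX).

Let nx k := a (gx k) (gx k).
Let nX k := a (gX k) (gX k).
Let z k := x k - X k.
Let gz k := gx k - gX k.

Hypothesis scheme : forall k, (k.+1 < m)%N -> forall v, S v ->
  d (X k.+2 - X k.+1 - (X k.+1 - X k)) v
  + h ^+ 2 / 2 * (al k.+1 + be k.+1 / 2 * (nX k.+2 + nX k))
    * d (LX k.+2 + LX k) v = h ^+ 2 * d (f k.+1) v.

Let nd k := snorm d (z k.+1 - z k) / h.
Let A k := snorm a (gz k) ^+ 2.
Let b k := a (gx k) (gz k).

Definition residual k : V := h ^- 2 *: (x k.+1 - x k - (x k - x k.-1))
  + (exact_coeff nx al be k / 2) *: (L k.+1 + L k.-1) - f k.

Let s k := d (L k.+1 + L k.-1) (z k.+1 - z k.-1).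
Let rho k := d (residual k) (z k.+1 - z k.-1).

Let Sz k : S (z k). Proof. exact: (sinner_memB sd). Qed.
Let Sgz k : S' (gz k). Proof. exact: (sinner_memB sa). Qed.
Let SDz k : S (z k.+2 - z k). Proof. exact: (sinner_memB sd). Qed.

Lemma residual_mem k : S (residual k).
Proof.
apply: (sinner_memB sd) => //; apply: (sinner_memD sd).
  apply: (sinner_memZ sd); apply: (sinner_memB sd); first exact: (sinner_memB sd).
  by apply: (sinner_memB sd).
by apply: (sinner_memZ sd); apply: (sinner_memD sd).
Qed.

Let nXE k : nX k = nx k - 2 * b k + A k.
Proof.
rewrite /A (snorm_sqr sa) // /b /gz /nX /nx.
rewrite !(sinnerBl sa) // ?(sinnerBr sa) //; try exact: (sinner_memB sa).
by rewrite (sinnerC sa (gX k) (gx k)); ring.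
Qed.

(** The second difference pairs with [z_(k+1) - z_(k-1)], the sum of two
    consecutive velocities, to a difference of squares, and so does
    [L z_(k+1) + L z_(k-1)] by Green's formula and the symmetry of [a]. *)
Lemma scheme_balance k : (k.+1 < m)%N ->
  energy_balance nd A b nx al be s rho k.+1.
Proof.
move=> km; have := scheme km (SDz k).
have h0 : h != 0 by rewrite gt_eqF.
set D := z k.+2 - z k.
set q := al k.+1 + _.
have qE : scheme_coeff A b nx al be k.+1 = q.
  by rewrite /scheme_coeff /exact_coeff /q !nXE /=; field.
rewrite /energy_balance qE /= => sch.
have -> : nd k.+1 ^+ 2 - nd k ^+ 2 = h ^- 2 * d (z k.+2 - z k.+1 - (z k.+1 - z k)) D.
  rewrite /nd !expr_div_n !(snorm_sqr sd) //; try exact: (sinner_memB sd).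
  have -> : D = (z k.+2 - z k.+1) + (z k.+1 - z k) by rewrite /D addrA subrK.
  have S1 : S (z k.+2 - z k.+1) by exact: (sinner_memB sd).
  have S2 : S (z k.+1 - z k) by exact: (sinner_memB sd).
  by rewrite (sinner_subr_sqr sd) //; field.
have -> : A k.+2 - A k = s k.+1 - d (LX k.+2 + LX k) D.
  rewrite /A !(snorm_sqr sa) // /s /= /D.
  have gzz i j : a (gz i) (gz j) = d (L i) (z j) - d (LX i) (z j).
    rewrite /gz (sinnerBl sa) //; last exact: (sinner_memB sa).
    by rewrite !(sinnerBr sa) // gxx gxX gXx gXX /z !(sinnerBr sd).
  have := sinnerC sa (gz k.+2) (gz k); rewrite !gzz.
  rewrite !(sinnerDl sd (SL _) (SL _) (SDz _)) !(sinnerDl sd (SLX _) (SLX _) (SDz _)).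
  rewrite !(sinnerBr sd (SL _) (Sz _) (Sz _)) !(sinnerBr sd (SLX _) (Sz _) (Sz _)).
  lra.
have -> : rho k.+1 = h ^- 2 * d (x k.+2 - x k.+1 - (x k.+1 - x k)) D
    + exact_coeff nx al be k.+1 / 2 * s k.+1 - d (f k.+1) D.
  have Sxx : S (x k.+2 - x k.+1 - (x k.+1 - x k)).
    by do !apply: (sinner_memB sd).
  have SLL : S (L k.+2 + L k) by exact: (sinner_memD sd).
  have Sxx' := sinner_memZ sd (h ^- 2) Sxx.
  have SLL' := sinner_memZ sd (exact_coeff nx al be k.+1 / 2) SLL.
  rewrite /rho /residual /= -/D.
  rewrite (sinnerBl sd (sinner_memD sd Sxx' SLL') (Sf _) (SDz _)).
  by rewrite (sinnerDl sd Sxx' SLL' (SDz _)) !(sinnerZl sd).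
have -> : d (z k.+2 - z k.+1 - (z k.+1 - z k)) D =
    d (x k.+2 - x k.+1 - (x k.+1 - x k)) D - d (X k.+2 - X k.+1 - (X k.+1 - X k)) D.
  rewrite -(sinnerBl sd) //; try by do !apply: (sinner_memB sd).
  by rewrite /z; congr (d _ _); rewrite [RHS]subrACA; congr (_ - _); exact: subrACA.
move: sch; rewrite -/D => sch.
have fE : d (f k.+1) D = h ^- 2 * d (X k.+2 - X k.+1 - (X k.+1 - X k)) D
   + q / 2 * d (LX k.+2 + LX k) D.
  apply: (mulfI (_ : h ^+ 2 != 0)); first by rewrite expf_neq0.
  by rewrite -sch; field.
by rewrite fE; ring.
Qed.

Lemma scheme_energy_bound (c K B G r n0 : R) :
  0 < c -> 0 <= K -> 0 <= B -> 0 <= G -> 0 <= n0 -> 0 <= r ->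
  (forall k, snorm d (L k) <= G) -> (forall k, snorm a (gx k) <= n0) ->
  (forall k, (0 < k < m)%N -> snorm d (residual k) <= r) ->
  (forall k, c <= be k <= B) -> (forall k, `|be k.+1 - be k| <= K * h) ->
  (forall k, (k < m)%N -> c <= energy_coeff b nx al be k) ->
  (forall k, (k.+1 < m)%N ->
    `|energy_coeff b nx al be k.+1 - energy_coeff b nx al be k| <= K * h) ->
  energy_const c K B (2 * G) (n0 ^+ 2) * h * m%:R <= 8^-1 ->
  forall k, (k < m)%N -> nd k ^+ 2 <=
    2 * energy nd A b nx al be 0 + 4 * (m%:R * h) * r ^+ 2.
Proof.
move=> c0 K0 B0 G0 n00 r0 LG gxn resr bec beK pc pK small k km.
have A0 j : 0 <= A j by exact: sqr_ge0.
have nd0 j : 0 <= nd j by rewrite divr_ge0 ?snorm_ge0 ?ltW.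
have bbe j : c <= be j by case/andP: (bec j).
have bbeB j : be j <= B by case/andP: (bec j).
have enl j : (j < m)%N -> nd j ^+ 2 <= energy nd A b nx al be j.
  move=> jm; apply: le_trans (energy_lower nd A0 (pc _ jm) (bbe _)).
  by rewrite -addrA lerDl addr_ge0 // mulr_ge0 ?divr_ge0 ?addr_ge0 ?sqr_ge0 ?(ltW c0).
apply: (le_trans (enl _ km)).
have n02 : 0 <= n0 ^+ 2 by exact: sqr_ge0.
have G2 : 0 <= 2 * G by rewrite mulr_ge0.
have C0 := energy_const_ge0 c0 K0 B0 G2 n02.
apply: (discrete_gronwall C0 (ltW h_gt0) (sqr_ge0 r) _ small) => // [j jm|j jm].
  by apply: le_trans (enl _ jm); exact: sqr_ge0.
have bA i : b i ^+ 2 <= n0 ^+ 2 * A i.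
  rewrite -exprMn -[b i ^+ 2]real_normK ?num_real //.
  rewrite lerXn2r ?nnegrE ?mulr_ge0 ?snorm_ge0 //.
  apply: le_trans (sinner_le sa (Sgx i) (Sgz i)) _.
  by rewrite ler_wpM2r ?snorm_ge0.
have zz : snorm d (z j.+2 - z j) <= h * (nd j.+1 + nd j).
  have -> : h * (nd j.+1 + nd j) = snorm d (z j.+2 - z j.+1) + snorm d (z j.+1 - z j).
    by rewrite /nd; field; rewrite gt_eqF.
  have -> : z j.+2 - z j = (z j.+2 - z j.+1) + (z j.+1 - z j) by rewrite addrA subrK.
  by apply: (snormD sd); exact: (sinner_memB sd).
apply: (energy_step (rho := rho) (s := s)) => //.
- exact: ltW.
- exact: scheme_balance.
- by apply: pc; exact: ltn_trans jm.
- exact: pc.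
- exact: pK.
- rewrite /s /=; apply: le_trans (sinner_le sd _ (SDz j)) _.
    exact: (sinner_memD sd).
  rewrite -mulrA; apply: ler_pM; rewrite ?snorm_ge0 //.
  apply: le_trans (snormD sd (SL _) (SL _)) _.
  by have := LG j.+2; have := LG j; lra.
- rewrite /rho; apply: le_trans (sinner_le sd (residual_mem _) (SDz j)) _.
  rewrite -mulrA mulrCA; apply: ler_pM; rewrite ?snorm_ge0 //.
  exact: resr.
Qed.

End SchemeEnergy.

(** * A-priori bound and convergence on a short time interval *)

(** Avoids square roots in the constants. *)
Lemma norm_le_max1 (R : realFieldType) (y P : R) :
  0 <= y -> y ^+ 2 <= P -> y <= P + 1.
Proof.
move=> y0 yP; rewrite leNgt; apply/negP => Py.
have P0 : 0 <= P by exact: le_trans (sqr_ge0 y) yP.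
have : 1 * y <= y * y by rewrite ler_wpM2r //; lra.
rewrite -expr2; lra.
Qed.

Section SchemeConvergence.
Context (R : realType) (V W : lmodType R) (S : V -> Prop) (S' : W -> Prop).
Context (d : V -> V -> R) (a : W -> W -> R).
Hypotheses (sd : semi_inner S d) (sa : semi_inner S' a).
Context (c M : R).
Hypotheses (c_gt0 : 0 < c) (M_ge0 : 0 <= M).

(** The energy of the starting values of the scheme itself: their gradients and
    their velocity are at most [2 M]. *)
Definition energy0_bound : R := 4 * M ^+ 2 + 4 * M ^+ 3 + 8 * M ^+ 5.

(** [scheme_energy_bound] for the solution of the scheme, with [f] as truncation
    error. *)
Definition velocity_const : R := 2 * energy0_bound + 4 * M ^+ 2 + 1.

Definition error_velocity_const : R := M + velocity_const.

Local Notation D := error_velocity_const.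

(** The Lipschitz constant of [energy_coeff], whose variable part is made of the
    squared norms of the exact gradients and of the products [b]. *)
Definition coeff_lipschitz : R := M + M ^+ 3 + M ^+ 2 + 6 * M ^+ 2 * D.

(** The first and the second inner bounds let the Gronwall inequality apply to
    the solution of the scheme and to the error; the last one keeps
    [energy_coeff] above [c / 2]. *)
Definition local_time : R := Num.min 1 (Num.min
  (8 * (energy_const c M M 0 0 + 1))^-1
  (Num.min (8 * (energy_const (c / 2) coeff_lipschitz M (2 * M) (M ^+ 2) + 1))^-1
   (c / (4 * M ^+ 2 * D + 1)))).

Definition error_const : R :=
  2 * (M ^+ 2 + (M + M ^+ 3 + 2 * M ^+ 2 * D) / 2 * M ^+ 2 + M ^+ 5 / 4)
  + 4 * M ^+ 2 + 1.

Let c2_gt0 : 0 < c / 2. Proof. by rewrite divr_gt0. Qed.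

Let D_ge0 : 0 <= D.
Proof. by rewrite !(addr_ge0, mulr_ge0, exprn_ge0). Qed.

Let K2_ge0 : 0 <= coeff_lipschitz.
Proof. by rewrite !(addr_ge0, mulr_ge0, exprn_ge0). Qed.

Let C1_ge0 : 0 <= energy_const c M M 0 0.
Proof. exact: energy_const_ge0. Qed.

Let C2_ge0 : 0 <= energy_const (c / 2) coeff_lipschitz M (2 * M) (M ^+ 2).
Proof. by apply: energy_const_ge0; rewrite ?mulr_ge0 ?exprn_ge0. Qed.

Lemma local_time_gt0 : 0 < local_time.
Proof.
rewrite /local_time !lt_min ltr01 !invr_gt0 !mulr_gt0 ?invr_gt0 ?ltr_wpDl //=.
by rewrite !(mulr_ge0, exprn_ge0).
Qed.

Let time_le (T C : R) : 0 <= C -> T <= (8 * (C + 1))^-1 -> 0 <= T ->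
  C * T <= 8^-1.
Proof.
move=> C0 TC T0; have C8 : 0 < 8 * (C + 1) by rewrite mulr_gt0 // ltr_wpDl.
move: TC; rewrite -[_^-1]mul1r ler_pdivlMr //; lra.
Qed.

Context (h : R) (m : nat) (x X L LX f : nat -> V) (gx gX : nat -> W)
  (al be : nat -> R).
Hypotheses (h_gt0 : 0 < h) (h_le1 : h <= 1) (hm : h * m%:R <= local_time).
Hypotheses (Sx : forall k, S (x k)) (SX : forall k, S (X k))
  (SL : forall k, S (L k)) (SLX : forall k, S (LX k)) (Sf : forall k, S (f k))
  (Sgx : forall k, S' (gx k)) (SgX : forall k, S' (gX k)).
Hypotheses (gxx : green d a L gx x gx) (gxX : green d a L gx X gX)
  (gXx : green d a LX gX x gx) (gXX : green d a LX gX X gX).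
Hypothesis scheme : forall k, (k.+1 < m)%N -> forall v, S v ->
  d (X k.+2 - X k.+1 - (X k.+1 - X k)) v
  + h ^+ 2 / 2 * (al k.+1 + be k.+1 / 2
      * (a (gX k.+2) (gX k.+2) + a (gX k) (gX k))) * d (LX k.+2 + LX k) v
  = h ^+ 2 * d (f k.+1) v.
Hypotheses (al_itv : forall k, c <= al k <= M) (be_itv : forall k, c <= be k <= M)
  (al_lip : forall k, `|al k.+1 - al k| <= M * h)
  (be_lip : forall k, `|be k.+1 - be k| <= M * h)
  (L_bnd : forall k, snorm d (L k) <= M)
  (L_lip : forall k, snorm d (L k.+1 - L k) <= M * h)
  (gx_bnd : forall k, snorm a (gx k) <= M)
  (gx_lip : forall k, `|a (gx k.+1) (gx k.+1) - a (gx k) (gx k)| <= M * h)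
  (f_bnd : forall k, snorm d (f k) <= M)
  (x_lip : forall k, snorm d (x k.+1 - x k) <= M * h)
  (res_bnd : forall k, (0 < k < m)%N ->
    snorm d (residual a x L f gx al be h k) <= M * h ^+ 2)
  (z0 : snorm d (x 0 - X 0) = 0) (gz0 : snorm a (gx 0 - gX 0) = 0)
  (z1 : snorm d (x 1 - X 1) <= M * h ^+ 3)
  (gz1 : snorm a (gx 1 - gX 1) <= M * h ^+ 2).

Let z k := x k - X k.
Let Sz k : S (z k). Proof. exact: (sinner_memB sd). Qed.

Let hm_le1 : h * m%:R <= 1.
Proof. by apply: le_trans hm _; rewrite /local_time ge_min lexx. Qed.

Let h_ge0 : 0 <= h. Proof. exact: ltW. Qed.

Let hm_ge0 : 0 <= h * m%:R. Proof. exact: mulr_ge0. Qed.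

Let h2_le1 : h ^+ 2 <= 1. Proof. exact: exprn_ile1. Qed.

Let Z10 : snorm d (z 1 - z 0) <= M * h ^+ 3.
Proof. by apply: le_trans (snormB sd (Sz _) (Sz _)) _; rewrite z0 addr0. Qed.

(** The energy estimate with [0] as exact solution: the truncation error is then
    [- f], and the products [b] vanish. *)
Lemma scheme_velocity_bound k : (k < m)%N ->
  snorm d (X k.+1 - X k) <= velocity_const * h.
Proof.
move=> km; have S00 := sinner0 sd; have S0' := sinner0 sa.
have SgX0 j : S' (0 - gX j) by exact: (sinner_memB sa).
have := @scheme_energy_bound _ _ _ _ _ _ _ sd sa (fun=> 0) X (fun=> 0) LX f
  (fun=> 0) gX al be h m h_gt0 (fun=> S00) SX (fun=> S00) SLX Sf (fun=> S0') SgX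
  _ _ _ _ scheme c M M 0 M 0 c_gt0.
have a0 w : S' w -> a w 0 = 0 by move=> ?; rewrite (sinnerC sa) (sinner0l sa).
have d0 w : S w -> d w 0 = 0 by move=> ?; rewrite (sinnerC sd) (sinner0l sd).
have sn0 : snorm d 0 = 0 by rewrite /snorm (sinner0l sd) // sqrtr0.
have sa0 : snorm a 0 = 0 by rewrite /snorm (sinner0l sa) // sqrtr0.
have coeffE j : energy_coeff (fun k => a 0 (0 - gX k)) (fun=> a 0 0) al be j = al j.
  by rewrite /energy_coeff /exact_coeff !(sinner0l sa) //; ring.
move=> /(_ _ _ _ _ M_ge0 M_ge0 (lexx 0) (lexx 0) M_ge0).
have en : energy (fun k => snorm d (0 - X k.+1 - (0 - X k)) / h)
    (fun k => snorm a (0 - gX k) ^+ 2) (fun k => a 0 (0 - gX k))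
    (fun=> a 0 0) al be 0 <= energy0_bound.
  rewrite /energy coeffE.
  have gX1 : snorm a (0 - gX 1%N) <= 2 * M.
    rewrite sub0r (snormN sa) //.
    have -> : gX 1%N = gx 1%N - (gx 1%N - gX 1%N) by rewrite subKr.
    apply: le_trans (snormB sa _ _) _ => //; first exact: (sinner_memB sa).
    have := gx_bnd 1; have := ler_wpM2l M_ge0 h2_le1; move: gz1; lra.
  have gX0 : snorm a (0 - gX 0%N) <= 2 * M.
    rewrite sub0r (snormN sa) //.
    have -> : gX 0%N = gx 0%N - (gx 0%N - gX 0%N) by rewrite subKr.
    apply: le_trans (snormB sa _ _) _ => //; first exact: (sinner_memB sa).
    by have := gx_bnd 0; rewrite gz0; move: M_ge0; lra.
  have v0 : snorm d (0 - X 1%N - (0 - X 0%N)) / h <= 2 * M.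
    rewrite ler_pdivrMr // !sub0r -opprD (snormN sd); last exact: (sinner_memB sd).
    have -> : X 1%N - X 0%N = (x 1%N - x 0%N) - (z 1%N - z 0%N).
      by rewrite /z (subrACA (x 1%N) (X 1%N)) subKr.
    apply: le_trans (snormB sd _ _) _; try exact: (sinner_memB sd).
    have := x_lip 0; have := ler_wpM2l (mulr_ge0 M_ge0 h_ge0) h2_le1.
    by move: Z10; lra.
  have sq (y : R) : 0 <= y -> y <= 2 * M -> y ^+ 2 <= 4 * M ^+ 2.
    move=> y0 yM; rewrite (_ : 4 * M ^+ 2 = (2 * M) ^+ 2); last by ring.
    by rewrite lerXn2r // nnegrE mulr_ge0.
  have A0 := sq _ (snorm_ge0 _ _) gX0; have A1 := sq _ (snorm_ge0 _ _) gX1.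
  have V0 := sq _ (divr_ge0 (snorm_ge0 _ _) h_ge0) v0.
  have M4 : 0 <= 4 * M ^+ 2 by rewrite mulr_ge0 ?exprn_ge0.
  have sq4 (y : R) : 0 <= y -> y <= 4 * M ^+ 2 -> y ^+ 2 <= 16 * M ^+ 4.
    move=> y0 yM; rewrite (_ : 16 * M ^+ 4 = (4 * M ^+ 2) ^+ 2); last by ring.
    by rewrite lerXn2r // nnegrE.
  have A02 := sq4 _ (sqr_ge0 _) A0; have A12 := sq4 _ (sqr_ge0 _) A1.
  have /andP[alc alM] := al_itv 0; have /andP[bec beM] := be_itv 0.
  have al0 : 0 <= al 0%N by exact: le_trans (ltW c_gt0) alc.
  have be0 : 0 <= be 0%N by exact: le_trans (ltW c_gt0) bec.
  rewrite /energy0_bound; apply: lerD; first apply: lerD => //.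
    apply: (@le_trans _ _ (M / 2 * (8 * M ^+ 2))); last by rewrite le_eqVlt; apply/orP; left; apply/eqP; field.
    apply: ler_pM; rewrite ?addr_ge0 ?sqr_ge0 ?divr_ge0 //.
      by rewrite ler_wpM2r ?invr_ge0.
    by move: A0 A1; lra.
  apply: (@le_trans _ _ (M / 4 * (32 * M ^+ 4))); last by rewrite le_eqVlt; apply/orP; left; apply/eqP; field.
  apply: ler_pM; rewrite ?addr_ge0 ?sqr_ge0 ?divr_ge0 //.
    by rewrite ler_wpM2r ?invr_ge0.
  by move: A02 A12; lra.
have res j : snorm d (residual a (fun=> 0) (fun=> 0) f (fun=> 0) al be h j) <= M.
  by rewrite /residual !(subr0, addr0, scaler0) sub0r (snormN sd).
move=> /(_ _ _ _ _ _ _ _ _ _ _ _ _ k km) bnd.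
have {bnd} : (snorm d (0 - X k.+1 - (0 - X k)) / h) ^+ 2 <= velocity_const - 1.
  apply: le_trans (bnd _ _ _ _ _ _ _ _ _ _ _ _) _ => //.
  - by move=> i j; rewrite (sinner0l sa) // (sinner0l sd).
  - by move=> i j; rewrite (sinner0l sa) // (sinner0l sd).
  - by move=> i j; rewrite a0 // d0.
  - by move=> j; rewrite sn0.
  - by move=> j; rewrite sa0.
  - by move=> j jm; rewrite coeffE; case/andP: (al_itv j).
  - by move=> j jm; rewrite !coeffE.
  - rewrite mulr0 expr0n /= -mulrA; apply: time_le => //.
    by apply: le_trans hm _; rewrite /local_time !ge_min lexx !orbT.
  rewrite /velocity_const addrK; apply: lerD.
    by rewrite ler_pM2l.
  have M2 : 0 <= M ^+ 2 by exact: sqr_ge0.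
  by rewrite -mulrA ler_pM2l // (mulrC m%:R) -[leRHS]mul1r ler_wpM2r.
move=> /norm_le_max1; rewrite subrK ler_pdivrMr // !sub0r -opprD (snormN sd).
  by apply; rewrite divr_ge0 ?snorm_ge0.
exact: (sinner_memB sd).
Qed.

Lemma scheme_error_velocity k : (k < m)%N ->
  snorm d (z k.+1 - z k) <= D * h.
Proof.
move=> km; rewrite /z (subrACA (x _)).
apply: le_trans (snormB sd _ _) _; try exact: (sinner_memB sd).
have -> : D * h = M * h + velocity_const * h by rewrite -mulrDl.
by apply: lerD; rewrite ?scheme_velocity_bound.
Qed.

(** The only place where the length of the time interval makes the error, and
    not merely the growth of the energy, small. *)
Let z_bnd k : (k <= m)%N -> snorm d (z k) <= D * local_time.
Proof.
move=> km; apply: (@le_trans _ _ (D * (h * k%:R))); last first.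
  by rewrite ler_wpM2l // (le_trans _ hm) // ler_wpM2l // ler_nat.
elim: k km => [|k IH] km; first by rewrite z0 !mulr0.
have := scheme_error_velocity km; have := IH (ltnW km).
have := snormD sd (sinner_memB sd (Sz k.+1) (Sz k)) (Sz k); rewrite subrK.
by rewrite -natr1; lra.
Qed.

Let b k := a (gx k) (gx k - gX k).
Let nx k := a (gx k) (gx k).

Let bE k : b k = d (L k) (z k).
Proof. by rewrite /b (sinnerBr sa) // gxx gxX -(sinnerBr sd). Qed.

Let t_le1 : local_time <= 1.
Proof. by rewrite /local_time ge_min lexx. Qed.

Let b_bnd k : (k <= m)%N -> `|b k| <= M * (D * local_time).
Proof.
move=> km; rewrite bE; apply: le_trans (sinner_le sd (SL _) (Sz _)) _.
by apply: ler_pM; rewrite ?snorm_ge0 ?z_bnd.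
Qed.

Let b_lip k : (k < m)%N -> `|b k.+1 - b k| <= 2 * M * D * h.
Proof.
move=> km; have SLL : S (L k.+1 - L k) by exact: (sinner_memB sd).
have SzZ : S (z k.+1 - z k) by exact: (sinner_memB sd).
have -> : b k.+1 - b k = d (L k.+1 - L k) (z k.+1) + d (L k) (z k.+1 - z k).
  rewrite !bE (sinnerBl sd (SL _) (SL _) (Sz _)).
  by rewrite (sinnerBr sd (SL _) (Sz _) (Sz _)); ring.
apply: le_trans (ler_normD _ _) _.
apply: (@le_trans _ _ (M * h * (D * local_time) + M * (D * h))).
  apply: lerD; [apply: le_trans (sinner_le sd SLL (Sz _)) _|
    apply: le_trans (sinner_le sd (SL _) SzZ) _]; apply: ler_pM;
    by rewrite ?snorm_ge0 ?z_bnd ?scheme_error_velocity.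
by have := ler_wpM2l (mulr_ge0 (mulr_ge0 M_ge0 h_ge0) D_ge0) t_le1; lra.
Qed.

Let b_small k : (k <= m)%N -> M * `|b k| <= c / 4.
Proof.
move=> km; apply: (@le_trans _ _ (M ^+ 2 * D * local_time)).
  by have := ler_wpM2l M_ge0 (b_bnd km); lra.
have : local_time <= c / (4 * M ^+ 2 * D + 1).
  by rewrite /local_time !ge_min lexx !orbT.
have MD : 0 <= M ^+ 2 * D by rewrite mulr_ge0 ?exprn_ge0.
rewrite ler_pdivlMr; last by lra.
by have := ltW local_time_gt0; lra.
Qed.

Let nx_itv k : 0 <= nx k <= M ^+ 2.
Proof.
rewrite /nx (sinner_ge0 sa) //= -(snorm_sqr sa) //.
by rewrite lerXn2r ?nnegrE ?snorm_ge0.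
Qed.

Let predm k : (k < m)%N -> (k.-1 <= m)%N.
Proof. by move=> km; apply: leq_trans (leq_pred _) (ltnW km). Qed.

Let coeff_ge k : (k < m)%N -> c / 2 <= energy_coeff b nx al be k.
Proof.
move=> km; rewrite /energy_coeff /exact_coeff.
have /andP[alc _] := al_itv k; have /andP[bec beM] := be_itv k.
have be0 : 0 <= be k by exact: le_trans (ltW c_gt0) bec.
have /andP[n1 _] := nx_itv k.+1; have /andP[n2 _] := nx_itv k.-1.
have bn : 0 <= be k / 2 * (nx k.+1 + nx k.-1) by rewrite mulr_ge0 ?divr_ge0 ?addr_ge0.
have bs j : (j <= m)%N -> be k * b j <= c / 4.
  move=> jm; apply: le_trans (b_small jm).
  by apply: le_trans (ler_norm _) _; rewrite normrM ger0_norm // ler_wpM2r.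
have := bs _ km; have := bs _ (predm km); lra.
Qed.

Let coeff_lip k : (k.+1 < m)%N ->
  `|energy_coeff b nx al be k.+1 - energy_coeff b nx al be k|
    <= coeff_lipschitz * h.
Proof.
move=> km.
have -> : energy_coeff b nx al be k.+1 - energy_coeff b nx al be k =
    (al k.+1 - al k) + (be k.+1 - be k) * ((nx k.+2 + nx k) / 2 - (b k.+2 + b k))
    + be k * (((nx k.+2 - nx k.+1) + (nx k - nx k.-1)) / 2
              - ((b k.+2 - b k.+1) + (b k - b k.-1))).
  by rewrite /energy_coeff /exact_coeff /=; field.
have /andP[bec beM] := be_itv k.
have be0 : 0 <= be k by exact: le_trans (ltW c_gt0) bec.
have kM := ltn_trans (ltnSn k) km.
have /andP[n1 n1'] := nx_itv k.+2; have /andP[n2 n2'] := nx_itv k.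
have MD : 0 <= 2 * M * D * h by rewrite !mulr_ge0.
have l1 : `|nx k - nx k.-1| <= M * h.
  by case: (k) => [|j]; rewrite ?subrr ?normr0 ?mulr_ge0 //; exact: gx_lip.
have l2 : `|b k - b k.-1| <= 2 * M * D * h.
  case: (k) kM => [|j] jm; rewrite ?subrr ?normr0 //.
  by apply: b_lip; exact: ltn_trans jm.
have l3 : `|nx k.+2 - nx k.+1| <= M * h := gx_lip k.+1; have l4 := b_lip km.
have b1 := b_bnd km; have b2 := b_bnd (ltnW kM).
have MDt : M * (D * local_time) <= M * D.
  by have := ler_wpM2l (mulr_ge0 M_ge0 D_ge0) t_le1; lra.
have w1 : `|(nx k.+2 + nx k) / 2 - (b k.+2 + b k)| <= M ^+ 2 + 2 * (M * D).
  by move: b1 b2; rewrite !ler_norml => /andP[? ?] /andP[? ?]; lra.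
have w2 : `|((nx k.+2 - nx k.+1) + (nx k - nx k.-1)) / 2
     - ((b k.+2 - b k.+1) + (b k - b k.-1))| <= M * h + 4 * M * D * h.
  move: l1 l2 l3 l4; rewrite !ler_norml.
  by move=> /andP[? ?] /andP[? ?] /andP[? ?] /andP[? ?]; lra.
apply: le_trans (ler_normD _ _) _.
apply: (@le_trans _ _ ((M * h + M * h * (M ^+ 2 + 2 * (M * D)))
    + M * (M * h + 4 * M * D * h))).
  apply: lerD; last by rewrite normrM (ger0_norm be0); apply: ler_pM.
  apply: le_trans (ler_normD _ _) _; apply: lerD => //.
  by rewrite normrM; apply: ler_pM.
by rewrite /coeff_lipschitz le_eqVlt; apply/orP; left; apply/eqP; ring.
Qed.

(** The starting energy is [O(h ^+ 4)], as well as the square of the truncation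
    error. *)
Lemma scheme_convergence k : (k < m)%N ->
  snorm d (z k.+1 - z k) <= error_const * h ^+ 2 * h.
Proof.
move=> km; have m0 : (0 < m)%N by exact: leq_ltn_trans km.
have Mh : 0 <= M * h ^+ 2 by rewrite mulr_ge0 ?exprn_ge0.
have := scheme_energy_bound sd sa h_gt0 Sx SX SL SLX Sf Sgx SgX gxx gxX gXx gXX
  scheme c2_gt0 K2_ge0 M_ge0 M_ge0 M_ge0 Mh L_bnd gx_bnd res_bnd _ _ coeff_ge
  coeff_lip _ km.
have small : energy_const (c / 2) coeff_lipschitz M (2 * M) (M ^+ 2) * h * m%:R <= 8^-1.
  rewrite -mulrA; apply: time_le => //.
  by apply: le_trans hm _; rewrite /local_time !ge_min lexx !orbT.
move=> /(_ _ _ small) bnd.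
have {bnd} : (snorm d (z k.+1 - z k) / h) ^+ 2 / (h ^+ 2) ^+ 2 <= error_const - 1.
  rewrite ler_pdivrMr ?exprn_gt0 //; apply: le_trans (bnd _ _) _.
  - move=> j; case/andP: (be_itv j) => ? ->; rewrite andbT.
    by move: c_gt0; lra.
  - move=> j; apply: le_trans (be_lip j) _; rewrite ler_wpM2r //.
    rewrite /coeff_lipschitz -!addrA lerDl.
    by rewrite !(addr_ge0, mulr_ge0, exprn_ge0).
  have hM : m%:R * h * (M * h ^+ 2) ^+ 2 <= M ^+ 2 * h ^+ 4.
    have := ler_wpM2r (sqr_ge0 (M * h ^+ 2)) hm_le1.
    by rewrite (mulrC h) mul1r exprMn -exprM.
  rewrite /energy -/nx.
  have A0 : snorm a (gx 0%N - gX 0%N) ^+ 2 = 0 by rewrite gz0 expr0n.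
  rewrite A0 expr0n /= !addr0.
  set A1 := snorm a _ ^+ 2.
  have A1_le : A1 <= M ^+ 2 * h ^+ 4.
    have -> : M ^+ 2 * h ^+ 4 = (M * h ^+ 2) ^+ 2 by ring.
    by rewrite lerXn2r ?nnegrE ?snorm_ge0.
  have A1_ge0 : 0 <= A1 by exact: sqr_ge0.
  have h4 : h ^+ 4 <= 1 by exact: exprn_ile1.
  have h40 : 0 <= h ^+ 4 by exact: exprn_ge0.
  have M40 : 0 <= M ^+ 4 by exact: exprn_ge0.
  have A12 : A1 ^+ 2 <= M ^+ 4 * h ^+ 4.
    apply: (@le_trans _ _ ((M ^+ 2 * h ^+ 4) ^+ 2)).
      by rewrite lerXn2r // nnegrE // mulr_ge0 ?exprn_ge0.
    have := ler_wpM2l (mulr_ge0 M40 h40) h4; rewrite exprMn -!exprM; lra.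
  have nd0 : (snorm d (x 1%N - X 1%N - (x 0%N - X 0%N)) / h) ^+ 2 <= M ^+ 2 * h ^+ 4.
    have -> : M ^+ 2 * h ^+ 4 = (M * h ^+ 2) ^+ 2 by ring.
    rewrite lerXn2r ?nnegrE ?divr_ge0 ?snorm_ge0 // ler_pdivrMr //.
    by apply: le_trans Z10 _; rewrite -mulrA -exprSr.
  have /andP[alc alM] := al_itv 0; have /andP[bec beM] := be_itv 0.
  have be0 : 0 <= be 0%N by exact: le_trans (ltW c_gt0) bec.
  set p0 := energy_coeff _ _ _ _ _.
  have p00 : 0 <= p0 by exact: le_trans (ltW c2_gt0) (coeff_ge m0).
  have p0M : p0 <= M + M ^+ 3 + 2 * M ^+ 2 * D.
    rewrite /p0 /energy_coeff /exact_coeff /=.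
    have /andP[n1 n1'] := nx_itv 1; have /andP[n2 n2'] := nx_itv 0.
    have q1 : be 0%N / 2 * (nx 1%N + nx 0%N) <= M / 2 * (2 * M ^+ 2).
      by apply: ler_pM; rewrite ?divr_ge0 ?addr_ge0 //; lra.
    have MDt : M * (D * local_time) <= M * D.
      by have := ler_wpM2l (mulr_ge0 M_ge0 D_ge0) t_le1; lra.
    have q2 : - (be 0%N * (b 1%N + b 0%N)) <= M * (2 * (M * D)).
      apply: le_trans (ler_norm _) _; rewrite normrN normrM (ger0_norm be0).
      apply: ler_pM => //; apply: le_trans (ler_normD _ _) _.
      have := b_bnd m0; have := b_bnd (leq0n m); lra.
    by move: q1 q2; rewrite /nx /b; lra.
  have r1 : p0 / 2 * A1 <= (M + M ^+ 3 + 2 * M ^+ 2 * D) / 2 * (M ^+ 2 * h ^+ 4).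
    by apply: ler_pM; rewrite ?divr_ge0 //; lra.
  have r2 : be 0%N / 4 * A1 ^+ 2 <= M / 4 * (M ^+ 4 * h ^+ 4).
    by apply: ler_pM; rewrite ?divr_ge0 ?sqr_ge0 //; lra.
  by rewrite /error_const addrK -exprM; move: nd0 r1 r2 hM; lra.
rewrite -expr_div_n => /norm_le_max1; rewrite subrK => bnd.
have : snorm d (z k.+1 - z k) / h / h ^+ 2 <= error_const.
  by apply: bnd; rewrite !divr_ge0 ?snorm_ge0 ?exprn_ge0.
by rewrite ler_pdivrMr ?exprn_gt0 // ler_pdivrMr.
Qed.

End SchemeConvergence.

(** * L^2 of a plane domain *)

Section L2.
Context (R : realType) (Omega : set (R * R)).
Implicit Types (u v w : R * R -> R).
Local Notation S := (inL2 Omega).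
Local Notation d := (dotL2 Omega).

Lemma patchM u v : (fun p => u p * v p) \_ Omega = (u \_ Omega) \* (v \_ Omega).
Proof. by apply/funext => p; rewrite /patch /=; case: ifP; rewrite ?mulr0. Qed.

Lemma patch_linear a u v : (a *: u + v) \_ Omega = a *: (u \_ Omega) + v \_ Omega.
Proof.
apply/funext => p; rewrite /patch /= !fctE; case: ifP => // _.
by rewrite scaler0 addr0.
Qed.

Lemma dotL2E u v : d u v = \int[mu2 R]_p ((u \_ Omega) p * (v \_ Omega) p).
Proof. by rewrite /dotL2 Rintegral_mkcond patchM. Qed.

Lemma dotL2_integrable u v : S u -> S v ->
  (mu2 R).-integrable setT (EFin \o ((u \_ Omega) \* (v \_ Omega))).
Proof. by move=> Su Sv; apply/Lfun1_integrable; exact: Lfun2_mul_Lfun1. Qed.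

Lemma L2_semi_inner : semi_inner S d.
Proof.
have p1 : (1 <= 2%:E :> \bar R)%E by rewrite lee_fin ler1n.
have [l0 lL] := Lfun_submod_closed (mu2 R) p1.
split.
- rewrite /inL2 (_ : _ \_ _ = 0) //.
  by apply/funext => p; rewrite /patch; case: ifP.
- by move=> a u v Su Sv; rewrite /inL2 patch_linear; apply: lL.
- by move=> u v; apply: eq_Rintegral => p _; rewrite mulrC.
- move=> a u v w Su Sv Sw; rewrite !dotL2E patch_linear.
  rewrite -RintegralZl //; last exact: dotL2_integrable.
  rewrite -RintegralD //; first last.
  - exact: dotL2_integrable.
  - exact: (integrableZl measurableT a (dotL2_integrable Su Sw)).
  - by apply: eq_Rintegral => p _; rewrite /= !fctE mulrDl -mulrA.
- move=> u Su; rewrite dotL2E; apply: Rintegral_ge0 => p _.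
  by rewrite -expr2 sqr_ge0.
Qed.

Lemma normL2E u : S u -> normL2 Omega u = snorm d u.
Proof.
move=> Su; rewrite /normL2 /snorm unlock /=.
have -> : (\int[mu2 R]_x (`|(u \_ Omega x)%:E| `^ 2) = (d u u)%:E)%E.
  rewrite dotL2E /Rintegral fineK; last first.
    by apply: integrable_fin_num => //; exact: dotL2_integrable.
  apply: eq_integral => p _ /=.
  by rewrite powR_mulrn // real_normK ?num_real // expr2.
by rewrite /= powR12_sqrt // (sinner_ge0 L2_semi_inner).
Qed.

Lemma dotL2_ae u u' v : S u -> S u' -> S v -> eqL2 Omega u u' -> d u v = d u' v.
Proof.
move=> Su Su' Sv uu'; rewrite !dotL2E /Rintegral; congr fine.
have m w : S w -> measurable_fun setT (w \_ Omega).
  by move=> /andP[+ _]; rewrite inE.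
apply: ae_eq_integral => //.
- by apply/measurable_EFinP; apply: measurable_funM; exact: m.
- by apply/measurable_EFinP; apply: measurable_funM; exact: m.
move: uu'; apply: (@filterS _ _ (ae_filter_ringOfSetsType (mu2 R))) => p up _ /=; congr (_ * _)%:E.
by rewrite /patch; case: ifPn => //; rewrite inE => /up.
Qed.

End L2.

(** * Functions that are continuous on the closure of a bounded domain *)

Section PlaneMeasure.
Context (R : realType).
Implicit Types (A Omega : set (R * R)) (g : R * R -> R).
Local Notation plane := (measurableTypeR R * measurableTypeR R)%type.

(** Every open set of the plane is a countable union of balls of the maximum
    norm, that is of rectangles, with rational centres and radii [1 / n]. *)
Lemma open_measurable_plane A : open A -> measurable (A : set plane).
Proof.
move=> oA.
pose B (i : rat * rat * nat) : set plane :=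
  if `[< ball (ratr i.1.1 : R, ratr i.1.2 : R) (i.2.+1%:R^-1 : R) `<=` A >]
  then ball (ratr i.1.1 : R) (i.2.+1%:R^-1 : R) `*`
       ball (ratr i.1.2 : R) (i.2.+1%:R^-1 : R) else set0.
have -> : A = \bigcup_i B i.
  apply/seteqP; split => [p Ap|p [i _]]; last first.
    by rewrite /B; case: asboolP => // h [p1 p2]; apply: h; split.
  have /nbhs_ballP[e /= e0 eA] : nbhs p A by exact: open_nbhs_nbhs.
  have e2 : 0 < e / 2 by rewrite divr_gt0.
  have [n ne] : exists n : nat, (n.+1%:R^-1 : R) < e / 2.
    exists (Num.trunc (e / 2)^-1).
    by rewrite invf_plt ?posrE ?ltr0Sn // truncnS_gt.
  set r := n.+1%:R^-1 in ne.
  have r0 : 0 < r by rewrite invr_gt0 ltr0Sn.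
  have rat_near (t : R) : exists q : rat, ball (ratr q : R) r t.
    have [q] := @rat_in_itvoo _ (t - r) (t + r) ltac:(lra).
    rewrite in_itv /= => /andP[q1 q2]; exists q.
    by rewrite /ball /= ltr_distlC; apply/andP; split; lra.
  have [q1 hq1] := rat_near p.1; have [q2 hq2] := rat_near p.2.
  exists (q1, q2, n) => //; rewrite /B /= -/r.
  case: asboolP => [_|]; first by split.
  case=> y [/= y1 y2]; apply: eA; split => /=.
    by apply: (le_ball (_ : r + r <= e)); [lra|apply: ball_triangle (ball_sym hq1) y1].
  by apply: (le_ball (_ : r + r <= e)); [lra|apply: ball_triangle (ball_sym hq2) y2].
apply: countable_bigcupT_measurable; first exact: countableP.
move=> i; rewrite /B; case: asboolP => // _.
by apply: measurableX; apply: open_measurable; exact: ball_open.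
Qed.

Lemma bounded_setP (V : normedModType R) (B : set V) : bounded_set B ->
  exists M : R, forall x, B x -> `|x| <= M.
Proof. by move=> [M [_ HM]]; exists (M + 1); apply: HM; rewrite ltrDl. Qed.

Lemma bounded_closure_compact Omega : bounded_set Omega -> compact (closure Omega).
Proof.
move=> /bounded_setP[M HM].
apply: (@subclosed_compact _ _ (`[- M, M] `*` `[- M, M])).
- exact: closed_closure.
- by apply: compact_setX; exact: segment_compact.
- have /closure_id -> : closed (`[- M, M]%classic `*` `[- M, M]%classic).
    apply: compact_closed; first exact: norm_hausdorff.
    by apply: compact_setX; exact: segment_compact.
  apply: closure_subset => p /HM; rewrite prod_normE ge_max !ler_norml.
  by move=> /andP[? ?]; split; rewrite /= in_itv.
Qed.

Lemma bounded_domain_finite Omega :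
  open Omega -> bounded_set Omega -> (mu2 R Omega < +oo)%E.
Proof.
move=> oO /bounded_setP[M HM].
apply: (@le_lt_trans _ _ (mu2 R (`[- M, M] `*` `[- M, M]))).
  apply: le_measure; rewrite ?inE.
  - exact: open_measurable_plane.
  - by apply: measurableX; exact: measurable_itv.
  - move=> p /HM; rewrite prod_normE ge_max !ler_norml.
    by move=> /andP[? ?]; split; rewrite /= in_itv.
have -> : mu2 R (`[- M, M] `*` `[- M, M]) =
    (@lebesgue_measure R `[(- M)%R, M] * @lebesgue_measure R `[(- M)%R, M])%E.
  by apply: product_measure1E; exact: measurable_itv.
by rewrite lebesgue_measure_itv /=; case: ifP => _; rewrite ?mule0 ?mul0e // -EFinB -EFinM ltry.
Qed.

Lemma continuous_closure_bounded Omega g : bounded_set Omega ->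
  {within closure Omega, continuous g} ->
  exists M : R, forall p, closure Omega p -> `|g p| <= M.
Proof.
move=> /bounded_closure_compact cO cg.
have /compact_bounded/bounded_setP[M HM] := continuous_compact cg cO.
by exists M => p Op; apply: HM; exists p.
Qed.

Lemma continuous_closure_measurable Omega g : open Omega ->
  {within closure Omega, continuous g} ->
  measurable_fun (Omega : set plane) g.
Proof.
move=> oO cg; have mO := open_measurable_plane oO.
have : {in Omega, continuous g}.
  rewrite -continuous_open_subspace //.
  exact: continuous_subspaceW (@subset_closure _ _) cg.
move=> {}cg.
apply: (measurability _ (RGenOpens.measurableE R)).
move=> _ [_ [a [b ->] <-]]; apply: open_measurable_plane.
rewrite openE => p [Op gp].
have : nbhs p (g @^-1` `]a, b[).
  by apply: cg; rewrite ?inE //; apply: open_nbhs_nbhs; split => //; exact: interval_open.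
by move=> h; apply: filterI => //; exact: open_nbhs_nbhs.
Qed.

Lemma bounded_measurable_L2 Omega g (M : R) : open Omega -> bounded_set Omega ->
  measurable_fun (Omega : set plane) g -> (forall p, Omega p -> `|g p| <= M) ->
  inL2 Omega g.
Proof.
move=> oO bO mg gM; have mO := open_measurable_plane oO.
have mgT : measurable_fun setT (g \_ Omega : plane -> R).
  exact: (measurable_restrictT g mO).1.
rewrite /inL2 inE; apply/andP; split; rewrite inE //=.
rewrite /finite_norm unlock; apply: poweR_lty.
have : (mu2 R).-integrable Omega (EFin \o (fun p => g p ^+ 2)).
  apply: measurable_bounded_integrable => //.
  - exact: bounded_domain_finite.
  - exact: measurable_funX.
  - exists (M ^+ 2); split; first exact: num_real.
    move=> x Mx p Op; apply: le_trans (ltW Mx); rewrite normrX.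
    by rewrite lerXn2r ?nnegrE //; [exact: le_trans (gM _ Op)|exact: gM].
move=> /(integrable_mkcond _ mO) /integrableP[_]; apply: le_lt_trans.
rewrite le_eqVlt; apply/orP; left; apply/eqP; apply: eq_integral => p _.
rewrite /= powR_mulrn // /patch; case: ifP => _ /=.
  by rewrite normrX.
by rewrite normr0 expr0n.
Qed.

Lemma continuous_closure_L2 Omega g : open Omega -> bounded_set Omega ->
  {within closure Omega, continuous g} -> inL2 Omega g.
Proof.
move=> oO bO cg; have [M HM] := continuous_closure_bounded bO cg.
apply: (@bounded_measurable_L2 _ _ M) => //.
  exact: continuous_closure_measurable.
by move=> p Op; apply: HM; exact: subset_closure.
Qed.

End PlaneMeasure.

(** * Integration by parts on a convex domain *)

Section DivergenceOnLines.
Context (R : realType).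

Lemma segment_sub_closure (a b : R) : a < b -> `[a, b] `<=` closure `]a, b[.
Proof.
move=> ab t; rewrite /= in_itv /= => /andP[at_ tb] B /nbhs_ballP[e /= e0 eB].
set c := (a + b) / 2; set k := `|c - t| + 1.
have k0 : 0 < k by rewrite /k ltr_wpDl.
set x := Num.min 2^-1 (e / (2 * k)).
have x0 : 0 < x by rewrite /x lt_min invr_gt0 ltr0n /= divr_gt0 ?mulr_gt0.
have x1 : x <= 2^-1 by rewrite /x ge_min lexx.
have xe : x * k < e.
  have : x <= e / (2 * k) by rewrite /x ge_min lexx orbT.
  rewrite ler_pdivlMr ?mulr_gt0 //; lra.
exists (t + x * (c - t)); split.
  rewrite /= in_itv /=.
  have p1 : 0 <= (1 - x) * (t - a) by rewrite mulr_ge0 //; lra.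
  have p2 : 0 <= (1 - x) * (b - t) by rewrite mulr_ge0 //; lra.
  have p3 : 0 < x * (b - a) by rewrite mulr_gt0 // subr_gt0.
  by move: p1 p2 p3; rewrite /c => *; apply/andP; split; lra.
apply: eB; rewrite /ball /= opprD addNKr normrN normrM gtr0_norm //.
by apply: le_lt_trans xe; rewrite ler_pM2l // /k lerDl.
Qed.

Lemma open_interval_itv (I : set R) : I !=set0 -> open I -> bounded_set I ->
  is_interval I -> exists a b : R, a < b /\ I = `]a, b[%classic.
Proof.
move=> [t It] oI /bounded_setP[M HM] iI.
have lI : has_lbound I.
  by exists (- M) => x /HM; rewrite ler_norml => /andP[].
have uI : has_ubound I.
  by exists M => x /HM; rewrite ler_norml => /andP[].
have IE : I = `]inf I, sup I[%classic.
  transitivity (interior I); first by rewrite (interior_id _).1.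
  by rewrite interval_bounded_interior.
exists (inf I), (sup I); split => //.
by move: It; rewrite {1}IE /= in_itv /= => /andP[]; exact: lt_trans.
Qed.

Lemma interval_integral_derive (I : set R) (W G : R -> R) :
  open I -> bounded_set I -> is_interval I ->
  {within closure I, continuous W} -> {within closure I, continuous G} ->
  (forall x, I x -> is_derive x 1 W (G x)) ->
  (forall x, (closure I `\` I) x -> W x = 0) ->
  (\int[@lebesgue_measure R]_(x in I) (G x)%:E = 0)%E.
Proof.
move=> oI bI iI cW cG dW W0.
have [I0|/set0P I0] := eqVneq I set0; first by rewrite I0 integral_set0.
have [a [b [ab IE]]] := open_interval_itv I0 oI bI iI.
have clI := segment_sub_closure ab; rewrite -IE in clI.
have ain : `[a, b]%classic a by rewrite /= in_itv /= lexx ltW.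
have bin : `[a, b]%classic b by rewrite /= in_itv /= lexx ltW.
have cWab := continuous_subspaceW clI cW.
have [_ Wa Wb] := (continuous_within_itvP W ab).1 cWab.
have mG : measurable_fun `[a, b] (EFin \o G).
  apply/measurable_EFinP; apply: subspace_continuous_measurable_fun.
    exact: measurable_itv.
  exact: continuous_subspaceW cG.
have Wa0 : W a = 0.
  by apply: W0; split; [exact: clI|rewrite IE /= in_itv /= ltxx].
have Wb0 : W b = 0.
  by apply: W0; split; [exact: clI|rewrite IE /= in_itv /= ltxx andbF].
rewrite IE integral_itv_obnd_cbnd; last first.
  by apply: measurable_funS mG => //; exact: subset_itv_oo_cc.
rewrite integral_itv_bndo_bndc; last first.
  by apply: measurable_funS mG => //; exact: subset_itv_co_cc.
rewrite (@continuous_FTC2 _ G W) //.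
- by rewrite Wa0 Wb0 subee.
- exact: continuous_subspaceW cG.
- split => // x xab.
  by apply: (@ex_derive _ _ _ _ _ _ _ (dW _ _)); rewrite IE.
- move=> x xab; rewrite derive1E; apply: (@derive_val _ _ _ _ _ _ _ (dW _ _)).
  by rewrite IE.
Qed.

Lemma line_continuous (e c : R * R) : continuous (fun t : R => t *: e + c).
Proof.
move=> t; apply: cvgD; last exact: cvg_cst.
by apply: cvgZr_tmp; exact: cvg_id.
Qed.

Lemma within_comp (A : set R) (B : set (R * R)) (j : R -> R * R) (f : R * R -> R) :
  continuous j -> (forall t, A t -> B (j t)) -> {within B, continuous f} ->
  {within A, continuous (f \o j)}.
Proof.
move=> cj AB /subspace_continuousP cf; apply/subspace_continuousP => t At.
apply: cvg_comp (cf _ (AB _ At)) => U /(cj t) h.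
change (nbhs t (fun s => A s -> U (j s))).
have {}h : nbhs t (fun s => B (j s) -> U (j s)) := h.
by move: h; apply: filterS => s h /AB; exact: h.
Qed.

Lemma is_derive_line (f : R * R -> R) (e c : R * R) (t : R) :
  derivable f (t *: e + c) e ->
  is_derive t 1 (fun s => f (s *: e + c)) ('D_e f (t *: e + c)).
Proof.
have E : (fun h : R => h^-1 *: (f ((h *: 1 + t) *: e + c) - f (t *: e + c))) =
         (fun h : R => h^-1 *: (f (h *: e + (t *: e + c)) - f (t *: e + c))).
  apply/funext => h; congr (_ *: (f _ - _)).
  by rewrite scalerDl addrA [h *: 1]mulr1.
move=> df; split; first by rewrite /derivable E.
by rewrite /derive E.
Qed.

Lemma line_section_interval (Omega : set (R * R)) (e c : R * R) :
  convex_set (Omega : set (convex_lmodType (R * R)%type)) ->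
  is_interval [set t | Omega (t *: e + c)].
Proof.
move=> cO x y /= Ox Oy z /andP[xz zy].
have [xy|xy] := eqVneq x y.
  by have <- : x = z by apply/eqP; rewrite eq_le xz xy.
have yx : 0 < y - x by rewrite subr_gt0 lt_neqAle xy (le_trans xz).
pose l := (y - z) / (y - x).
have l0 : 0 <= l by rewrite divr_ge0 ?(ltW yx) // subr_ge0.
have l1 : l <= 1 by rewrite ler_pdivrMr // mul1r; lra.
have := cO _ _ (Itv01 l0 l1) (mem_set Ox) (mem_set Oy); rewrite inE.
rewrite /conv /= => h.
have -> : z *: e + c = l *: (x *: e + c) + (1 - l) *: (y *: e + c).
  rewrite !scalerDr addrACA !scalerA -!scalerDl; congr (_ *: _ + _).
    by rewrite /l; field; rewrite gt_eqF.
  by rewrite addrC subrK scale1r.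
exact: h.
Qed.

(** On every line, [w] vanishes at both ends of the chord cut out by a convex
    domain. *)
Lemma line_integral_derive (Omega : set (R * R)) (w g : R * R -> R) (e c : R * R) :
  e != 0 -> convex_domain Omega ->
  {within closure Omega, continuous w} -> {within closure Omega, continuous g} ->
  (forall p, Omega p -> derivable w p e /\ 'D_e w p = g p) ->
  zero_on_boundary Omega w ->
  (\int[@lebesgue_measure R]_t ((g \_ Omega) (t *: e + c))%:E = 0)%E.
Proof.
move=> e0 [_ oO bO cO] cw cg dw w0.
set j := fun t : R => t *: e + c.
have cj : continuous j by exact: line_continuous.
pose I := [set t | Omega (j t)].
have oI : open I by apply: open_comp => // t _; exact: cj.
have clj t : closure I t -> closure Omega (j t).
  move=> clt B Bj; have [s [Is Bs]] := clt _ (cj t _ Bj); by exists (j s).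
have bI : bounded_set I.
  have [M HM] := bounded_setP bO.
  have en : 0 < `|e| by rewrite normr_gt0.
  exists ((M + `|c|) / `|e|); split; first exact: num_real.
  move=> x Mx t /HM h; apply: le_trans (ltW Mx).
  rewrite ler_pdivlMr // -normrZ.
  by rewrite -[t *: e](addrK c); apply: le_trans (ler_normB _ _) _; rewrite lerD2r.
rewrite -[LHS](_ : (\int[lebesgue_measure]_(t in I) (g (j t))%:E = _)%E).
  apply: (@interval_integral_derive _ (w \o j)) => //.
  - exact: line_section_interval.
  - exact: within_comp cw.
  - exact: (@within_comp _ _ j g cj clj cg).
  - by move=> t It; have [d1 d2] := dw _ It; rewrite /= -d2; exact: is_derive_line.
  - by move=> t [clt nIt]; apply: w0; split => //; exact: clj.
rewrite integral_mkcond; apply: eq_integral => t _.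
rewrite /patch; have -> : (t \in I) = (j t \in Omega) by apply/asboolP/asboolP.
by case: ifP.
Qed.

Let leb := @lebesgue_measure R.

Let line_e1 (x y : R) : (x, y) = x *: e1 R + (0, y).
Proof.
apply: injective_projections => /=.
  by rewrite [x *: 1]mulr1 addr0.
by rewrite scaler0 add0r.
Qed.

Let line_e2 (x y : R) : (x, y) = y *: e2 R + (x, 0).
Proof.
apply: injective_projections => /=.
  by rewrite scaler0 add0r.
by rewrite [y *: 1]mulr1 addr0.
Qed.

(** Fubini, integrating first along the lines of direction [e]. *)
Lemma plane_integral_derive (Omega : set (R * R)) (w g : R * R -> R) (e : R * R) :
  dirs R e -> convex_domain Omega ->
  {within closure Omega, continuous w} -> {within closure Omega, continuous g} ->
  (forall p, Omega p -> derivable w p e /\ 'D_e w p = g p) ->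
  zero_on_boundary Omega w -> \int[mu2 R]_(p in Omega) g p = 0.
Proof.
move=> de dom cw cg dw w0; have [_ oO bO _] := dom.
have mO := open_measurable_plane oO.
have int : (mu2 R).-integrable setT (EFin \o (g \_ Omega)).
  rewrite -restrict_EFin; apply: (integrable_mkcond _ mO).1.
  have [M HM] := continuous_closure_bounded bO cg.
  apply: measurable_bounded_integrable => //.
  - exact: bounded_domain_finite.
  - exact: continuous_closure_measurable.
  - exists M; split; first exact: num_real.
    move=> x Mx p Op; apply: le_trans (ltW Mx); apply: HM.
    exact: subset_closure.
rewrite Rintegral_mkcond /Rintegral.
case: de => ->{e} in dw *.
  rewrite -(integral21_prod_meas1 (m1 := leb) (m2 := leb) int).
  rewrite (eq_integral (cst 0%E)) ?integral0 // => y _.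
  rewrite /fubini_G /=.
  have e0 : e1 R != 0 by apply/eqP => -[/eqP]; rewrite oner_eq0.
  rewrite -[RHS](line_integral_derive (0, y) e0 dom cw cg dw w0).
  apply: eq_integral => x _; congr ((_ \_ _) _)%:E.
  exact: line_e1.
rewrite -(integral12_prod_meas1 (m1 := leb) (m2 := leb) int).
rewrite (eq_integral (cst 0%E)) ?integral0 // => x _.
rewrite /fubini_F /=.
have e0 : e2 R != 0 by apply/eqP => -[/eqP]; rewrite oner_eq0.
rewrite -[RHS](line_integral_derive (x, 0) e0 dom cw cg dw w0).
apply: eq_integral => y _; congr ((_ \_ _) _)%:E.
exact: line_e2.
Qed.

Lemma integration_by_parts_plane (Omega : set (R * R)) (u v gu gv : R * R -> R)
    (e : R * R) :
  dirs R e -> convex_domain Omega ->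
  {within closure Omega, continuous u} -> {within closure Omega, continuous v} ->
  {within closure Omega, continuous gu} -> {within closure Omega, continuous gv} ->
  (forall p, Omega p -> derivable u p e /\ 'D_e u p = gu p) ->
  (forall p, Omega p -> derivable v p e /\ 'D_e v p = gv p) ->
  zero_on_boundary Omega v ->
  dotL2 Omega u gv = - dotL2 Omega gu v.
Proof.
move=> de dom cu cv cgu cgv du dv v0; have [_ oO bO _] := dom.
have cM (a b : R * R -> R) : {within closure Omega, continuous a} ->
    {within closure Omega, continuous b} ->
    {within closure Omega, continuous (fun p => a p * b p)}.
  by move=> ca cb p; apply: cvgM; [exact: ca|exact: cb].
have L2 a := @continuous_closure_L2 R Omega a oO bO.
apply/eqP; rewrite -addr_eq0; apply/eqP.
rewrite /dotL2 -RintegralD; first last.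
- have mO := open_measurable_plane oO.
  apply: (integrable_mkcond _ mO).2; rewrite restrict_EFin patchM.
  by apply: dotL2_integrable; exact: L2.
- have mO := open_measurable_plane oO.
  apply: (integrable_mkcond _ mO).2; rewrite restrict_EFin patchM.
  by apply: dotL2_integrable; exact: L2.
- exact: open_measurable_plane.
apply: (@plane_integral_derive _ (fun p => u p * v p) _ e) => //.
- exact: cM.
- move=> p; apply: cvgD; [exact: (cM _ _ cu cgv)|exact: (cM _ _ cgu cv)].
- move=> p Op; have [du1 du2] := du p Op; have [dv1 dv2] := dv p Op.
  have -> : (fun p0 => u p0 * v p0) = u * v by [].
  split; first exact: (@derivableM R _ u v p e du1 dv1).
  rewrite (@deriveM R _ u v p e du1 dv1) du2 dv2.
  by rewrite [gu p * _]mulrC.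
- by move=> p /v0 ->; rewrite mulr0.
Qed.

End DivergenceOnLines.

(** * Taylor's formula in L^2 *)

Section ScalarTaylor.
Context (R : realType) (T : R).
Implicit Types (s t K : R) (F G : R -> R).

(** Each integration of the derivative gains one power of the distance to
    [t]. *)
Lemma mean_value_power F G t K n : t \in `[0, T] ->
  {within `[0, T], continuous F} ->
  (forall s, s \in `]0, T[ -> is_derive s 1 F (G s)) ->
  0 <= K -> (forall s, s \in `]0, T[ -> `|G s| <= K * `|s - t| ^+ n) ->
  forall s, s \in `[0, T] -> `|F s - F t| <= K * `|s - t| ^+ n.+1.
Proof.
move=> t0T cF dF K0 bG.
have seg (x y : R) : x \in `[0, T] -> y \in `[0, T] -> x < y ->
    exists2 c, c \in `]x, y[ & F y - F x = G c * (y - x).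
  rewrite !in_itv /= => /andP[x0 xT] /andP[y0 yT] xy.
  have d c : c \in `]x, y[ -> is_derive c 1 F (G c).
    rewrite in_itv /= => /andP[xc cy]; apply: dF.
    by rewrite in_itv /= (le_lt_trans x0 xc) (lt_le_trans cy yT).
  have cxy : {within `[x, y], continuous F}.
    apply: continuous_subspaceW cF => c /=; rewrite !in_itv /=.
    by move=> /andP[xc cy]; rewrite (le_trans x0 xc) (le_trans cy yT).
  exact: MVT xy d cxy.
have inn x y c : x \in `[0, T] -> y \in `[0, T] -> c \in `]x, y[ -> c \in `]0, T[.
  rewrite !in_itv /= => /andP[x0 xT] /andP[y0 yT] /andP[xc cy].
  by rewrite (le_lt_trans x0) //= (lt_le_trans cy).
move=> s s0T; have [st|ts|->] := ltgtP s t; last 1 first.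
- by rewrite !subrr normr0 expr0n mulr0.
- have [c cst E] := seg _ _ s0T t0T st.
  rewrite distrC E normrM exprSr mulrA distrC; apply: ler_pM => //.
  apply: le_trans (bG _ (inn _ _ _ s0T t0T cst)) _.
  rewrite ler_wpM2l // lerXn2r ?nnegrE //.
  by move: cst; rewrite in_itv /= => /andP[? ?]; rewrite !ler0_norm; lra.
- have [c cst E] := seg _ _ t0T s0T ts.
  rewrite E normrM exprSr mulrA; apply: ler_pM => //.
  apply: le_trans (bG _ (inn _ _ _ t0T s0T cst)) _.
  rewrite ler_wpM2l // lerXn2r ?nnegrE //.
  by move: cst; rewrite in_itv /= => /andP[? ?]; rewrite !ger0_norm; lra.
Qed.

Lemma is_derive_taylor_term s t (c : R) i :
  is_derive s 1 (fun x => (x - t) ^+ i.+1 / (i.+1)`!%:R * c)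
    ((s - t) ^+ i / i`!%:R * c).
Proof.
have f0 j : j`!%:R != 0 :> R by rewrite pnatr_eq0 -lt0n fact_gt0.
have D : is_derive s 1 ((c / (i.+1)`!%:R) \*: ((id : R -> R) - cst t) ^+ i.+1)
    ((c / (i.+1)`!%:R) *: ((i.+1%:R * ((id : R -> R) - cst t) s ^+ i) *: (1 - 0))).
  exact: is_deriveZ.
have -> : (fun x => (x - t) ^+ i.+1 / (i.+1)`!%:R * c) =
    (c / (i.+1)`!%:R) \*: ((id : R -> R) - cst t) ^+ i.+1.
  apply/funext => x.
  have E : ((id - cst t) ^+ i.+1) x = (x - t) ^+ i.+1 by rewrite exprfctE.
  by rewrite /= E [RHS]mulrC mulrA mulrAC.
apply: is_derive_eq D _; rewrite !fctE /= -![_ *: _]/(_ * _) subr0 mulr1.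
have := f0 i; have := f0 i.+1; rewrite factS natrM mulf_eq0 negb_or => /andP[? ?] ?.
by field; apply/andP.
Qed.

(** Induction on [n]: the remainder of order [n + 1] vanishes at [t], and its
    derivative is the remainder of order [n] of the derivative. *)
Lemma taylor_scalar n r (F : nat -> R -> R) t K : t \in `[0, T] ->
  (forall i, (i <= n)%N -> {within `[0, T], continuous (F i)}) ->
  (forall i s, (i < n)%N -> s \in `]0, T[ -> is_derive s 1 (F i) (F i.+1 s)) ->
  0 <= K ->
  (forall s, s \in `[0, T] -> `|F n s - F n t| <= K * `|s - t| ^+ r) ->
  forall s, s \in `[0, T] ->
    `|F 0%N s - \sum_(i < n.+1) (s - t) ^+ i / i`!%:R * F i t|
      <= K * `|s - t| ^+ (n + r).
Proof.
move=> t0T; elim: n F => [|n IH] F cF dF K0 bF s s0T.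
  by rewrite big_ord_recl big_ord0 expr0 fact0 divr1 mul1r addr0; exact: bF.
have {}IH := IH (fun i => F i.+1) (fun i => cF i.+1) (fun i s => dF i.+1 s) K0 bF.
pose P (x : R) : R := \sum_(i < n.+1) (x - t) ^+ i.+1 / (i.+1)`!%:R * F i.+1 t.
have PE x : \sum_(i < n.+2) (x - t) ^+ i / i`!%:R * F i t = F 0%N t + P x.
  by rewrite big_ord_recl expr0 fact0 divr1 mul1r.
have P0 : P t = 0.
  by rewrite /P big1 // => i _; rewrite subrr expr0n mul0r mul0r.
have dP (x : R) : is_derive x 1 P (\sum_(i < n.+1) (x - t) ^+ i / i`!%:R * F i.+1 t).
  rewrite /P.
  have := is_derive_sum (fun i : 'I_n.+1 => is_derive_taylor_term x t (F i.+1 t) i).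
  by rewrite fct_sumE.
have cP : continuous P.
  by move=> x; apply: differentiable_continuous; apply/derivable1_diffP; exact: (@ex_derive _ _ _ _ _ _ _ (dP x)).
rewrite PE opprD addrA.
have itvW x : x \in `]0, T[ -> x \in `[0, T].
  by rewrite !in_itv /= => /andP[? ?]; rewrite !ltW.
have := @mean_value_power (F 0%N - P) _ t K (n + r) t0T _ _ K0
  (fun x xI => IH x (itvW x xI)) s s0T.
rewrite addSn !fctE P0 subr0 addrAC; apply.
- move=> x; apply: cvgB; first exact: cF.
  exact: (continuous_subspaceT cP).
- by move=> x xI; apply: is_deriveB; exact: dF.
Qed.

End ScalarTaylor.

Lemma sinner_suml (R : realType) (V : lmodType R) (S : V -> Prop)
    (d : V -> V -> R) (sd : semi_inner S d) n (c : 'I_n -> R) (x : 'I_n -> V) y :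
  (forall i, S (x i)) -> S y ->
  S (\sum_i c i *: x i) /\ d (\sum_i c i *: x i) y = \sum_i c i * d (x i) y.
Proof.
move=> Sx Sy; elim: n c x Sx => [|n IH] c x Sx.
  by rewrite !big_ord0 (sinner0l sd) //; split => //; exact: sinner0 sd.
rewrite !big_ord_recl; have [S1 E] := IH (fun i => c (lift ord0 i)) _ (fun i => Sx (lift ord0 i)).
split; first exact: (sinnerP sd).
by rewrite (sinner_linear sd) // E.
Qed.

Section L2Calculus.
Context (R : realType) (Omega : set (R * R)) (T : R).
Local Notation V := (R * R -> R).
Local Notation S := (inL2 Omega).
Local Notation d := (dotL2 Omega).
Local Notation sd := (L2_semi_inner Omega).
Implicit Types (u : R -> V) (s t : R).

Let within_imply (A : set R) t (P Q : R -> Prop) :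
  (forall s, A s -> P s -> Q s) -> (\forall s \near within A (nbhs t), P s) ->
  \forall s \near within A (nbhs t), Q s.
Proof.
move=> PQ h; have {}h : nbhs t (fun s => A s -> P s) := h.
suff : nbhs t (fun s => A s -> Q s) by [].
by move: h; apply: filterS => s h As; apply: PQ (h As).
Qed.

Lemma L2_continuous_weak u (y : V) : L2_valued Omega T u ->
  continuous_in_time T (normL2 Omega) u -> S y ->
  {within `[0, T], continuous (fun s => d (u s) y)}.
Proof.
move=> Su cu Sy; apply/subspace_continuousP => t tI.
apply/cvgrPdist_le => e e0.
have e1 : 0 < e / (snorm d y + 1) by rewrite divr_gt0 // ltr_wpDl ?snorm_ge0.
have /cvgrPdist_le/(_ _ e1) := cu t tI.
apply: within_imply => s sI.
have Sust : S (u s - u t) by apply: (sinner_memB sd); exact: Su.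
rewrite sub0r normrN normL2E // ger0_norm ?snorm_ge0 // => h.
rewrite distrC /from_subspace -(sinnerBl sd) //; try exact: Su.
apply: le_trans (sinner_le sd Sust Sy) _.
apply: (@le_trans _ _ (e / (snorm d y + 1) * (snorm d y + 1))).
  by apply: ler_pM; rewrite ?snorm_ge0 // lerDl.
by rewrite divfK // gt_eqF // ltr_wpDl ?snorm_ge0.
Qed.

Lemma L2_continuous_bounded u : L2_valued Omega T u ->
  continuous_in_time T (normL2 Omega) u ->
  exists2 K : R, 0 <= K & forall t, t \in `[0, T] -> snorm d (u t) <= K.
Proof.
move=> Su cu.
have cn : {within `[0, T], continuous (fun s => snorm d (u s))}.
  apply/subspace_continuousP => t tI; apply/cvgrPdist_le => e e0.
  have /cvgrPdist_le/(_ _ e0) := cu t tI.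
  apply: within_imply => s sI.
  have Sust : S (u s - u t) by apply: (sinner_memB sd); exact: Su.
  rewrite sub0r normrN normL2E // ger0_norm ?snorm_ge0 // => h.
  by rewrite distrC; apply: le_trans (snorm_dist sd _ _) h; exact: Su.
have /compact_bounded/bounded_setP[M HM] := continuous_compact cn (@segment_compact R 0 T).
exists `|M| => // t tI; apply: le_trans (ler_norm M).
by apply: le_trans (ler_norm _) (HM _ _); exists t.
Qed.

Lemma L2_timeD_weak u (t : R) (l y : V) : L2_valued Omega T u -> S y ->
  t \in `]0, T[ -> is_timeD Omega T u t l ->
  is_derive t 1 (fun s => d (u s) y) (d l y).
Proof.
move=> Su Sy tI [Sl cl].
have t0T : t \in `[0, T] by move: tI; rewrite !in_itv /= => /andP[? ?]; rewrite !ltW.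
suff lim : (fun h : R => h^-1 *: (d (u (h *: 1 + t)) y - d (u t) y)) @ 0^' --> d l y.
  split; first by apply/cvg_ex; exists (d l y).
  exact: cvg_lim lim.
apply/cvgrPdist_le => e e0.
have e1 : 0 < e / (snorm d y + 1) by rewrite divr_gt0 // ltr_wpDl ?snorm_ge0.
have /cvgrPdist_le/(_ _ e1) := cl.
have n0T : nbhs t `]0, T[%classic.
  by apply: open_nbhs_nbhs; split => //; exact: interval_open.
rewrite near_withinE => /nbhs_ballP[r1 /= r10 h1].
have /nbhs_ballP[r2 /= r20 h2] := n0T.
apply/nbhs_ballP; exists (Num.min r1 r2); rewrite /= ?lt_min ?r10 //.
move=> h /=; rewrite /ball /= sub0r normrN lt_min => /andP[hr1 hr2] hn0.
have htt : h *: 1 + t = t + h by rewrite [h *: 1]mulr1 addrC.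
rewrite htt; set s := t + h.
have sI : s \in `[0, T].
  have : ball t r2 s by rewrite /ball /= /s opprD addNKr normrN.
  by move=> /h2; rewrite /= !in_itv /= => /andP[? ?]; rewrite !ltW.
have st : s - t = h by rewrite /s addrC addKr.
have bs : ball t r1 s by rewrite /ball /= /s opprD addNKr normrN.
have sn : s != t by rewrite -subr_eq0 st.
have Sust : S (u s - u t) by apply: (sinner_memB sd); exact: Su.
have SQ : S (h^-1 *: (u s - u t)) by exact: (sinner_memZ sd).
have SD : S (h^-1 *: (u s - u t) - l) by exact: (sinner_memB sd).
have := h1 s bs sn sI.
rewrite sub0r normrN st.
rewrite (_ : (_ \*o _) \- _ = h^-1 *: (u s - u t) - l) // normL2E //.
rewrite ger0_norm ?snorm_ge0 // => b.
have -> : d l y - h^-1 *: (d (u s) y - d (u t) y) = - d (h^-1 *: (u s - u t) - l) y.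
  rewrite (sinnerBl sd) // (sinnerZl sd) // (sinnerBl sd) //; try exact: Su.
  by rewrite opprB.
rewrite normrN; apply: le_trans (sinner_le sd SD Sy) _.
apply: (@le_trans _ _ (e / (snorm d y + 1) * (snorm d y + 1))).
  by apply: ler_pM; rewrite ?snorm_ge0 // lerDl.
by rewrite divfK // gt_eqF // ltr_wpDl ?snorm_ge0.
Qed.

(** Taylor's formula for functions with values in [L^2]: pairing with the
    remainder itself reduces it to real functions. *)
Lemma taylor_L2 n r (D : nat -> R -> V) t K : t \in `[0, T] ->
  (forall i, (i <= n)%N ->
    L2_valued Omega T (D i) /\ continuous_in_time T (normL2 Omega) (D i)) ->
  (forall i s, (i < n)%N -> s \in `[0, T] -> is_timeD Omega T (D i) s (D i.+1 s)) ->
  0 <= K ->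
  (forall s, s \in `[0, T] -> snorm d (D n s - D n t) <= K * `|s - t| ^+ r) ->
  forall s, s \in `[0, T] ->
    snorm d (D 0%N s - \sum_(i < n.+1) ((s - t) ^+ i / i`!%:R) *: D i t)
      <= K * `|s - t| ^+ (n + r).
Proof.
move=> t0T Dn dD K0 bD s s0T.
have SD i : (i <= n)%N -> L2_valued Omega T (D i) by move=> /Dn[].
have Sum y (Sy : S y) := @sinner_suml _ _ _ _ sd _
  (fun i : 'I_n.+1 => (s - t) ^+ i / i`!%:R) (fun i : 'I_n.+1 => D i t) y
  (fun i => SD i (ltn_ord i) t t0T) Sy.
have Srem : S (D 0%N s - \sum_(i < n.+1) ((s - t) ^+ i / i`!%:R) *: D i t).
  by apply: (sinner_memB sd); [exact: SD|exact: (Sum 0 (sinner0 sd)).1].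
apply: (snorm_le_dual sd) => //; first by rewrite mulr_ge0 ?exprn_ge0.
move=> y Sy; rewrite (sinnerBl sd) //; [|exact: SD|exact: (Sum y Sy).1].
rewrite (Sum y Sy).2; apply: le_trans (ler_norm _) _.
have -> : K * `|s - t| ^+ (n + r) * snorm d y = (K * snorm d y) * `|s - t| ^+ (n + r).
  by rewrite mulrAC.
apply: (@taylor_scalar _ T n r (fun i x => d (D i x) y)) => //.
- by move=> i /Dn[? ?]; exact: L2_continuous_weak.
- move=> i x i_n xI; apply: L2_timeD_weak => //; first exact: SD (ltnW i_n).
  by apply: dD => //; move: xI; rewrite !in_itv /= => /andP[? ?]; rewrite !ltW.
- by rewrite mulr_ge0 ?snorm_ge0.
- move=> x xI; have Sn := SD n (leqnn n).
  rewrite -(sinnerBl sd) //; try exact: Sn.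
  have Sxt : S (D n x - D n t) by apply: (sinner_memB sd); exact: Sn.
  apply: le_trans (sinner_le sd Sxt Sy) _.
  by rewrite -mulrA [snorm _ _ * _ in leRHS]mulrC mulrA ler_wpM2r ?snorm_ge0 ?bD.
Qed.

End L2Calculus.

(** * Weak derivatives and the span of the test functions *)

Section WeakDerivatives.
Context (R : realType) (Omega : set (R * R)).
Hypotheses (oO : open Omega) (bO : bounded_set Omega).
Local Notation V := (R * R -> R).
Local Notation S := (inL2 Omega).
Local Notation d := (dotL2 Omega).
Local Notation sd := (L2_semi_inner Omega).
Implicit Types (u v w g x y phi : V) (e : R * R).

Lemma test_fun_continuous phi (A : set (R * R)) :
  test_fun Omega phi -> {within A, continuous phi}.
Proof.
move=> [/(_ 0%N) [cphi _] _ _]; apply: continuous_subspaceW cphi.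
by rewrite closureT.
Qed.

Lemma test_fun_L2 phi : test_fun Omega phi -> S phi.
Proof. by move=> tphi; apply: continuous_closure_L2 => //; exact: test_fun_continuous. Qed.

Lemma test_fun_derive phi e : dirs R e ->
  test_fun Omega phi -> test_fun Omega ('D_e phi).
Proof.
move=> de [smooth csupp suppO].
have supp : closure [set p | 'D_e phi p != 0] `<=` closure [set p | phi p != 0].
  have /closure_id E : closed (closure [set p | phi p != 0]) by exact: closed_closure.
  rewrite [X in _ `<=` X]E; apply: closure_subset => p /= Dp; apply: contrapT => np.
  have op : open (~` closure [set p | phi p != 0]).
    by apply: closed_openC; exact: closed_closure.
  have n0 : \forall q \near p, phi q = 0.
    have := open_nbhs_nbhs (conj op np); apply: filterS => q /= nq.
    by apply: contrapT => /eqP phiq; apply: nq; exact: subset_closure.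
  move/eqP: Dp; apply.
  by rewrite (near_eq_derive (g := cst 0)) ?derive_cst //.
split.
- move=> k; have [_ /(_ e de)[_ [g Cg gE]]] := smooth k.+1.
  by rewrite (_ : 'D_e phi = g) //; apply/funext => p; rewrite gE.
- apply: subclosed_compact csupp supp; exact: closed_closure.
- exact: subset_trans suppO.
Qed.

Definition test_orth x : Prop := S x /\ forall phi, test_fun Omega phi -> d x phi = 0.

(** The biorthogonal of the test functions.  It takes the place of their closure,
    and membership is stable under limits and linear combinations for free. *)
Definition test_span g : Prop := S g /\ forall x, test_orth x -> d g x = 0.

Lemma test_fun_span phi : test_fun Omega phi -> test_span phi.
Proof.
move=> tphi; split; first exact: test_fun_L2.
by move=> x [_ ox]; rewrite (sinnerC sd) ox.
Qed.

Lemma test_span_linear c g y : test_span g -> test_span y -> test_span (c *: g + y).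
Proof.
move=> [Sg og] [Sy oy]; split; first exact: (sinnerP sd).
move=> x ox; have [Sx _] := ox.
by rewrite (sinner_linear sd) // og // oy // mulr0 addr0.
Qed.

Lemma test_span0 : test_span 0.
Proof. by split; [exact: sinner0 sd|move=> x [Sx _]; rewrite (sinner0l sd)]. Qed.

Lemma test_spanZ c g : test_span g -> test_span (c *: g).
Proof. by move=> sg; rewrite -[_ *: _]addr0; exact: test_span_linear sg test_span0. Qed.

Lemma test_spanB g y : test_span g -> test_span y -> test_span (g - y).
Proof.
by move=> sg sy; rewrite addrC -scaleN1r; exact: test_span_linear.
Qed.

Lemma test_span_orth0 g : test_span g -> test_orth g -> snorm d g = 0.
Proof. by move=> [_ sg] og; rewrite /snorm sg // sqrtr0. Qed.

Lemma dotL2_cvg (g : nat -> V) x y : (forall n, S (g n)) -> S x -> S y ->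
  (fun n => normL2 Omega (g n \- x)) @ \oo --> (0 : R) ->
  (fun n => d y (g n)) @ \oo --> d y x.
Proof.
move=> Sg Sx Sy /cvgrPdist_le cg; apply/cvgrPdist_le => e e0.
have e1 : 0 < e / (snorm d y + 1) by rewrite divr_gt0 // ltr_wpDl ?snorm_ge0.
apply: filterS (cg _ e1) => n; have Sgx : S (g n - x) by exact: (sinner_memB sd).
rewrite sub0r normrN normL2E // ger0_norm ?snorm_ge0 // => h.
rewrite distrC -(sinnerBr sd) //; apply: le_trans (sinner_le sd Sy Sgx) _.
rewrite mulrC; apply: (@le_trans _ _ (e / (snorm d y + 1) * (snorm d y + 1))).
  by apply: ler_pM; rewrite ?snorm_ge0 // lerDl.
by rewrite divfK // gt_eqF // ltr_wpDl ?snorm_ge0.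
Qed.

Lemma test_span_limit (g : nat -> V) x : S x -> (forall n, test_span (g n)) ->
  (fun n => normL2 Omega (g n \- x)) @ \oo --> (0 : R) -> test_span x.
Proof.
move=> Sx sg cg; split => // y oy; have [Sy _] := oy.
rewrite (sinnerC sd).
have c1 := dotL2_cvg (fun n => (sg n).1) Sx Sy cg.
have c0 : (fun n => d y (g n)) @ \oo --> (0 : R).
  rewrite (_ : (fun n => _) = cst 0); first exact: cvg_cst.
  by apply/funext => n; rewrite (sinnerC sd) (sg n).2.
exact: (cvg_unique (@Rhausdorff R) c1 c0).
Qed.

Lemma weakDP e u : weakly_derivable Omega e u -> is_weakD Omega e u (weakD Omega e u).
Proof. by move=> h; rewrite /weakD; apply: (@xgetPex _ (cst 0) [set g | is_weakD Omega e u g]). Qed.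

Lemma is_weakD_ae e u v g : dirs R e -> S u -> S v -> eqL2 Omega u v ->
  is_weakD Omega e u g -> is_weakD Omega e v g.
Proof.
move=> de Su Sv uv [Sg wg]; split => // phi tphi; rewrite -wg //.
by apply/esym/dotL2_ae => //; apply: test_fun_L2; exact: test_fun_derive.
Qed.

Lemma eqL2_sym u v : eqL2 Omega u v -> eqL2 Omega v u.
Proof.
apply: (@filterS _ _ (ae_filter_ringOfSetsType (mu2 R))) => p h Op.
by rewrite h.
Qed.

(** As the weak derivative is chosen among all candidates, functions that are
    equal almost everywhere have literally the same one. *)
Lemma weakD_ae e u v : dirs R e -> S u -> S v -> eqL2 Omega u v ->
  weakD Omega e u = weakD Omega e v.
Proof.
move=> de Su Sv uv; congr (xget _ _); apply/seteqP; split => g /=.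
  exact: is_weakD_ae.
by apply: is_weakD_ae => //; exact: eqL2_sym.
Qed.

Lemma is_weakD_linear e c u v g y : dirs R e -> S u -> S v ->
  is_weakD Omega e u g -> is_weakD Omega e v y ->
  is_weakD Omega e (c *: u + v) (c *: g + y).
Proof.
move=> de Su Sv [Sg wg] [Sy wy]; split; first exact: (sinnerP sd).
move=> phi tphi; have Sp := test_fun_L2 tphi.
have Sdp := test_fun_L2 (test_fun_derive de tphi).
by rewrite !(sinner_linear sd) // wg // wy // mulrN opprD.
Qed.

(** The difference of two weak derivatives is orthogonal to the test functions;
    if it also lies in their span it is orthogonal to itself. *)
Lemma is_weakD_unique e u g y : is_weakD Omega e u g -> is_weakD Omega e u y ->
  test_span g -> test_span y -> snorm d (g - y) = 0.
Proof.
move=> [Sg wg] [Sy wy] sg sy; apply: test_span_orth0; first exact: test_spanB.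
split; first exact: (sinner_memB sd).
move=> phi tphi; have Sp := test_fun_L2 tphi; rewrite (sinnerBl sd) //.
have := wg _ tphi; rewrite wy // => /eqP; rewrite eqr_opp => /eqP ->.
by rewrite subrr.
Qed.

Lemma H10_L2 u : in_H10 Omega u -> S u. Proof. by case. Qed.

Lemma H10_weakD e u : dirs R e -> in_H10 Omega u ->
  is_weakD Omega e u (weakD Omega e u).
Proof. by move=> de [_ /(_ e de) h _]; exact: weakDP. Qed.

Lemma H10_weakD_L2 e u : dirs R e -> in_H10 Omega u -> S (weakD Omega e u).
Proof. by move=> de hu; case: (H10_weakD de hu). Qed.

Lemma H10_span u : in_H10 Omega u -> test_span u.
Proof.
move=> [Su _ [phi [tphi cphi _]]]; apply: test_span_limit cphi => // n.
exact: test_fun_span.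
Qed.

Lemma H10_weakD_span e u : dirs R e -> in_H10 Omega u ->
  test_span (weakD Omega e u).
Proof.
move=> de hu; have [Su _ [phi [tphi _ /(_ e de) cphi]]] := hu.
apply: test_span_limit cphi; first exact: H10_weakD_L2.
by move=> n; apply: test_fun_span; exact: test_fun_derive.
Qed.

(** The definition of the weak derivative extends from test functions to their
    limits in the [H^1] norm. *)
Lemma weakD_ibp_H10 e g y v : dirs R e -> S g -> is_weakD Omega e g y ->
  in_H10 Omega v -> d y v = - d g (weakD Omega e v).
Proof.
move=> de Sg [Sy wy] hv; have [Sv _ [phi [tphi cphi /(_ e de) cDphi]]] := hv.
have Sphi n := test_fun_L2 (tphi n).
have SDphi n := test_fun_L2 (test_fun_derive de (tphi n)).
have c1 := dotL2_cvg Sphi Sv Sy cphi.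
have c2 := dotL2_cvg SDphi (H10_weakD_L2 de hv) Sg cDphi.
have : (fun n => - d g ('D_e (phi n))) @ \oo --> - d g (weakD Omega e v).
  exact: cvgN.
rewrite (_ : (fun n => _) = (fun n => d y (phi n))); last first.
  by apply/funext => n; rewrite wy // opprK.
by move=> c3; exact: (cvg_unique (@Rhausdorff R) c1 c3).
Qed.

Lemma dirs1 : dirs R (e1 R). Proof. by left. Qed.
Lemma dirs2 : dirs R (e2 R). Proof. by right. Qed.

Lemma dirichlet_weak_laplace u v : in_H10 Omega u ->
  has_pure_second_derivatives Omega u -> in_H10 Omega v ->
  dirichlet Omega u v = d (- weak_laplace Omega u) v.
Proof.
move=> hu u2 hv; have Sv := H10_L2 hv.
have Suu e (de : dirs R e) : is_weakD Omega e (weakD Omega e u)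
    (weakD Omega e (weakD Omega e u)) by apply: weakDP; exact: (u2 e de).2.
have S1 := (Suu _ dirs1).1; have S2 := (Suu _ dirs2).1.
have -> : - weak_laplace Omega u = - (weakD Omega (e1 R) (weakD Omega (e1 R) u)
   + weakD Omega (e2 R) (weakD Omega (e2 R) u)) by [].
rewrite (sinnerNl sd) //; last exact: (sinner_memD sd).
rewrite (sinnerDl sd) //.
have E1 := weakD_ibp_H10 dirs1 (H10_weakD_L2 dirs1 hu) (Suu _ dirs1) hv.
have E2 := weakD_ibp_H10 dirs2 (H10_weakD_L2 dirs2 hu) (Suu _ dirs2) hv.
by rewrite -[LHS]opprK opprD; congr (- (_ + _)); [exact: esym E1|exact: esym E2].
Qed.

End WeakDerivatives.

Section WeakTime.
Context (R : realType) (Omega : set (R * R)) (T : R).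
Hypotheses (oO : open Omega) (bO : bounded_set Omega) (T_gt0 : 0 < T).
Local Notation V := (R * R -> R).
Local Notation S := (inL2 Omega).
Local Notation d := (dotL2 Omega).
Local Notation sd := (L2_semi_inner Omega).
Implicit Types (u : R -> V) (t : R) (l y : V).

Lemma within_segment_proper t : t \in `[0, T] ->
  ProperFilter (within `[0, T] t^').
Proof.
rewrite in_itv /= => /andP[t0 tT]; split; last exact: within_filter.
move=> /nbhs_ballP[r /= r0 /= H].
pose h := Num.min (r / 2) (T / 2).
have h0 : 0 < h by rewrite lt_min !divr_gt0.
have hr : h < r by rewrite gt_min ltr_pdivrMr // ltr_pMr // ltr1n.
have hT : h <= T / 2 by rewrite ge_min lexx orbT.
have [tT2|tT2] := leP t (T / 2).
- apply: (H (t + h)).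
  + by rewrite /ball /= opprD addNKr normrN gtr0_norm.
  + by rewrite gt_eqF // ltrDl.
  + by rewrite /= in_itv /= addr_ge0 ?(ltW h0) //=; lra.
- apply: (H (t - h)).
  + by rewrite /ball /= opprB addrC subrK gtr0_norm.
  + by rewrite lt_eqF // ltrBlDr ltrDl.
  + by rewrite /= in_itv /=; apply/andP; split; lra.
Qed.

Lemma is_timeD_dot u t l y : L2_valued Omega T u -> S y -> t \in `[0, T] ->
  is_timeD Omega T u t l ->
  (fun s => (s - t)^-1 * (d (u s) y - d (u t) y)) @ within `[0, T] t^' --> d l y.
Proof.
move=> Su Sy tI [Sl /cvgrPdist_le cl]; apply/cvgrPdist_le => e e0.
have e1 : 0 < e / (snorm d y + 1) by rewrite divr_gt0 // ltr_wpDl ?snorm_ge0.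
have h : nbhs t^' (fun s => s \in `[0, T] ->
  `|0 - normL2 Omega ((s - t)^-1 \*o (u s \- u t) \- l)| <= e / (snorm d y + 1)).
  exact: cl _ e1.
suff : nbhs t^' (fun s => s \in `[0, T] ->
  `|d l y - (s - t)^-1 * (d (u s) y - d (u t) y)| <= e) by [].
move: h; apply: filterS => s h sI; move: (h sI).
have Sust : S (u s - u t) by apply: (sinner_memB sd); exact: Su.
have SQ : S ((s - t)^-1 *: (u s - u t)) by exact: (sinner_memZ sd).
have SD : S ((s - t)^-1 *: (u s - u t) - l) by exact: (sinner_memB sd).
rewrite sub0r normrN.
rewrite (_ : (_ \*o _) \- _ = (s - t)^-1 *: (u s - u t) - l) // normL2E //.
rewrite ger0_norm ?snorm_ge0 // => b.
have -> : d l y - (s - t)^-1 * (d (u s) y - d (u t) y)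
    = - d ((s - t)^-1 *: (u s - u t) - l) y.
  rewrite (sinnerBl sd) // (sinnerZl sd) // (sinnerBl sd) //; try exact: Su.
  by rewrite opprB.
rewrite normrN; apply: le_trans (sinner_le sd SD Sy) _.
apply: (@le_trans _ _ (e / (snorm d y + 1) * (snorm d y + 1))).
  by apply: ler_pM; rewrite ?snorm_ge0 // lerDl.
by rewrite divfK // gt_eqF // ltr_wpDl ?snorm_ge0.
Qed.

(** Difference quotients stay in the span, which is closed. *)
Lemma timeD_span u t l : (forall s, s \in `[0, T] -> test_span Omega (u s)) ->
  t \in `[0, T] -> is_timeD Omega T u t l -> test_span Omega l.
Proof.
move=> su tI ul; have [Sl _] := ul; split => // x ox; have [Sx _] := ox.
have Su : L2_valued Omega T u by move=> s /su[].
have PF := within_segment_proper tI.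
have c1 := is_timeD_dot Su Sx tI ul.
have c0 : (fun s => (s - t)^-1 * (d (u s) x - d (u t) x)) @ within `[0, T] t^'
    --> (0 : R).
  apply/cvgrPdist_le => e e0.
  suff : nbhs t^' (fun s => s \in `[0, T] ->
    `|0 - (s - t)^-1 * (d (u s) x - d (u t) x)| <= e) by [].
  apply: nearW => s _ sI; have [_ ->//] := su s sI; have [_ ->//] := su t tI.
  by rewrite subrr mulr0 subrr normr0 ltW.
exact: (cvg_unique (@Rhausdorff R) c1 c0).
Qed.

(** Weak derivation in space commutes with derivation in time, as the weak
    derivative is a closed operator. *)
Lemma timeD_weakD e u t l y : dirs R e ->
  (forall s, s \in `[0, T] -> S (u s) /\ weakly_derivable Omega e (u s)) ->
  t \in `[0, T] -> is_timeD Omega T u t l ->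
  is_timeD Omega T (fun s => weakD Omega e (u s)) t y -> is_weakD Omega e l y.
Proof.
move=> de wu tI ul gy; have [Sy _] := gy; split => // phi tphi.
have PF := within_segment_proper tI.
have Sphi := test_fun_L2 oO bO tphi.
have SDphi := test_fun_L2 oO bO (test_fun_derive de tphi).
have Su : L2_valued Omega T u by move=> s /wu[].
have wg s : s \in `[0, T] -> is_weakD Omega e (u s) (weakD Omega e (u s)).
  by move=> /wu[_]; exact: weakDP.
have Sg : L2_valued Omega T (fun s => weakD Omega e (u s)) by move=> s /wg[].
have c1 := is_timeD_dot Su SDphi tI ul.
have /cvgN c2 := is_timeD_dot Sg Sphi tI gy.
apply: (cvg_unique (@Rhausdorff R) c1); apply: cvg_trans c2.
apply: near_eq_cvg.
suff : nbhs t^' (fun s => s \in `[0, T] ->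
   - ((s - t)^-1 * (d (weakD Omega e (u s)) phi - d (weakD Omega e (u t)) phi))
   = (s - t)^-1 * (d (u s) ('D_e phi) - d (u t) ('D_e phi))) by [].
apply: nearW => s _ sI.
have aux (q a1 a2 b1 b2 : R) : a1 = - b1 -> a2 = - b2 ->
    - (q * (b1 - b2)) = q * (a1 - a2) by move=> -> ->; ring.
exact: aux ((wg s sI).2 _ tphi) ((wg t tI).2 _ tphi).
Qed.

End WeakTime.

(** * Regularity in time *)

Section SmoothInTime.
Context (R : realType) (Omega : set (R * R)) (T : R).
Hypothesis T_gt0 : 0 < T.
Local Notation V := (R * R -> R).
Local Notation S := (inL2 Omega).
Local Notation d := (dotL2 Omega).
Local Notation sd := (L2_semi_inner Omega).
Implicit Types (u v w : R -> V) (s t h K : R).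

Lemma C1_segment_lipschitz (a : R -> R) : C1_segment T a ->
  exists2 K : R, 0 <= K &
    forall s t, s \in `[0, T] -> t \in `[0, T] -> `|a s - a t| <= K * `|s - t|.
Proof.
have clT : `[0, T] `<=` closure `]0, T[ by exact: segment_sub_closure.
move=> [ca /(_ 1 erefl) [da [g [cg _] ga]]].
have cgT := continuous_subspaceW clT cg.
have /compact_bounded/bounded_setP[M HM] := continuous_compact cgT (@segment_compact R 0 T).
exists `|M| => // s t sI tI; rewrite -[`|s - t|]expr1.
apply: (@mean_value_power R T a g) => //.
- exact: continuous_subspaceW ca.
- move=> x xI; rewrite ga //; split => //; exact: da.
- move=> x xI; rewrite expr0 mulr1; apply: le_trans (ler_norm M); apply: HM.
  exists x => //; move: xI; rewrite /= !in_itv /= => /andP[? ?]; by rewrite !ltW.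
Qed.

Lemma C1_segment_bounds (a : R -> R) : C1_segment T a ->
  (forall t, t \in `[0, T] -> 0 < a t) ->
  exists c M : R, 0 < c /\ forall t, t \in `[0, T] -> c <= a t <= M.
Proof.
move=> [ca _] a0.
have clT : `[0, T] `<=` closure `]0, T[ by exact: segment_sub_closure.
have cT := continuous_subspaceW clT ca.
have [x xI xm] := EVT_min (ltW T_gt0) cT.
have [y yI ym] := EVT_max (ltW T_gt0) cT.
exists (a x), (a y); split; first exact: a0.
by move=> t tI; rewrite xm ?ym.
Qed.

(** The three bounds on a [C^{1,1}] function of time that the truncation error
    of the scheme depends on. *)
Definition C11 u K : Prop :=
  [/\ forall t, t \in `[0, T] -> S (u t) /\ snorm d (u t) <= K,
      forall s t, s \in `[0, T] -> t \in `[0, T] ->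
        snorm d (u s - u t) <= K * `|s - t|
    & forall t h, t - h \in `[0, T] -> t \in `[0, T] -> t + h \in `[0, T] ->
        snorm d (u (t + h) - u t - (u t - u (t - h))) <= K * h ^+ 2].

Lemma timeDP u t : (exists l, is_timeD Omega T u t l) ->
  is_timeD Omega T u t (timeD Omega T u t).
Proof.
by move=> h; rewrite /timeD; apply: (@xgetPex _ (cst 0) [set l | is_timeD Omega T u t l]).
Qed.

Lemma Ck_time_C0 k u : Ck_time Omega T k u ->
  L2_valued Omega T u /\ continuous_in_time T (normL2 Omega) u.
Proof. by case: k => [|k] []. Qed.

Lemma Ck_timeW k u : Ck_time Omega T k.+1 u -> Ck_time Omega T k u.
Proof.
elim: k u => [|k IH] u; first by case=> ? ? _.
by case=> ? ? [? ?]; split => //; split => //; exact: IH.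
Qed.

Lemma Ck_time_timeD k u : Ck_time Omega T k.+1 u ->
  (forall t, t \in `[0, T] -> is_timeD Omega T u t (timeD Omega T u t)) /\
  Ck_time Omega T k (timeD Omega T u).
Proof. by case=> _ _ [h ?]; split => // t /h; exact: timeDP. Qed.

Lemma Ck_time_iter k u i : (i <= k)%N -> Ck_time Omega T k u ->
  Ck_time Omega T (k - i) (iter i (timeD Omega T) u).
Proof.
elim: i => [|i IH] ik Cu; first by rewrite subn0.
have := IH (ltnW ik) Cu; rewrite subnS -[(k - i)%N]prednK ?subn_gt0 //.
by move=> /Ck_time_timeD[_].
Qed.

Lemma taylor_Ck n r u t K : t \in `[0, T] -> Ck_time Omega T n u -> 0 <= K ->
  (forall s, s \in `[0, T] -> snorm d (iter n (timeD Omega T) u s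
     - iter n (timeD Omega T) u t) <= K * `|s - t| ^+ r) ->
  forall s, s \in `[0, T] ->
    snorm d (u s - \sum_(i < n.+1)
      ((s - t) ^+ i / i`!%:R) *: iter i (timeD Omega T) u t)
      <= K * `|s - t| ^+ (n + r).
Proof.
move=> tI Cu K0 bK; apply: (@taylor_L2 _ _ _ n r (fun i => iter i (timeD Omega T) u)) => //.
  by move=> i /(Ck_time_iter)/(_ Cu)/Ck_time_C0.
move=> i s i_n sI; have := Ck_time_iter (ltnW i_n) Cu.
rewrite -[(n - i)%N]prednK ?subn_gt0 // => /Ck_time_timeD[h _]; exact: h.
Qed.

(** The remainder of first order is bounded by [2 B |s - t|] because the
    derivative is bounded by [B]. *)
Lemma C1_time_lipschitz u : Ck_time Omega T 1 u ->
  exists2 K : R, 0 <= K & forall s t, s \in `[0, T] -> t \in `[0, T] ->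
    snorm d (u s - u t) <= K * `|s - t|.
Proof.
move=> Cu; have [Su _] := Ck_time_C0 Cu.
have [du /Ck_time_C0[Sdu cdu]] := Ck_time_timeD Cu.
have [B B0 HB] := L2_continuous_bounded Sdu cdu.
exists (3 * B) => [|s t sI tI]; first by rewrite mulr_ge0.
have Sst := sinner_memB sd (Su s sI) (Su t tI).
have b2 x : x \in `[0, T] -> snorm d (iter 1 (timeD Omega T) u x
     - iter 1 (timeD Omega T) u t) <= 2 * B * `|x - t| ^+ 0.
  move=> xI; rewrite expr0 mulr1; apply: le_trans (snormB sd (Sdu x xI) (Sdu t tI)) _.
  rewrite (_ : 2 * B = B + B); last by ring.
  by apply: lerD; apply: HB.
have := @taylor_Ck 1 0 u t (2 * B) tI Cu (mulr_ge0 (ler0n R 2) B0) b2 s sI.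
rewrite !big_ord_recl big_ord0 /= expr0 expr1 addr0 !divr1 scale1r.
rewrite opprD addrA addn0 expr1 => h.
have SQ : S ((s - t) *: timeD Omega T u t) by apply: (sinner_memZ sd); exact: Sdu.
rewrite -[u s - u t](subrK ((s - t) *: timeD Omega T u t)).
apply: le_trans (snormD sd (sinner_memB sd Sst SQ) SQ) _.
rewrite (snormZ sd); last exact: Sdu.
rewrite (_ : 3 * B * _ = 2 * B * `|s - t| + `|s - t| * B); last by ring.
by apply: lerD h _; rewrite ler_wpM2l // HB.
Qed.

(** The second difference is the sum of the Taylor remainders at [t + h] and
    [t - h], since the first order terms cancel. *)
Lemma C1_lipschitz_C11 u K : 0 <= K -> Ck_time Omega T 1 u ->
  (forall s t, s \in `[0, T] -> t \in `[0, T] ->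
    snorm d (timeD Omega T u s - timeD Omega T u t) <= K * `|s - t|) ->
  exists2 K' : R, 0 <= K' & C11 u K'.
Proof.
move=> K0 Cu lK; have [Su cu] := Ck_time_C0 Cu.
have [B B0 HB] := L2_continuous_bounded Su cu.
have [L L0 HL] := C1_time_lipschitz Cu.
have [du /Ck_time_C0[Sdu cdu]] := Ck_time_timeD Cu.
exists (B + L + 2 * K); first by rewrite !(addr_ge0, mulr_ge0).
have K2 : 0 <= 2 * K by rewrite mulr_ge0.
have leB : B <= B + L + 2 * K by rewrite -addrA lerDl addr_ge0.
have leL : L <= B + L + 2 * K by rewrite addrAC lerDr addr_ge0.
split.
- move=> t tI; split; [exact: Su|exact: le_trans (HB t tI) leB].
- move=> s t sI tI; apply: le_trans (HL s t sI tI) _.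
  by rewrite ler_wpM2r.
- move=> t h m0 t0 p0.
  have ty s (sI : s \in `[0, T]) : snorm d (u s - u t - (s - t) *: timeD Omega T u t)
      <= K * h ^+ 2 \/ `|s - t| != `|h|.
    have [E|] := eqVneq `|s - t| `|h|; [left|by right].
    have := @taylor_Ck 1 1 u t K t0 Cu K0 _ s sI.
    rewrite !big_ord_recl big_ord0 /= expr0 expr1 addr0 !divr1 scale1r.
    rewrite opprD addrA E real_normK ?num_real //; apply.
    by move=> x xI; rewrite expr1; exact: lK.
  have ph : t + h - t = h by rewrite addrC addKr.
  have mh : t - h - t = - h by rewrite addrC addKr.
  have [hp|] := ty _ p0; last by rewrite ph eqxx.
  have [hm|] := ty _ m0; last by rewrite mh normrN eqxx.
  rewrite ph in hp; rewrite mh scaleNr opprK in hm.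
  have SQ : S (h *: timeD Omega T u t) by apply: (sinner_memZ sd); exact: Sdu.
  have Sp := sinner_memB sd (Su _ p0) (Su _ t0).
  have Sm := sinner_memB sd (Su _ m0) (Su _ t0).
  have -> : u (t + h) - u t - (u t - u (t - h)) =
    (u (t + h) - u t - h *: timeD Omega T u t)
    + (u (t - h) - u t + h *: timeD Omega T u t).
    by rewrite -(opprB (u t) (u (t - h))) addrACA addNr addr0.
  apply: le_trans (snormD sd (sinner_memB sd Sp SQ) (sinner_memD sd Sm SQ)) _.
  have h2 := sqr_ge0 h; have := mulr_ge0 (addr_ge0 B0 L0) h2; move: hp hm; lra.
Qed.

Lemma C2_C11 u : Ck_time Omega T 2 u -> exists2 K : R, 0 <= K & C11 u K.
Proof.
move=> Cu; have [_ Cdu] := Ck_time_timeD Cu.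
have [K K0 HK] := C1_time_lipschitz Cdu.
exact: C1_lipschitz_C11 K0 (Ck_timeW Cu) HK.
Qed.

Lemma C11W u K K' : K <= K' -> C11 u K -> C11 u K'.
Proof.
move=> KK' [c1 c2 c3]; split.
- by move=> t /c1[? h]; split => //; exact: le_trans KK'.
- by move=> s t sI tI; apply: le_trans (c2 s t sI tI) _; rewrite ler_wpM2r.
- by move=> t h a b c; apply: le_trans (c3 t h a b c) _; rewrite ler_wpM2r ?sqr_ge0.
Qed.

Lemma C11N u K : C11 u K -> C11 (fun t => - u t) K.
Proof.
move=> [c1 c2 c3]; split.
- by move=> t /c1[Su h]; split; [exact: (sinner_memN sd)|rewrite (snormN sd)].
- move=> s t sI tI; rewrite -opprD (snormN sd); first exact: c2.
  by apply: (sinner_memB sd); [case: (c1 s sI)|case: (c1 t tI)].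
- move=> t h mI tI pI; rewrite -!opprD (snormN sd); first exact: c3.
  have [Sp _] := c1 _ pI; have [St _] := c1 _ tI; have [Sm _] := c1 _ mI.
  by do 2?apply: (sinner_memB sd).
Qed.

Lemma C11D u v K K' : C11 u K -> C11 v K' -> C11 (fun t => u t + v t) (K + K').
Proof.
move=> [c1 c2 c3] [e1 e2 e3].
have DB (a b a' b' : V) : a + b - (a' + b') = (a - a') + (b - b').
  by rewrite opprD addrACA.
split.
- move=> t tI; have [Su hu] := c1 t tI; have [Sv hv] := e1 t tI.
  by split; [exact: (sinner_memD sd)|apply: le_trans (snormD sd Su Sv) (lerD hu hv)].
- move=> s t sI tI; have [Su _] := c1 t tI; have [Sv _] := e1 t tI.
  have [Su' _] := c1 s sI; have [Sv' _] := e1 s sI.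
  rewrite DB; apply: le_trans (snormD sd (sinner_memB sd Su' Su) (sinner_memB sd Sv' Sv)) _.
  by rewrite mulrDl; apply: lerD; [exact: c2|exact: e2].
- move=> t h mI tI pI; rewrite (DB (u (t + h))) (DB (u t)) DB.
  have [Sp _] := c1 _ pI; have [St _] := c1 _ tI; have [Sm _] := c1 _ mI.
  have [Sp' _] := e1 _ pI; have [St' _] := e1 _ tI; have [Sm' _] := e1 _ mI.
  have Sa := sinner_memB sd (sinner_memB sd Sp St) (sinner_memB sd St Sm).
  have Sa' := sinner_memB sd (sinner_memB sd Sp' St') (sinner_memB sd St' Sm').
  apply: le_trans (snormD sd Sa Sa') _; rewrite mulrDl.
  by apply: lerD; [exact: c3|exact: e3].
Qed.

(** Leibniz rule for differences.  It is applied to [(L u, u) = |grad u|^2], so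
    that the regularity of [L u] gives that of the Dirichlet energy. *)
Lemma C11_dot u v K : 0 <= K -> C11 u K -> C11 v K ->
  [/\ forall t, t \in `[0, T] -> `|d (u t) (v t)| <= K ^+ 2,
      forall s t, s \in `[0, T] -> t \in `[0, T] ->
        `|d (u s) (v s) - d (u t) (v t)| <= 2 * K ^+ 2 * `|s - t|
    & forall t h, t - h \in `[0, T] -> t \in `[0, T] -> t + h \in `[0, T] ->
        `|d (u (t + h)) (v (t + h)) + d (u (t - h)) (v (t - h))
          - 2 * d (u t) (v t)| <= 4 * K ^+ 2 * h ^+ 2].
Proof.
move=> K0 [c1 c2 c3] [e1 e2 e3].
have prod (x y : V) (a b : R) : S x -> S y -> snorm d x <= a -> snorm d y <= b ->
    `|d x y| <= a * b.
  move=> Sx Sy xa yb; apply: le_trans (sinner_le sd Sx Sy) _.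
  by apply: ler_pM; rewrite ?snorm_ge0.
split.
- move=> t tI; have [Su hu] := c1 t tI; have [Sv hv] := e1 t tI.
  by rewrite expr2; apply: prod.
- move=> s t sI tI; have [Su hu] := c1 t tI; have [Sv hv] := e1 t tI.
  have [Su' hu'] := c1 s sI; have [Sv' hv'] := e1 s sI.
  have Sd1 := sinner_memB sd Su' Su; have Sd2 := sinner_memB sd Sv' Sv.
  have -> : d (u s) (v s) - d (u t) (v t) = d (u s - u t) (v s) + d (u t) (v s - v t).
    by rewrite (sinnerBl sd) // (sinnerBr sd) //; ring.
  apply: le_trans (ler_normD _ _) _.
  have := prod _ _ _ _ Sd1 Sv' (c2 s t sI tI) hv'.
  have := prod _ _ _ _ Su Sd2 hu (e2 s t sI tI).
  lra.
- move=> t h mI tI pI.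
  have [Sp _] := c1 _ pI; have [St ht] := c1 _ tI; have [Sm _] := c1 _ mI.
  have [Sp' _] := e1 _ pI; have [St' ht'] := e1 _ tI; have [Sm' _] := e1 _ mI.
  have Sa := sinner_memB sd Sp St; have Sb := sinner_memB sd St Sm.
  have Sa' := sinner_memB sd Sp' St'; have Sb' := sinner_memB sd St' Sm'.
  have Sab := sinner_memB sd Sa Sb; have Sab' := sinner_memB sd Sa' Sb'.
  have -> : d (u (t + h)) (v (t + h)) + d (u (t - h)) (v (t - h))
      - 2 * d (u t) (v t) =
    d (u (t + h) - u t - (u t - u (t - h))) (v t)
    + d (u t) (v (t + h) - v t - (v t - v (t - h)))
    + d (u (t + h) - u t) (v (t + h) - v t)
    + d (u t - u (t - h)) (v t - v (t - h)).
    rewrite (sinnerBl sd Sa Sb St') (sinnerBr sd St Sa' Sb').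
    rewrite (sinnerBl sd Sp St Sa') (sinnerBl sd St Sm Sb').
    rewrite (sinnerBl sd Sp St St') (sinnerBl sd St Sm St').
    rewrite !(sinnerBr sd St) // !(sinnerBr sd Sp) // !(sinnerBr sd Sm) //.
    ring.
  have ph : `|t + h - t| = `|h| by rewrite addrC addKr.
  have mh : `|t - (t - h)| = `|h| by rewrite opprB addrC subrK.
  have b1 := prod _ _ _ _ Sab St' (c3 t h mI tI pI) ht'.
  have b2 := prod _ _ _ _ St Sab' ht (e3 t h mI tI pI).
  have := prod _ _ _ _ Sa Sa' (c2 _ _ pI tI) (e2 _ _ pI tI).
  have := prod _ _ _ _ Sb Sb' (c2 _ _ tI mI) (e2 _ _ tI mI).
  rewrite ph mh -[h ^+ 2]real_normK ?num_real // => b3 b4.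
  apply: le_trans (ler_normD _ _) _; apply: le_trans (lerD (ler_normD _ _) (lexx _)) _.
  apply: le_trans (lerD (lerD (ler_normD _ _) (lexx _)) (lexx _)) _.
  move: b1 b2; rewrite -[h ^+ 2]real_normK ?num_real //; lra.
Qed.

End SmoothInTime.

(** * Classical and weak Laplacian *)

Section ClassicalDerivatives.
Context (R : realType) (Omega : set (R * R)).
Hypothesis dom : convex_domain Omega.
Local Notation V := (R * R -> R).
Local Notation S := (inL2 Omega).
Local Notation d := (dotL2 Omega).
Local Notation sd := (L2_semi_inner Omega).
Implicit Types (u v w g h x : V) (e : R * R).

Let oO : open Omega. Proof. by case: dom. Qed.
Let bO : bounded_set Omega. Proof. by case: dom. Qed.

Lemma Ck_bar_L2 k u : Ck_bar Omega k u -> S u.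
Proof. by move=> Cu; apply: continuous_closure_L2 => //; case: k Cu => [|k] []. Qed.

Lemma test_fun_ibp e u gu phi : dirs R e -> test_fun Omega phi ->
  {within closure Omega, continuous u} -> {within closure Omega, continuous gu} ->
  (forall p, Omega p -> derivable u p e /\ 'D_e u p = gu p) ->
  d u ('D_e phi) = - d gu phi.
Proof.
move=> de tphi cu cgu du; apply: (integration_by_parts_plane (e := e)) => //.
- exact: (test_fun_continuous tphi).
- exact: (test_fun_continuous (test_fun_derive de tphi)).
- move=> p _; split => //; have [/(_ 1%N) [_ /(_ e de)[dphi _]] _ _] := tphi.
  exact: dphi.
- move=> p [_ nOp]; have [_ _ supp] := tphi.
  apply: contrapT => /eqP phip; apply: nOp; apply: supp.
  exact: subset_closure.
Qed.

Lemma Ck_bar2_derivatives e u : dirs R e -> Ck_bar Omega 2 u ->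
  exists g h : V,
  [/\ {within closure Omega, continuous g}, {within closure Omega, continuous h},
      forall p, Omega p -> derivable u p e /\ 'D_e u p = g p,
      forall p, Omega p -> derivable g p e /\ 'D_e g p = h p
    & forall p, Omega p -> 'D_e ('D_e u) p = h p].
Proof.
move=> de [cu /(_ e de)[du [g [cg /(_ e de)[dg [h [ch _] hE]]] gE]]].
exists g, h; split => //.
- by move=> p Op; rewrite gE //; split => //; exact: du.
- by move=> p Op; rewrite hE //; split => //; exact: dg.
- move=> p Op; rewrite hE //; apply: near_eq_derive.
  have := open_nbhs_nbhs (conj oO Op); apply: filterS => q Oq.
  by rewrite gE.
Qed.

(** Two integrations by parts move the second derivatives, weak or classical,
    to the test function.  The Dirichlet energy is minus the product of the
    second derivative with [u], and [u], being in the span of the test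
    functions, does not see the difference of the two second derivatives. *)
Lemma classical_weak_derivatives e u : dirs R e -> Ck_bar Omega 2 u ->
  zero_on_boundary Omega u -> in_H10 Omega u ->
  weakly_derivable Omega e (weakD Omega e u) ->
  exists g h : V,
  [/\ S g /\ S h, forall p, Omega p -> 'D_e u p = g p,
      forall p, Omega p -> 'D_e ('D_e u) p = h p,
      test_orth Omega (weakD Omega e (weakD Omega e u) - h)
    & d (weakD Omega e u) (weakD Omega e u) = d g g].
Proof.
move=> de Cu u0 hu w2; have [g [h [cg ch dg dh hE]]] := Ck_bar2_derivatives de Cu.
have cu : {within closure Omega, continuous u} by case: Cu.
have Sg : S g by exact: continuous_closure_L2.
have Sh : S h by exact: continuous_closure_L2.
have wu := H10_weakD de hu; have wwu := weakDP w2.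
have SW := wwu.1; have Su := H10_L2 hu.
have orth : test_orth Omega (weakD Omega e (weakD Omega e u) - h).
  split; first exact: (sinner_memB sd).
  move=> phi tphi; have Sphi := test_fun_L2 oO bO tphi.
  have tD := test_fun_derive de tphi.
  rewrite (sinnerBl sd) //.
  have E1 := wwu.2 _ tphi; have E2 := wu.2 _ tD.
  have E3 := test_fun_ibp de tphi cg ch dh.
  have E4 := test_fun_ibp de tD cu cg dg.
  apply/eqP; rewrite subr_eq0; apply/eqP.
  by apply: oppr_inj; apply: etrans (esym E1) (etrans _ E3); apply: oppr_inj;
    apply: etrans (esym E2) E4.
exists g, h; split => //.
  by move=> p Op; case: (dg p Op).
have E1 := weakD_ibp_H10 oO bO de (H10_weakD_L2 de hu) wwu hu.
have E2 := integration_by_parts_plane de dom cg cu ch cg dh dg u0.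
have [_ /(_ _ orth)] := H10_span oO bO hu.
rewrite (sinnerBr sd) // => E3.
have SWh := (esym E3); rewrite (sinnerC sd u) (sinnerC sd u h) in SWh.
have E4 : d (weakD Omega e (weakD Omega e u)) u = d h u.
  by apply/eqP; rewrite -subr_eq0; apply/eqP; exact: esym SWh.
by apply: oppr_inj; apply: etrans (esym E1) (etrans E4 _);
  exact: etrans (esym (opprK _)) (congr1 -%R (esym E2)).
Qed.

(** The equation at time [0] involves weak derivatives and [w_0] classical ones:
    their Dirichlet energies are equal, and their Laplacians differ by a
    function that is orthogonal to the test functions. *)
Lemma initial_acceleration u f0 w0 x (a b : R) : Ck_bar Omega 2 u ->
  zero_on_boundary Omega u -> in_H10 Omega u ->
  has_pure_second_derivatives Omega u -> S x -> S w0 -> S f0 ->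
  (forall p, Omega p ->
       w0 p = f0 p
         + (a + b * \int[mu2 R]_(z in Omega)
              (('D_(e1 R) u z) ^+ 2 + ('D_(e2 R) u z) ^+ 2)) * laplace u p) ->
  eqL2 Omega (fun p => x p - (a + b * dirichlet Omega u u) * weak_laplace Omega u p) f0 ->
  test_orth Omega (x - w0).
Proof.
move=> Cu u0 hu u2 Sx Sw Sf w0E xE.
have [g1 [h1 [[Sg1 Sh1] g1E h1E o1 n1]]] :=
  classical_weak_derivatives (@dirs1 R) Cu u0 hu (u2 _ (@dirs1 R)).2.
have [g2 [h2 [[Sg2 Sh2] g2E h2E o2 n2]]] :=
  classical_weak_derivatives (@dirs2 R) Cu u0 hu (u2 _ (@dirs2 R)).2.
set W1 := weakD _ _ (weakD _ _ _) in o1.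
set W2 := weakD _ _ (weakD _ _ _) in o2.
have SW1 : S W1 := (weakDP (u2 _ (@dirs1 R)).2).1.
have SW2 : S W2 := (weakDP (u2 _ (@dirs2 R)).2).1.
have energyE : \int[mu2 R]_(z in Omega)
    (('D_(e1 R) u z) ^+ 2 + ('D_(e2 R) u z) ^+ 2) = dirichlet Omega u u.
  transitivity (d g1 g1 + d g2 g2); last first.
    by congr (_ + _); [exact: esym n1|exact: esym n2].
  rewrite !dotL2E Rintegral_mkcond -RintegralD //; try exact: dotL2_integrable.
  apply: eq_Rintegral => p _; rewrite /patch; case: ifPn => [|_].
    by rewrite inE => Op; rewrite g1E // g2E // !expr2.
  by rewrite !mulr0 addr0.
rewrite energyE in w0E; set q := a + b * _ in w0E xE.
have So : S ((W1 - h1) + (W2 - h2)).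
  by apply: (sinner_memD sd); apply: (sinner_memB sd).
split; first exact: (sinner_memB sd).
move=> phi tphi; have Sphi := test_fun_L2 oO bO tphi.
have -> : d (x - w0) phi = d (q *: ((W1 - h1) + (W2 - h2))) phi.
  apply: dotL2_ae => //; first exact: (sinner_memB sd).
    exact: (sinner_memZ sd).
  move: xE; apply: (@filterS _ _ (ae_filter_ringOfSetsType (mu2 R))) => p xp Op.
  have {}xp := xp Op; have wp := w0E p Op.
  have lapE : laplace u p = h1 p + h2 p by rewrite /laplace h1E // h2E.
  have -> : (x - w0) p = x p - w0 p by [].
  have -> : (q *: ((W1 - h1) + (W2 - h2))) p = q * ((W1 p - h1 p) + (W2 p - h2 p)) by [].
  rewrite wp -xp lapE.
  have -> : weak_laplace Omega u p = W1 p + W2 p by [].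
  move: (W1 p) (W2 p) (h1 p) (h2 p) => ? ? ? ?; ring.
have [Sd1 p1] := o1; have [Sd2 p2] := o2.
by rewrite (sinnerZl sd) // (sinnerDl sd) // (p1 _ tphi) (p2 _ tphi) addr0 mulr0.
Qed.

End ClassicalDerivatives.

(** * Consistency: starting values and truncation error *)

Section Start.
Context (R : realType) (Omega : set (R * R)).
Hypotheses (oO : open Omega) (bO : bounded_set Omega).
Local Notation V := (R * R -> R).
Local Notation S := (inL2 Omega).
Local Notation d := (dotL2 Omega).
Local Notation sd := (L2_semi_inner Omega).
Implicit Types (u v w x y g : V) (e : R * R).

Lemma eqL2_snorm0 x y : S x -> S y -> eqL2 Omega x y -> snorm d (x - y) = 0.
Proof.
move=> Sx Sy xy; have Sxy := sinner_memB sd Sx Sy.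
have E := dotL2_ae Sx Sy Sxy xy.
rewrite /snorm (sinnerBl sd Sx Sy Sxy).
have -> : d x (x - y) - d y (x - y) = 0 by apply/eqP; rewrite subr_eq0; apply/eqP.
by rewrite sqrtr0.
Qed.

Lemma test_span_ae x y : S y -> eqL2 Omega x y -> test_span Omega x ->
  test_span Omega y.
Proof.
move=> Sy xy [Sx ox]; split => // z oz; have [Sz _] := oz.
by apply: etrans (ox z oz); apply/esym/dotL2_ae.
Qed.

Let comb3 (a b c : R) x y z : V := a *: x + (b *: y + c *: z).

Let comb3_L2 (a b c : R) x y z : S x -> S y -> S z -> S (comb3 a b c x y z).
Proof.
move=> Sx Sy Sz; apply: (sinnerP sd) => //; apply: (sinnerP sd) => //.
exact: (sinner_memZ sd).
Qed.

Lemma is_weakD_comb3 e (a b c : R) x y z gx gy gz : dirs R e ->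
  S x -> S y -> S z ->
  is_weakD Omega e x gx -> is_weakD Omega e y gy -> is_weakD Omega e z gz ->
  is_weakD Omega e (comb3 a b c x y z) (comb3 a b c gx gy gz).
Proof.
move=> de Sx Sy Sz wx wy wz.
have wz' : is_weakD Omega e (c *: z) (c *: gz).
  have [Sgz hz] := wz; split; first exact: (sinner_memZ sd).
  move=> phi tphi; have Sp := test_fun_L2 oO bO tphi.
  have Sdp := test_fun_L2 oO bO (test_fun_derive de tphi).
  have E := hz phi tphi.
  by rewrite (sinnerZl sd c Sz Sdp) (sinnerZl sd c Sgz Sp) E mulrN.
apply: (is_weakD_linear oO bO) => //.
  by apply: (sinner_memD sd); apply: (sinner_memZ sd).
by apply: (is_weakD_linear oO bO) => //; exact: (sinner_memZ sd).
Qed.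

Lemma test_span_comb3 (a b c : R) x y z :
  test_span Omega x -> test_span Omega y -> test_span Omega z ->
  test_span Omega (comb3 a b c x y z).
Proof.
move=> tx ty tz; apply: test_span_linear => //; apply: test_span_linear => //.
exact: test_spanZ.
Qed.

Let start_comb (tau : R) u v w X : tau != 0 ->
  eqL2 Omega X (fun p => u p + tau * v p + tau ^+ 2 / 2 * w p) ->
  eqL2 Omega (comb3 (2 / tau ^+ 2) (- (2 / tau ^+ 2)) (- (2 / tau)) X u v) w.
Proof.
move=> tau0; apply: (@filterS _ _ (ae_filter_ringOfSetsType (mu2 R))) => p Xp Op.
have -> : comb3 (2 / tau ^+ 2) (- (2 / tau ^+ 2)) (- (2 / tau)) X u v p =
   2 / tau ^+ 2 * X p + (- (2 / tau ^+ 2) * u p + - (2 / tau) * v p) by [].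
rewrite Xp //; move: (u p) (v p) (w p) => a b c; field.
exact: tau0.
Qed.

(** The initial acceleration [w] is a linear combination of the starting value
    and of the data, so it inherits from [H^1_0] its weak derivatives and their
    place in the span of the test functions. *)
Lemma start_acceleration (tau : R) u v w X : tau != 0 ->
  in_H10 Omega u -> in_H10 Omega v -> S w -> in_H10 Omega X ->
  eqL2 Omega X (fun p => u p + tau * v p + tau ^+ 2 / 2 * w p) ->
  test_span Omega w /\
  forall e, dirs R e -> exists2 g, is_weakD Omega e w g & test_span Omega g.
Proof.
move=> tau0 hu hv Sw hX XE; have cE := start_comb tau0 XE.
split.
  by apply: test_span_ae cE _ => //; apply: test_span_comb3; exact: H10_span.
move=> e de; eexists; last first.
  by apply: (test_span_comb3 (2 / tau ^+ 2) (- (2 / tau ^+ 2)) (- (2 / tau)));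
    [exact: (H10_weakD_span oO bO de hX)|exact: (H10_weakD_span oO bO de hu)|
     exact: (H10_weakD_span oO bO de hv)].
apply: is_weakD_ae cE _ => //.
  by apply: comb3_L2; exact: H10_L2.
by apply: is_weakD_comb3 => //; try exact: H10_L2; exact: H10_weakD.
Qed.

(** The starting value is a combination of [u], [v] and [w] almost everywhere
    only, and weak derivatives are unique only inside the span of the test
    functions. *)
Lemma start_gradient (tau : R) u v w X e g : dirs R e ->
  in_H10 Omega u -> in_H10 Omega v -> S w -> in_H10 Omega X ->
  eqL2 Omega X (fun p => u p + tau * v p + tau ^+ 2 / 2 * w p) ->
  is_weakD Omega e w g -> test_span Omega g ->
  snorm d (weakD Omega e X
    - (1 *: weakD Omega e u + (tau *: weakD Omega e v + (tau ^+ 2 / 2) *: g))) = 0.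
Proof.
move=> de hu hv Sw hX XE wg sg.
apply: (is_weakD_unique oO bO (u := X) (e := e)).
- exact: H10_weakD.
- have c : is_weakD Omega e (comb3 1 tau (tau ^+ 2 / 2) u v w)
      (comb3 1 tau (tau ^+ 2 / 2) (weakD Omega e u) (weakD Omega e v) g).
    by apply: is_weakD_comb3 => //; try exact: H10_L2; exact: H10_weakD.
  apply: is_weakD_ae c => //; [|exact: H10_L2|].
    by apply: comb3_L2 => //; exact: H10_L2.
  apply: eqL2_sym; move: XE; apply: (@filterS _ _ (ae_filter_ringOfSetsType (mu2 R))) => p Xp Op.
  rewrite Xp // /comb3 !fctE scale1r.
  by rewrite addrA.
- exact: H10_weakD_span.
- by apply: test_span_comb3 => //; exact: H10_weakD_span.
Qed.

End Start.

Lemma sum4 (R : realType) (V : lmodType R) (c : nat -> R) (x : nat -> V) :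
  \sum_(i < 4) c i *: x i
    = c 0%N *: x 0%N + (c 1%N *: x 1%N + (c 2%N *: x 2%N + c 3%N *: x 3%N)).
Proof. by rewrite !big_ord_recl big_ord0 addr0. Qed.

Lemma sum3 (R : realType) (V : lmodType R) (c : nat -> R) (x : nat -> V) :
  \sum_(i < 3) c i *: x i = c 0%N *: x 0%N + (c 1%N *: x 1%N + c 2%N *: x 2%N).
Proof. by rewrite !big_ord_recl big_ord0 addr0. Qed.

Lemma upper_bound_seq (R : realDomainType) (s : seq R) :
  exists2 M : R, 0 <= M & all (fun x => x <= M) s.
Proof.
elim: s => [|x s [M M0 HM]]; first by exists 0.
exists (M + `|x|); first by rewrite addr_ge0.
rewrite /= ler_wpDl //=; last exact: ler_norm.
by apply: sub_all HM => y yM; rewrite ler_wpDr.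
Qed.

Lemma start_bound (R : realFieldType) (B g t : R) : 0 <= B -> 0 <= g ->
  2 * B * t ^+ 2 + t * 0 + t ^+ 2 / 2 * (B + g) <= (3 * B + g) * t ^+ 2.
Proof.
by move=> B0 g0; have := mulr_ge0 (sqr_ge0 t) (addr_ge0 B0 g0); lra.
Qed.

Section ExactSolution.
Context (R : realType) (Omega : set (R * R)) (T : R)
  (alpha beta : R -> R) (f : R -> R * R -> R) (u0 v0 w0 : R * R -> R)
  (u : R -> R * R -> R).
Local Notation V := (R * R -> R).
Local Notation S := (inL2 Omega).
Local Notation d := (dotL2 Omega).
Local Notation sd := (L2_semi_inner Omega).

Hypotheses (T_gt0 : 0 < T)
  (alpha_C1 : C1_segment T alpha) (beta_C1 : C1_segment T beta)
  (alpha_gt0 : forall t, t \in `[0, T] -> 0 < alpha t)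
  (beta_gt0 : forall t, t \in `[0, T] -> 0 < beta t)
  (f_cont : Ck_time Omega T 0 f)
  (u_sol : is_solution Omega T alpha beta f u0 v0 u)
  (u_C3 : Ck_time Omega T 3 u)
  (u_ttt_lip : lipschitz_in_time T (normL2 Omega) (timeD Omega T
       (timeD Omega T (timeD Omega T u))))
  (u_xx_yy_C1 : forall e, dirs R e ->
       Ck_time Omega T 1 (fun t => weakD Omega e (weakD Omega e (u t))))
  (u_xxt_yyt_lip : forall e, dirs R e ->
       lipschitz_in_time T (normL2 Omega)
         (timeD Omega T (fun t => weakD Omega e (weakD Omega e (u t))))).

Definition Lu (t : R) : V := - weak_laplace Omega (u t).

Local Notation u1 := (timeD Omega T u).
Local Notation u2 := (timeD Omega T (timeD Omega T u)).
Local Notation u3 := (timeD Omega T (timeD Omega T (timeD Omega T u))).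

Lemma lipschitz_snorm w : L2_valued Omega T w ->
  lipschitz_in_time T (normL2 Omega) w ->
  exists2 K : R, 0 <= K & forall s t, s \in `[0, T] -> t \in `[0, T] ->
    snorm d (w s - w t) <= K * `|s - t|.
Proof.
move=> Sw [K HK]; exists `|K| => // s t sI tI.
rewrite -normL2E; last by apply: (sinner_memB sd); exact: Sw.
by apply: le_trans (HK s t sI tI) _; rewrite ler_wpM2r // ler_norm.
Qed.

Lemma Lu_C11 : exists2 K : R, 0 <= K & C11 Omega T Lu K.
Proof.
have one e : dirs R e -> exists2 K : R, 0 <= K &
    C11 Omega T (fun t => weakD Omega e (weakD Omega e (u t))) K.
  move=> de; have C1 := u_xx_yy_C1 de.
  have [_ /Ck_time_C0[Sdu _]] := Ck_time_timeD C1.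
  have [K K0 HK] := lipschitz_snorm Sdu (u_xxt_yyt_lip de).
  exact: (C1_lipschitz_C11 K0 C1 HK).
have [K1 K10 c1] := one _ (@dirs1 R); have [K2 K20 c2] := one _ (@dirs2 R).
exists (K1 + K2); first exact: addr_ge0.
exact: (C11N (C11D c1 c2)).
Qed.

Let u_H10 t : t \in `[0, T] -> in_H10 Omega (u t).
Proof. by case: u_sol => _ h _ _ _ /h[]. Qed.

Let Su t : t \in `[0, T] -> S (u t).
Proof. by move=> /u_H10; exact: H10_L2. Qed.

Let Su123 t : t \in `[0, T] -> [/\ S (u1 t), S (u2 t) & S (u3 t)].
Proof.
move=> tI; have [_ C2] := Ck_time_timeD u_C3; have [_ C1] := Ck_time_timeD C2.
have [_ C0] := Ck_time_timeD C1.
have [S1 _] := Ck_time_C0 C2; have [S2 _] := Ck_time_C0 C1; have [S3 _] := Ck_time_C0 C0.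
by split; [exact: S1|exact: S2|exact: S3].
Qed.

Let taylor4 : exists2 K : R, 0 <= K &
  (forall t, t \in `[0, T] -> snorm d (u3 t) <= K) /\
  forall s t, s \in `[0, T] -> t \in `[0, T] ->
    snorm d (u s - (u t + ((s - t) *: u1 t + (((s - t) ^+ 2 / 2) *: u2 t
      + ((s - t) ^+ 3 / 6) *: u3 t)))) <= K * `|s - t| ^+ 4.
Proof.
have [_ C2] := Ck_time_timeD u_C3; have [_ C1] := Ck_time_timeD C2.
have [_ /Ck_time_C0[S3 c3]] := Ck_time_timeD C1.
have [B B0 HB] := L2_continuous_bounded S3 c3.
have [K K0 HK] := lipschitz_snorm S3 u_ttt_lip.
have KB : K <= B + K by rewrite lerDr.
have BK : B <= B + K by rewrite lerDl.
exists (B + K); first exact: addr_ge0.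
split => [t tI|s t sI tI]; first exact: le_trans (HB t tI) BK.
have b3 x : x \in `[0, T] -> snorm d (iter 3 (timeD Omega T) u x
   - iter 3 (timeD Omega T) u t) <= K * `|x - t| ^+ 1.
  by move=> xI; rewrite expr1; exact: HK.
have := taylor_Ck tI u_C3 K0 b3 sI.
rewrite (sum4 (fun i => (s - t) ^+ i / i`!%:R)
  (fun i => iter i (timeD Omega T) u t)) /=.
rewrite expr0 fact0 divr1 scale1r expr1 (_ : 1`! = 1%N) // divr1.
rewrite (_ : 2`! = 2%N) // (_ : 3`! = 6%N) //.
by move=> h; apply: le_trans h _; rewrite ler_wpM2r ?exprn_ge0.
Qed.

Let triangle3 (x y z : V) (a b c : R) : S x -> S y -> S z ->
  snorm d x <= a -> snorm d y <= b -> snorm d z <= c ->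
  snorm d (x + y + z) <= a + b + c.
Proof.
move=> Sx Sy Sz xa yb zc.
apply: le_trans (snormD sd (sinner_memD sd Sx Sy) Sz) _; apply: lerD zc.
by apply: le_trans (snormD sd Sx Sy) _; apply: lerD.
Qed.

(** Odd terms cancel in the second difference and even ones in the central
    difference, so that a Lipschitz third derivative yields the orders four and
    three. *)
Lemma time_differences : exists2 K : R, 0 <= K &
  [/\ forall t h, 0 <= h -> t - h \in `[0, T] -> t \in `[0, T] -> t + h \in `[0, T] ->
        snorm d (u (t + h) - u t - (u t - u (t - h)) - h ^+ 2 *: u2 t)
          <= K * h ^+ 4,
      forall t h, 0 <= h -> t - h \in `[0, T] -> t \in `[0, T] -> t + h \in `[0, T] ->
        snorm d ((2 * h) *: u1 t - (u (t + h) - u (t - h))) <= K * h ^+ 3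
    & forall h, h \in `[0, T] ->
        snorm d (u h - (u 0 + (h *: u1 0 + (h ^+ 2 / 2) *: u2 0))) <= K * h ^+ 3].
Proof.
have [K K0 [K3 ty]] := taylor4.
have KT : 0 <= K * T by rewrite mulr_ge0 // ltW.
have KTK : 2 * K + 2 * (K * T) >= 0 by rewrite addr_ge0 // mulr_ge0.
exists (2 * K + 2 * (K * T)) => //.
pose P (t h : R) := u t + (h *: u1 t + ((h ^+ 2 / 2) *: u2 t + (h ^+ 3 / 6) *: u3 t)).
have SP t h : t \in `[0, T] -> S (P t h).
  move=> tI; have [S1 S2 S3] := Su123 tI; have St := Su tI.
  apply: (sinner_memD sd) => //; apply: (sinnerP sd) => //.
  by apply: (sinnerP sd) => //; exact: (sinner_memZ sd).
have tP t h : t \in `[0, T] -> t + h \in `[0, T] ->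
    snorm d (u (t + h) - P t h) <= K * `|h| ^+ 4.
  by move=> tI pI; have := ty _ t pI tI; rewrite (_ : t + h - t = h) // addrC addKr.
have le4 h : 0 <= h -> h <= T -> K * h ^+ 4 <= K * T * h ^+ 3.
  move=> h0 hT; rewrite exprS mulrA ler_wpM2r ?exprn_ge0 //.
  by rewrite ler_wpM2l.
have hT t h : t - h \in `[0, T] -> t + h \in `[0, T] -> 0 <= h -> h <= T.
  by rewrite !in_itv /= => /andP[? ?] /andP[? ?] ?; lra.
split.
- move=> t h h0 mI tI pI; have := tP t (- h) tI mI; have := tP t h tI pI.
  rewrite normrN (ger0_norm h0) => hp hm.
  have Sp := sinner_memB sd (Su pI) (SP t h tI).
  have Sm := sinner_memB sd (Su mI) (SP t (- h) tI).
  have -> : u (t + h) - u t - (u t - u (t - h)) - h ^+ 2 *: u2 t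
      = (u (t + h) - P t h) + (u (t - h) - P t (- h)).
    rewrite /P; move: (u (t + h)) (u (t - h)) (u t) (u1 t) (u2 t) (u3 t) => a b c x y z.
    by apply/funext => p; rewrite !fctE -![_ *: _]/(_ * _); field.
  apply: le_trans (snormD sd Sp Sm) _.
  have KTh : 0 <= 2 * (K * T) * h ^+ 4 by rewrite !mulr_ge0 ?exprn_ge0 // ltW.
  rewrite mulrDl; apply: ler_wpDr => //.
  by rewrite (_ : 2 * K * _ = K * h ^+ 4 + K * h ^+ 4); [exact: lerD|ring].
- move=> t h h0 mI tI pI; have := tP t (- h) tI mI; have := tP t h tI pI.
  rewrite normrN (ger0_norm h0) => hp hm.
  have Sp := sinner_memB sd (Su pI) (SP t h tI).
  have Sm := sinner_memB sd (Su mI) (SP t (- h) tI).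
  have [S1 S2 S3] := Su123 tI.
  have -> : (2 * h) *: u1 t - (u (t + h) - u (t - h))
      = - (u (t + h) - P t h) + (u (t - h) - P t (- h)) + (- (h ^+ 3 / 3)) *: u3 t.
    rewrite /P; move: (u (t + h)) (u (t - h)) (u t) (u1 t) (u2 t) (u3 t) => a b c x y z.
    by apply/funext => p; rewrite !fctE -![_ *: _]/(_ * _); field.
  have l4 := le4 h h0 (hT t h mI pI h0).
  have h30 : 0 <= h ^+ 3 by rewrite exprn_ge0.
  have Kh3 : 0 <= K * h ^+ 3 by rewrite mulr_ge0.
  apply: (@le_trans _ _ (K * h ^+ 4 + K * h ^+ 4 + h ^+ 3 * K)).
    apply: triangle3 => //; first exact: (sinner_memN sd).
    + exact: (sinner_memZ sd).
    + by rewrite (snormN sd).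
    + rewrite (snormZ sd) // normrN ger0_norm ?divr_ge0 //.
      apply: ler_pM; rewrite ?divr_ge0 ?snorm_ge0 ?K3 //.
      by rewrite ler_pdivrMr // ler_peMr // ler1n.
  move: l4 Kh3; lra.
- move=> h hI; have oI : 0 \in `[0, T] by rewrite in_itv /= lexx ltW.
  have h0 : 0 <= h by move: hI; rewrite in_itv /= => /andP[].
  have hleT : h <= T by move: hI; rewrite in_itv /= => /andP[].
  have := tP 0 h oI; rewrite add0r => /(_ hI); rewrite (ger0_norm h0) => hp.
  have Sp := sinner_memB sd (Su hI) (SP 0 h oI).
  have [S1 S2 S3] := Su123 oI.
  have -> : u h - (u 0 + (h *: u1 0 + (h ^+ 2 / 2) *: u2 0))
      = (u h - P 0 h) + (h ^+ 3 / 6) *: u3 0.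
    rewrite /P; move: (u h) (u 0) (u1 0) (u2 0) (u3 0) => a c x y z.
    by apply/funext => p; rewrite !fctE -![_ *: _]/(_ * _); field.
  have l4 := le4 h h0 hleT.
  have h30 : 0 <= h ^+ 3 by rewrite exprn_ge0.
  have Kh3 : 0 <= K * h ^+ 3 by rewrite mulr_ge0.
  have KTh3 : 0 <= K * T * h ^+ 3 by rewrite mulr_ge0.
  apply: (@le_trans _ _ (K * h ^+ 4 + h ^+ 3 * K)).
    apply: le_trans (snormD sd Sp (sinner_memZ sd _ S3)) _; apply: lerD => //.
    rewrite (snormZ sd) // ger0_norm ?divr_ge0 //.
    apply: ler_pM; rewrite ?divr_ge0 ?snorm_ge0 ?K3 //.
    by rewrite ler_pdivrMr // ler_peMr // ler1n.
  move: l4 Kh3 KTh3; lra.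
Qed.

Definition Kirchhoff_coeff (t : R) : R :=
  alpha t + beta t * dirichlet Omega (u t) (u t).

Let Su2_eq t : t \in `[0, T] ->
  snorm d (u2 t + Kirchhoff_coeff t *: Lu t - f t) = 0.
Proof.
move=> tI; have [_ S2 _] := Su123 tI.
have [K _ [cL _ _]] := Lu_C11; have [SL _] := cL t tI.
have [Sf _] := Ck_time_C0 f_cont.
apply: eqL2_snorm0; [|exact: Sf|].
  by apply: (sinner_memD sd) => //; exact: (sinner_memZ sd).
case: u_sol => _ _ /(_ t tI) E _ _.
move: E; apply: (@filterS _ _ (ae_filter_ringOfSetsType (mu2 R))) => p E Op.
rewrite -E //.
have -> : (u2 t + Kirchhoff_coeff t *: Lu t) p =
  u2 t p + Kirchhoff_coeff t * (- weak_laplace Omega (u t) p) by [].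
by rewrite mulrN.
Qed.

Let green_u t v : t \in `[0, T] -> open Omega -> bounded_set Omega ->
  in_H10 Omega v -> dirichlet Omega (u t) v = d (Lu t) v.
Proof.
move=> tI oO bO hv; have [_ /(_ t tI)[hu h] _ _ _] := u_sol.
exact: (dirichlet_weak_laplace oO bO hu h hv).
Qed.

(** The truncation error splits into four parts: the second difference of [u]
    against [u_tt], the average of [L u] at the two outer times against its
    value at the middle, the same for the Dirichlet energy in the coefficient,
    and the differential equation at the middle time, which cancels. *)
Lemma residual_bound : open Omega -> bounded_set Omega ->
  exists2 C : R, 0 <= C &
  forall t h, 0 < h -> t - h \in `[0, T] -> t \in `[0, T] -> t + h \in `[0, T] ->
    snorm d (h ^- 2 *: (u (t + h) - u t - (u t - u (t - h)))
      + ((alpha t + beta t / 2 * (dirichlet Omega (u (t + h)) (u (t + h))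
          + dirichlet Omega (u (t - h)) (u (t - h)))) / 2)
        *: (Lu (t + h) + Lu (t - h)) - f t) <= C * h ^+ 2.
Proof.
move=> oO bO.
have [KL KL0 cL] := Lu_C11; have [Ku Ku0 cu] := C2_C11 (Ck_timeW u_C3).
have [K K0 [K2 _ _]] := time_differences.
have [ca [MA [_ HA]]] := C1_segment_bounds T_gt0 alpha_C1 alpha_gt0.
have [cb [MB [_ HB]]] := C1_segment_bounds T_gt0 beta_C1 beta_gt0.
pose M := Ku + KL; have M0 : 0 <= M by exact: addr_ge0.
have cL' : C11 Omega T Lu M by apply: C11W cL; rewrite /M lerDr.
have cu' : C11 Omega T u M by apply: C11W cu; rewrite /M lerDl.
have [n1 _ n3] := C11_dot M0 cL' cu'.
have nE t : t \in `[0, T] -> dirichlet Omega (u t) (u t) = d (Lu t) (u t).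
  by move=> tI; apply: green_u => //; exact: u_H10.
have [cL1 cL2 cL3] := cL'.
have oI : 0 \in `[0, T] by rewrite in_itv /= lexx ltW.
have A0 : 0 <= MA by apply: le_trans (ltW (alpha_gt0 oI)) _; case/andP: (HA 0 oI).
have B0 : 0 <= MB by apply: le_trans (ltW (beta_gt0 oI)) _; case/andP: (HB 0 oI).
have Mn0 : 0 <= M ^+ 2 by exact: sqr_ge0.
have Q0 : 0 <= (MA + MB * M ^+ 2) * M by rewrite mulr_ge0 ?addr_ge0 ?mulr_ge0.
have Q1 : 0 <= MB * (4 * M ^+ 2) * M by rewrite !mulr_ge0.
exists (K + (MA + MB * M ^+ 2) * M + MB * (4 * M ^+ 2) * M).
  by apply: addr_ge0 => //; apply: addr_ge0.
move=> t h h_gt0 mI tI pI; have h0 : 0 <= h := ltW h_gt0.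
have hn0 : h != 0 by rewrite gt_eqF.
set np := dirichlet Omega (u (t + h)) (u (t + h)).
set nm := dirichlet Omega (u (t - h)) (u (t - h)).
set n := dirichlet Omega (u t) (u t).
have n3' : `|np + nm - 2 * n| <= 4 * M ^+ 2 * h ^+ 2.
  by rewrite /np /nm /n !nE //; exact: n3.
have npb : `|np| <= M ^+ 2 by rewrite /np nE //; exact: n1.
have nmb : `|nm| <= M ^+ 2 by rewrite /nm nE //; exact: n1.
set Q := alpha t + beta t / 2 * (np + nm).
have [SLp _] := cL1 _ pI; have [SL Lb] := cL1 _ tI; have [SLm _] := cL1 _ mI.
have [_ S2 _] := Su123 tI.
have [Sf _] := Ck_time_C0 f_cont; have Sft := Sf t tI.
have Sp := Su pI; have St := Su tI; have Sm := Su mI.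
have Sdd := sinner_memB sd (sinner_memB sd Sp St) (sinner_memB sd St Sm).
have SX1 : S (u (t + h) - u t - (u t - u (t - h)) - h ^+ 2 *: u2 t).
  by apply: (sinner_memB sd) Sdd _; exact: (sinner_memZ sd).
have SX2 : S (Lu (t + h) - Lu t - (Lu t - Lu (t - h))).
  exact: (sinner_memB sd (sinner_memB sd SLp SL) (sinner_memB sd SL SLm)).
have SE : S (u2 t + Kirchhoff_coeff t *: Lu t - f t).
  by apply: (sinner_memB sd) => //; apply: (sinner_memD sd) => //; exact: (sinner_memZ sd).
have -> : h ^- 2 *: (u (t + h) - u t - (u t - u (t - h)))
      + (Q / 2) *: (Lu (t + h) + Lu (t - h)) - f t
    = h ^- 2 *: (u (t + h) - u t - (u t - u (t - h)) - h ^+ 2 *: u2 t)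
      + (Q / 2) *: (Lu (t + h) - Lu t - (Lu t - Lu (t - h)))
      + ((beta t / 2 * (np + nm - 2 * n)) *: Lu t
      + (u2 t + Kirchhoff_coeff t *: Lu t - f t)).
  have -> : Kirchhoff_coeff t = alpha t + beta t * n by [].
  rewrite /Q; clearbody np nm n.
  move: (u (t + h)) (u (t - h)) (u t) (u2 t) (Lu (t + h)) (Lu (t - h)) (Lu t) (f t)
    (alpha t) (beta t) => a b c x y z w k ? ?.
  by apply/funext => p; rewrite !fctE -![_ *: _]/(_ * _); field.
have /andP[al1 al2] := HA t tI; have /andP[be1 be2] := HB t tI.
have al0 := ltW (alpha_gt0 tI); have be0 := ltW (beta_gt0 tI).
rewrite [X in _ <= X](_ : _ = K * h ^+ 2 + (MA + MB * M ^+ 2) * M * h ^+ 2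
  + MB * (4 * M ^+ 2) * M * h ^+ 2); last by ring.
apply: triangle3.
- exact: (sinner_memZ sd).
- exact: (sinner_memZ sd).
- by apply: (sinner_memD sd) SE; exact: (sinner_memZ sd).
- rewrite (snormZ sd) // ger0_norm ?invr_ge0 ?exprn_ge0 //.
  have := K2 t h h0 mI tI pI => kk.
  rewrite mulrC ler_pdivrMr ?exprn_gt0 // -mulrA -exprD; exact: kk.
- rewrite (snormZ sd) //.
  have Qb : `|Q / 2| <= MA + MB * M ^+ 2.
    rewrite normrM (ger0_norm (_ : 0 <= 2^-1)) ?invr_ge0 //.
    have q1 : `|Q| <= MA + MB / 2 * (M ^+ 2 + M ^+ 2).
      apply: le_trans (ler_normD _ _) _; apply: lerD; first by rewrite ger0_norm.
      rewrite normrM; apply: ler_pM => //; first by rewrite ger0_norm ?divr_ge0 // ler_wpM2r // invr_ge0.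
      exact: le_trans (ler_normD _ _) (lerD npb nmb).
    have : MA + MB / 2 * (M ^+ 2 + M ^+ 2) = MA + MB * M ^+ 2 by field.
    move=> e; rewrite e in q1; apply: le_trans (ler_piMr _ _) q1 => //.
    by rewrite invf_le1 // ler1n.
  rewrite -mulrA; apply: ler_pM; rewrite ?snorm_ge0 //.
  exact: cL3.
- apply: le_trans (snormD sd (sinner_memZ sd _ SL) SE) _.
  rewrite Su2_eq // addr0 (snormZ sd) //.
  rewrite (_ : MB * (4 * M ^+ 2) * M * h ^+ 2 = MB * (4 * M ^+ 2 * h ^+ 2) * M); last by ring.
  apply: ler_pM; rewrite ?snorm_ge0 // normrM; apply: ler_pM => //.
  rewrite ger0_norm ?divr_ge0 //; apply: le_trans be2.
  by rewrite ler_pdivrMr // ler_peMr // ler1n.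
Qed.

Hypothesis dom : convex_domain Omega.
Hypotheses
    (w0_def : forall p, Omega p ->
       w0 p = f 0 p
         + (alpha 0 + beta 0 * \int[mu2 R]_(z in Omega)
              (('D_(e1 R) u0 z) ^+ 2 + ('D_(e2 R) u0 z) ^+ 2)) * laplace u0 p)
    (u0_L0 : in_D_L0 Omega u0)
    (w0_C1 : Ck_bar Omega 1 w0)
    (u_xtt_ytt : forall e, dirs R e ->
       Ck_time Omega T 2 (fun t => weakD Omega e (u t)))
    (u0_H10 : in_H10 Omega u0)
    (v0_H10 : in_H10 Omega v0).

Let oO : open Omega. Proof. by case: dom. Qed.
Let bO : bounded_set Omega. Proof. by case: dom. Qed.
Let oI : 0 \in `[0, T]. Proof. by rewrite in_itv /= lexx ltW. Qed.
Let Su0 : S u0. Proof. exact: H10_L2. Qed.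
Let Sv0 : S v0. Proof. exact: H10_L2. Qed.
Let Sw0 : S w0. Proof. exact: (Ck_bar_L2 dom w0_C1). Qed.

Let u_at0 : eqL2 Omega (u 0) u0. Proof. by case: u_sol. Qed.
Let ut_at0 : eqL2 Omega (u1 0) v0. Proof. by case: u_sol. Qed.

Let weakD_at0 e : dirs R e -> weakD Omega e (u 0) = weakD Omega e u0.
Proof. by move=> de; apply: weakD_ae => //; exact: Su. Qed.

(** The difference of [u_tt(0)] and [w_0] is orthogonal to the test functions,
    and both lie in their span. *)
Lemma utt_at0 : test_span Omega w0 -> snorm d (u2 0 - w0) = 0.
Proof.
move=> sw.
have [du C2] := Ck_time_timeD u_C3; have [du1 _] := Ck_time_timeD C2.
have spu s : s \in `[0, T] -> test_span Omega (u s).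
  by move=> sI; exact: (H10_span oO bO (u_H10 sI)).
have spu1 s : s \in `[0, T] -> test_span Omega (u1 s).
  by move=> sI; apply: (timeD_span T_gt0 spu sI); exact: du.
have spu2 : test_span Omega (u2 0).
  by apply: (timeD_span T_gt0 spu1 oI); exact: du1.
have [_ S2 _] := Su123 oI.
have [Cu0 z0] := u0_L0.
apply: (test_span_orth0 (test_spanB spu2 sw)).
have pure : has_pure_second_derivatives Omega u0.
  move=> e de; have [_ /(_ 0 oI)[_ /(_ e de)[h1 h2]] _ _ _] := u_sol.
  split; last by rewrite -(weakD_at0 de).
  by have [_ /(_ e de) h _] := u0_H10.
have [Sf _] := Ck_time_C0 f_cont.
apply: (initial_acceleration dom Cu0 z0 u0_H10 pure S2 Sw0 (Sf 0 oI) w0_def).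
have [_ _ /(_ 0 oI) E _ _] := u_sol.
have H1 := weakD_at0 (@dirs1 R); have H2 := weakD_at0 (@dirs2 R).
have dirE : dirichlet Omega (u 0) (u 0) = dirichlet Omega u0 u0.
  exact: (congr2 (fun x y => d x x + d y y) H1 H2).
have lapE : weak_laplace Omega (u 0) = weak_laplace Omega u0.
  exact: (congr2 (fun x y => weakD Omega (e1 R) x \+ weakD Omega (e2 R) y) H1 H2).
by rewrite -dirE -lapE.
Qed.

Let norm_trans (x y z : V) (b : R) : S x -> S y -> S z ->
  snorm d (x - y) <= b -> snorm d (y - z) = 0 -> snorm d (x - z) <= b.
Proof.
move=> Sx Sy Sz h1 h2; have -> : x - z = (x - y) + (y - z) by rewrite addrA subrK.
apply: le_trans (snormD sd (sinner_memB sd Sx Sy) (sinner_memB sd Sy Sz)) _.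
by rewrite h2 addr0.
Qed.

(** Taylor's formula at [0] for [u], whose coefficients up to order two are the
    data, and for the gradient of [u], where those up to order one are: as only
    second order is claimed for the gradient, its second derivative in time and
    the gradient of [w0] are bounded separately. *)
Lemma start_error : exists2 C : R, 0 <= C &
  forall (tau : R) X, 0 < tau -> tau \in `[0, T] -> in_H10 Omega X ->
    eqL2 Omega X (fun p => u0 p + tau * v0 p + tau ^+ 2 / 2 * w0 p) ->
    snorm d (u tau - X) <= C * tau ^+ 3 /\
    forall e, dirs R e ->
      snorm d (weakD Omega e (u tau) - weakD Omega e X) <= C * tau ^+ 2.
Proof.
(* If [w0] lacks these properties then no starting value lies in [H^1_0], and
   the bound holds vacuously. *)
have [[sw wg]|nsw] := pselect (test_span Omega w0 /\
    forall e, dirs R e -> exists2 g, is_weakD Omega e w0 g & test_span Omega g); last first.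
  exists 0 => // tau X tau0 _ hX XE; exfalso; apply: nsw.
  by apply: (start_acceleration oO bO _ u0_H10 v0_H10 Sw0 hX XE); rewrite gt_eqF.
have [S1 S2 _] := Su123 oI.
have [K K0 [_ _ ty]] := time_differences.
have grad e : dirs R e -> exists2 C : R, 0 <= C &
  forall (tau : R) X, 0 < tau -> tau \in `[0, T] -> in_H10 Omega X ->
    eqL2 Omega X (fun p => u0 p + tau * v0 p + tau ^+ 2 / 2 * w0 p) ->
    snorm d (weakD Omega e (u tau) - weakD Omega e X) <= C * tau ^+ 2.
  move=> de; have [g wgg sg] := wg e de; have Sg : S g by case: sg.
  have Cg := u_xtt_ytt de.
  set G := fun t => weakD Omega e (u t) in Cg.
  have [dG C1G] := Ck_time_timeD Cg; have [_ C0G] := Ck_time_timeD C1G.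
  have [SG _] := Ck_time_C0 Cg; have [SG1 _] := Ck_time_C0 C1G.
  have [SG2 cG2] := Ck_time_C0 C0G.
  have [B B0 HB] := L2_continuous_bounded SG2 cG2.
  have G0 : G 0 = weakD Omega e u0 := weakD_at0 de.
  have SWu := H10_weakD_L2 de u0_H10; have SWv := H10_weakD_L2 de v0_H10.
  have G1 : snorm d (timeD Omega T G 0 - weakD Omega e v0) = 0.
    have wdu s : s \in `[0, T] -> S (u s) /\ weakly_derivable Omega e (u s).
      by move=> sI; split; [exact: Su|case: (u_H10 sI) => _ /(_ e de)].
    have [du _] := Ck_time_timeD u_C3.
    have w1 := timeD_weakD oO bO T_gt0 de wdu oI (du 0 oI) (dG 0 oI).
    apply: (is_weakD_unique oO bO (u := v0) (e := e)).
    - exact: (is_weakD_ae oO bO de S1 Sv0 ut_at0 w1).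
    - exact: (H10_weakD de v0_H10).
    - have spG s : s \in `[0, T] -> test_span Omega (G s).
        by move=> sI; exact: (H10_weakD_span oO bO de (u_H10 sI)).
      exact: (timeD_span T_gt0 spG oI (dG 0 oI)).
    - exact: (H10_weakD_span oO bO de v0_H10).
  have Cg0 : 0 <= 3 * B + snorm d g by rewrite addr_ge0 ?snorm_ge0 ?mulr_ge0.
  exists (3 * B + snorm d g) => // tau X tau0 tI hX XE.
  have SWX := H10_weakD_L2 de hX.
  have st := start_gradient oO bO de u0_H10 v0_H10 Sw0 hX XE wgg sg.
  have b2 x : x \in `[0, T] -> snorm d (iter 2 (timeD Omega T) G x
     - iter 2 (timeD Omega T) G 0) <= 2 * B * `|x - 0| ^+ 0.
    move=> xI; rewrite expr0 mulr1 (_ : 2 * B = B + B); last by ring.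
    apply: le_trans (snormB sd (SG2 x xI) (SG2 0 oI)) _.
    by apply: lerD; apply: HB.
  have := taylor_Ck oI Cg (mulr_ge0 (ler0n R 2) B0) b2 tI.
  rewrite (sum3 (fun i => (tau - 0) ^+ i / i`!%:R)
    (fun i => iter i (timeD Omega T) G 0)) /=.
  rewrite expr0 fact0 divr1 scale1r expr1 (_ : 1`! = 1%N) // divr1.
  rewrite (_ : 2`! = 2%N) // subr0 addn0 gtr0_norm // => tay.
  set G1' := timeD Omega T G 0 in G1 tay.
  set G2' := timeD Omega T (timeD Omega T G) 0 in tay.
  have SG1' : S G1' := SG1 0 oI. have SG2' : S G2' := SG2 0 oI.
  set Y := 1 *: weakD Omega e u0 + (tau *: weakD Omega e v0 + (tau ^+ 2 / 2) *: g).
  have SY : S Y.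
    by apply: (sinnerP sd) => //; apply: (sinnerP sd) => //; exact: (sinner_memZ sd).
  have st' : snorm d (Y - weakD Omega e X) = 0.
    by rewrite -opprB (snormN sd (sinner_memB sd SWX SY)); exact: st.
  apply: (norm_trans (SG tau tI) SY SWX _ st').
  have STay : S (G tau - (G 0 + (tau *: G1' + (tau ^+ 2 / 2) *: G2'))).
    apply: (sinner_memB sd); first exact: (SG tau tI).
    apply: (sinner_memD sd); first exact: (SG 0 oI).
    by apply: (sinnerP sd) => //; exact: (sinner_memZ sd).
  have Sv1 : S (G1' - weakD Omega e v0) by exact: (sinner_memB sd).
  have Sv2 : S (G2' - g) by exact: (sinner_memB sd).
  have alg (q r : R) (x1 x2 x3 y1 y2 y3 : V) :
      x1 - (1 *: x2 + (q *: x3 + r *: y3)) =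
      (x1 - (x2 + (q *: y1 + r *: y2))) + q *: (y1 - x3) + r *: (y2 - y3).
    by apply/funext => p; rewrite !fctE -![_ *: _]/(_ * _); ring.
  rewrite G0 in STay tay.
  have E := alg tau (tau ^+ 2 / 2) (G tau) (weakD Omega e u0) (weakD Omega e v0) G1' G2' g.
  rewrite [X in snorm d X](E : weakD Omega e (u tau) - Y = _).
  have t20 : 0 <= tau ^+ 2 / 2 by rewrite divr_ge0 ?exprn_ge0 // ltW.
  apply: (@le_trans _ _ (2 * B * tau ^+ 2 + tau * 0 + tau ^+ 2 / 2 * (B + snorm d g))).
    apply: triangle3 => //; try exact: (sinner_memZ sd).
      by rewrite (snormZ sd) // G1 mulr0 mulr0.
    rewrite (snormZ sd) // ger0_norm //; apply: ler_wpM2l => //.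
    by apply: le_trans (snormB sd SG2' Sg) _; rewrite lerD2r; exact: HB.
  by apply: start_bound; rewrite ?snorm_ge0.
have [C1 C10 H1] := grad _ (@dirs1 R); have [C2 C20 H2] := grad _ (@dirs2 R).
exists (K + C1 + C2); first by rewrite !addr_ge0.
move=> tau X tau0 tI hX XE; have SX := H10_L2 hX.
have t2 : 0 <= tau ^+ 2 by exact: sqr_ge0.
have t3 : 0 <= tau ^+ 3 by rewrite exprn_ge0 // ltW.
split; last first.
  have l1 : C1 <= K + C1 + C2 by rewrite addrAC lerDr addr_ge0.
  have l2 : C2 <= K + C1 + C2 by rewrite lerDr addr_ge0.
  move=> e [->|->].
    by apply: le_trans (H1 tau X tau0 tI hX XE) _; rewrite ler_wpM2r.
  by apply: le_trans (H2 tau X tau0 tI hX XE) _; rewrite ler_wpM2r.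
have lK : K <= K + C1 + C2 by rewrite -addrA lerDl addr_ge0.
apply: (@le_trans _ _ (K * tau ^+ 3)); last by rewrite ler_wpM2r.
pose Y := u0 + (tau *: v0 + (tau ^+ 2 / 2) *: w0).
have SY : S Y.
  by apply: (sinner_memD sd) => //; apply: (sinnerP sd) => //; exact: (sinner_memZ sd).
have SY' : S (u 0 + (tau *: u1 0 + (tau ^+ 2 / 2) *: u2 0)).
  apply: (sinner_memD sd); first exact: (Su oI).
  by apply: (sinnerP sd) => //; exact: (sinner_memZ sd).
apply: (norm_trans (Su tI) SY' SX (ty tau tI)).
have YX : snorm d (Y - X) = 0.
  apply: eqL2_snorm0 => //; apply: eqL2_sym.
  move: XE; apply: (@filterS _ _ (ae_filter_ringOfSetsType (mu2 R))) => p XE Op.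
  rewrite XE // /Y.
  have -> : (u0 + (tau *: v0 + (tau ^+ 2 / 2) *: w0)) p =
    u0 p + (tau * v0 p + tau ^+ 2 / 2 * w0 p) by [].
  by rewrite addrA.
apply/eqP; rewrite eq_le snorm_ge0 andbT.
apply: (norm_trans SY' SY SX _ YX).
have z0 := eqL2_snorm0 (Su oI) Su0 u_at0.
have z1 := eqL2_snorm0 S1 Sv0 ut_at0.
have z2 := utt_at0 sw.
have Sa := sinner_memB sd (Su oI) Su0; have Sb := sinner_memB sd S1 Sv0.
have Sc := sinner_memB sd S2 Sw0.
have -> : u 0 + (tau *: u1 0 + (tau ^+ 2 / 2) *: u2 0) - Y =
   (u 0 - u0) + tau *: (u1 0 - v0) + (tau ^+ 2 / 2) *: (u2 0 - w0).
  rewrite /Y; move: (u 0) (u1 0) (u2 0) => a b c.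
  by apply/funext => p; rewrite !fctE -![_ *: _]/(_ * _); field.
have N1 : snorm d (u 0 - u0) <= 0 by rewrite z0.
have N2 : snorm d (tau *: (u1 0 - v0)) <= 0 by rewrite (snormZ sd) // z1 mulr0.
have N3 : snorm d ((tau ^+ 2 / 2) *: (u2 0 - w0)) <= 0 by rewrite (snormZ sd) // z2 mulr0.
rewrite [X in _ <= X](_ : _ = 0 + 0 + 0); last by rewrite !addr0.
exact: (triangle3 Sa (sinner_memZ sd _ Sb) (sinner_memZ sd _ Sc) N1 N2 N3).
Qed.

End ExactSolution.

(** * Convergence of the central difference *)

Lemma snorm_pair_le (R : realType) (V : lmodType R) (S : V -> Prop)
    (d : V -> V -> R) (sd : semi_inner S d) (w : V * V) : S w.1 -> S w.2 ->
  snorm (V := (V * V)%type) (fun w w' => d w.1 w'.1 + d w.2 w'.2) w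
    <= snorm d w.1 + snorm d w.2.
Proof.
move=> S1 S2; rewrite /snorm.
have a0 := sinner_ge0 sd S1; have b0 := sinner_ge0 sd S2.
rewrite -(@ler_pXn2r _ 2) ?nnegrE ?addr_ge0 ?sqrtr_ge0 //.
rewrite sqr_sqrtr ?addr_ge0 // sqrrD !sqr_sqrtr //.
have := mulr_ge0 (sqrtr_ge0 (d w.1 w.1)) (sqrtr_ge0 (d w.2 w.2)).
by rewrite mulr2n; lra.
Qed.

Lemma scheme_step_dot (R : realType) (Omega : set (R * R)) (tau q : R)
    (y2 y1 y0 l2 l0 g v : R * R -> R) :
  0 < tau -> inL2 Omega y2 -> inL2 Omega y1 -> inL2 Omega y0 ->
  inL2 Omega l2 -> inL2 Omega l0 -> inL2 Omega g -> inL2 Omega v ->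
  eqL2 Omega (fun p => (y2 p - 2 * y1 p + y0 p) / tau ^+ 2
    + 2^-1 * q * (l2 p + l0 p)) g ->
  dotL2 Omega (y2 - y1 - (y1 - y0)) v + tau ^+ 2 / 2 * q * dotL2 Omega (l2 + l0) v
    = tau ^+ 2 * dotL2 Omega g v.
Proof.
move=> tau0 Sy2 Sy1 Sy0 Sl2 Sl0 Sg Sv E.
have sd := L2_semi_inner Omega.
have S1 := sinner_memB sd (sinner_memB sd Sy2 Sy1) (sinner_memB sd Sy1 Sy0).
have S2 := sinner_memD sd Sl2 Sl0.
have S3 := sinner_memD sd S1 (sinner_memZ sd (tau ^+ 2 / 2 * q) S2).
have S4 := sinner_memZ sd (tau ^+ 2) Sg.
have E' : eqL2 Omega (y2 - y1 - (y1 - y0) + (tau ^+ 2 / 2 * q) *: (l2 + l0))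
    (tau ^+ 2 *: g).
  move: E; apply: (@filterS _ _ (ae_filter_ringOfSetsType (mu2 R))) => p E Op.
  have {}E := E Op.
  have -> : (tau ^+ 2 *: g) p = tau ^+ 2 * g p by [].
  rewrite -E.
  have -> : (y2 - y1 - (y1 - y0) + (tau ^+ 2 / 2 * q) *: (l2 + l0)) p =
    y2 p - y1 p - (y1 p - y0 p) + (tau ^+ 2 / 2 * q) * (l2 p + l0 p) by [].
  by field; rewrite gt_eqF.
have := dotL2_ae S3 S4 Sv E'.
by rewrite (sinnerDl sd S1 (sinner_memZ sd _ S2) Sv) (sinnerZl sd _ S2 Sv)
  (sinnerZl sd _ Sg Sv).
Qed.

Theorem corollary4p7 (R : realType) (Omega : set (R * R)) (T : R)
    (alpha beta : R -> R) (f : R -> R * R -> R) (u0 v0 w0 : R * R -> R)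
    (u : R -> R * R -> R)
    (Omega_dom : convex_domain Omega)
    (T_gt0 : 0 < T)
    (alpha_C1 : C1_segment T alpha)
    (beta_C1 : C1_segment T beta)
    (alpha_gt0 : forall t, t \in `[0, T] -> 0 < alpha t)
    (beta_gt0 : forall t, t \in `[0, T] -> 0 < beta t)
    (f_cont : Ck_time Omega T 0 f)
    (* w_0 = f_0 + q_0 Delta u_0 *)
    (w0_def : forall p, Omega p ->
       w0 p = f 0 p
         + (alpha 0 + beta 0 * \int[mu2 R]_(z in Omega)
              (('D_(e1 R) u0 z) ^+ 2 + ('D_(e2 R) u0 z) ^+ 2)) * laplace u0 p)
    (wp : well_posed Omega T alpha beta f u0 v0)
    (u_sol : is_solution Omega T alpha beta f u0 v0 u)
    (* (i) *)
    (u0_L0 : in_D_L0 Omega u0)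
    (v0_C1 : Ck_bar Omega 1 v0)
    (w0_C1 : Ck_bar Omega 1 w0)
    (u_xtt_ytt : forall e, dirs R e ->
       Ck_time Omega T 2 (fun t => weakD Omega e (u t)))
    (f_C1 : forall t, t \in `[0, T] ->
       Ck_bar Omega 1 (f t) /\ zero_on_boundary Omega (f t))
    (f_bnd : exists M : R, forall t p e,
       t \in `[0, T] -> Omega p -> dirs R e -> `|'D_e (f t) p| <= M)
    (u0_L2 : in_D_L2 Omega u0)
    (v0_L : in_D_L Omega v0)
    (f_Lhalf : C_D_Lhalf Omega T f)
    (f0_L : in_D_L Omega (f 0))
    (* (ii) *)
    (u_C3 : Ck_time Omega T 3 u)
    (u_ttt_lip : lipschitz_in_time T (normL2 Omega) (timeD Omega T
       (timeD Omega T (timeD Omega T u))))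
    (* (iii) *)
    (u_xx_yy_C1 : forall e, dirs R e ->
       Ck_time Omega T 1 (fun t => weakD Omega e (weakD Omega e (u t))))
    (u_xxt_yyt_lip : forall e, dirs R e ->
       lipschitz_in_time T (normL2 Omega)
         (timeD Omega T (fun t => weakD Omega e (weakD Omega e (u t))))) :
  exists Tbar : R, 0 < Tbar <= T /\
  exists C : R, forall (n : nat) (U : nat -> R * R -> R),
    (1 < n)%N -> is_scheme_solution Omega T alpha beta f u0 v0 w0 n U ->
    let tau := T / n%:R in
    let m := Num.truncn (Tbar / tau) in
    forall k, (1 <= k <= m.-1)%N ->
      normL2 Omega (fun p => timeD Omega T u (k%:R * tau) p
                       - (U k.+1 p - U k.-1 p) / (2 * tau))
        <= C * tau ^+ 2.
Proof.
have [_ oO bO _] := Omega_dom.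
have u0_H10 : in_H10 Omega u0 by case: u0_L2 => -[].
have v0_H10 : in_H10 Omega v0 by case: v0_L.
pose S := inL2 Omega; pose d := dotL2 Omega.
have sd : semi_inner S d := L2_semi_inner Omega.
have sa := semi_inner_pair sd.
set S' := (fun w : (R * R -> R) * (R * R -> R) => S w.1 /\ S w.2) in sa.
set a := (fun w w' : (R * R -> R) * (R * R -> R) => d w.1 w'.1 + d w.2 w'.2) in sa.
pose grad (v : R * R -> R) := (weakD Omega (e1 R) v, weakD Omega (e2 R) v).
have Sgrad v : in_H10 Omega v -> S' (grad v).
  by move=> hv; split; [exact: (H10_weakD_L2 (@dirs1 R) hv)|exact: (H10_weakD_L2 (@dirs2 R) hv)].
have uH t : t \in `[0, T] -> in_H10 Omega (u t).
  by case: u_sol => _ h _ _ _ /h[].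
have oI : 0 \in `[0, T] by rewrite in_itv /= lexx ltW.
have [ca [Ma [ca0 HA]]] := C1_segment_bounds T_gt0 alpha_C1 alpha_gt0.
have [cb [Mb [cb0 HB]]] := C1_segment_bounds T_gt0 beta_C1 beta_gt0.
have [Ka Ka0 La] := C1_segment_lipschitz T_gt0 alpha_C1.
have [Kb Kb0 Lb] := C1_segment_lipschitz T_gt0 beta_C1.
have [KL KL0 cL] := Lu_C11 u_xx_yy_C1 u_xxt_yyt_lip.
have [Ku Ku0 cu] := C2_C11 (Ck_timeW u_C3).
have [Sf cf] := Ck_time_C0 f_cont.
have [F F0 HF] := L2_continuous_bounded Sf cf.
have [C1 C10 [_ central _]] := time_differences T_gt0 u_sol u_C3 u_ttt_lip.
have [Cr Cr0 Hres] := residual_bound T_gt0 alpha_C1 beta_C1 alpha_gt0 beta_gt0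
  f_cont u_sol u_C3 u_ttt_lip u_xx_yy_C1 u_xxt_yyt_lip oO bO.
have [Cs Cs0 Hstart] := start_error T_gt0 f_cont u_sol u_C3 u_ttt_lip Omega_dom w0_def
  u0_L0 w0_C1 u_xtt_ytt u0_H10 v0_H10.
pose K := Ku + KL; have K0 : 0 <= K by exact: addr_ge0.
have KuK : Ku <= K by rewrite /K lerDl.
have KLK : KL <= K by rewrite /K lerDr.
have cL' := C11W KLK cL; have cu' := C11W KuK cu.
have [n1 n2 _] := C11_dot K0 cL' cu'.
have [cL1 cL2 _] := cL'; have [cu1 cu2 _] := cu'.
have [M M0] := upper_bound_seq [:: Ma; Mb; Ka; Kb; K; 2 * K ^+ 2; F; Cr; Cs + Cs].
move=> /= /andP[leMa /andP[leMb /andP[leKa /andP[leKb /andP[leK /andP[leK2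
  /andP[leF /andP[leCr /andP[leCs _]]]]]]]]].
have leCs1 : Cs <= M by apply: le_trans leCs; rewrite lerDl.
pose c := Num.min ca cb.
have c0 : 0 < c by rewrite /c lt_min ca0 cb0.
have lt0 := local_time_gt0 c0 M0.
exists (Num.min T (local_time c M)); split.
  by rewrite lt_min T_gt0 lt0 /= ge_min lexx.
exists (C1 + error_const M) => n U n_gt1 [HU HU0].
pose tau := T / n%:R; pose m := Num.truncn (Num.min T (local_time c M) / tau).
rewrite -/tau -/m => HU1 Hsch k /andP[k1 km].
have n0 : 0 < n%:R :> R by rewrite ltr0n; exact: ltn_trans n_gt1.
have tau0 : 0 < tau by exact: divr_gt0.
have tauE : tau * n%:R = T by rewrite /tau divfK // gt_eqF.
have mT : tau * m%:R <= Num.min T (local_time c M).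
  have q0 : 0 <= Num.min T (local_time c M) / tau.
    by rewrite divr_ge0 ?(ltW tau0) // le_min !ltW.
  by rewrite mulrC -ler_pdivlMr // /m truncn_le.
have {}km : (k < m)%N by move: km; case: (m) => [|m'] //=; rewrite leqNgt k1.
have hm : tau * m%:R <= local_time c M by apply: le_trans mT _; rewrite ge_min lexx orbT.
have mT' : tau * m%:R <= T by apply: le_trans mT _; rewrite ge_min lexx.
have mn : (m <= n)%N by rewrite -(ler_nat R) -(ler_pM2l tau0) tauE.
have m0 : (0 < m)%N by exact: leq_ltn_trans km.
have m1 : (1 < m)%N by exact: leq_ltn_trans km.
have tau1 : tau <= 1.
  apply: (@le_trans _ _ (tau * m%:R)); first by rewrite ler_peMr ?(ltW tau0) // ler1n.
  by apply: le_trans hm _; rewrite /local_time ge_min lexx.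
move: m mT hm mT' mn m0 m1 km => m _ hm mT' mn m0 m1 km.
(* Beyond the local interval the sequences are continued by constants, so that
   bounds and Lipschitz estimates hold for all indices. *)
pose j i := minn i m.
have jE i : (i <= m)%N -> j i = i by move=> im; exact: (minn_idPl im).
have jm i : (j i <= m)%N by exact: geq_minr.
pose t i : R := (j i)%:R * tau.
have tE i : (i <= m)%N -> t i = i%:R * tau by move=> im; rewrite /t jE.
have tI i : t i \in `[0, T].
  rewrite in_itv /= /t mulr_ge0 ?(ltW tau0) //= mulrC; apply: le_trans mT'.
  by rewrite ler_pM2l // ler_nat.
have tS i : `|t i.+1 - t i| <= tau.
  rewrite /t; have [im|im] := leqP i.+1 m.
    by rewrite jE // jE ?(ltnW im) // -mulrBl -natr1 addrAC subrr add0r mul1r gtr0_norm.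
  rewrite ltnS in im.
  have -> : j i.+1 = m by apply/minn_idPr; exact: leqW.
  have -> : j i = m by apply/minn_idPr.
  by rewrite subrr normr0 ltW.
have tstep (C : R) i : 0 <= C -> C <= M -> C * `|t i.+1 - t i| <= M * tau.
  by move=> ? ?; apply: ler_pM.
pose x i := u (t i); pose X i := U (j i).
pose L i := Lu Omega u (t i); pose LX i := opL Omega (U (j i)).
have xH i : in_H10 Omega (x i) by exact: uH.
have XD i : in_D_L Omega (X i) by apply: HU; exact: leq_trans (jm i) mn.
have XH i : in_H10 Omega (X i) by case: (XD i).
have isL i : is_L Omega (X i) (LX i).
  by case: (XD i) => _; apply: (@xgetPex _ (cst 0) [set w | is_L Omega (X i) w]).
have Sx i : S (x i) := H10_L2 (xH i).
have SX i : S (X i) := H10_L2 (XH i).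
have SL i : S (L i) by case: (cL1 _ (tI i)).
have SLX i : S (LX i) by case: (isL i).
have Sft i : S (f (t i)) by exact: Sf.
have green_x i v : in_H10 Omega v -> dirichlet Omega (x i) v = d (L i) v.
  move=> hv; have [_ /(_ _ (tI i))[hu hu2] _ _ _] := u_sol.
  exact: (dirichlet_weak_laplace oO bO hu hu2 hv).
have gxx : green d a L (fun i => grad (x i)) x (fun i => grad (x i)).
  by move=> i i'; exact: green_x (xH i').
have gxX : green d a L (fun i => grad (x i)) X (fun i => grad (X i)).
  by move=> i i'; exact: green_x (XH i').
have gXx : green d a LX (fun i => grad (X i)) x (fun i => grad (x i)).
  by move=> i i'; case: (isL i) => _ h; exact: h _ (xH i').
have gXX : green d a LX (fun i => grad (X i)) X (fun i => grad (X i)).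
  by move=> i i'; case: (isL i) => _ h; exact: h _ (XH i').
have Sgx i : S' (grad (x i)) := Sgrad _ (xH i).
have SgX i : S' (grad (X i)) := Sgrad _ (XH i).
have tau2 : 0 < tau ^+ 2 by exact: exprn_gt0.
have scheme i : (i.+1 < m)%N -> forall v, S v ->
  d (X i.+2 - X i.+1 - (X i.+1 - X i)) v
  + tau ^+ 2 / 2 * (alpha (t i.+1) + beta (t i.+1) / 2
      * (a (grad (X i.+2)) (grad (X i.+2)) + a (grad (X i)) (grad (X i))))
    * d (LX i.+2 + LX i) v = tau ^+ 2 * d (f (t i.+1)) v.
  move=> im v Sv.
  have i0 : (i <= m)%N by exact: leq_trans (leqnSn i) (ltnW im).
  have := Hsch i.+1; rewrite /= (leq_trans im mn) => /(_ isT).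
  have nL w : in_H10 Omega w -> norm_Lhalf Omega w ^+ 2 = a (grad w) (grad w).
    by move=> hw; apply: sqr_sqrtr; exact: (sinner_ge0 sa (Sgrad _ hw)).
  have XE2 : X i.+2 = U i.+2 by rewrite /X jE.
  have XE1 : X i.+1 = U i.+1 by rewrite /X jE // ltnW.
  have XE0 : X i = U i by rewrite /X jE.
  rewrite -/tau -(tE i.+1 (ltnW im)) -XE2 -XE1 -XE0.
  rewrite -[opL Omega (X i.+2)]/(LX i.+2) -[opL Omega (X i)]/(LX i).
  move=> E.
  have Eq := f_equal2 (fun r s : R => alpha (t i.+1) + beta (t i.+1) / 2 * (r + s))
    (nL _ (XH i.+2)) (nL _ (XH i)).
  have H := scheme_step_dot tau0 (SX i.+2) (SX i.+1) (SX i) (SLX i.+2) (SLX i)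
    (Sft i.+1) Sv E.
  exact: (eq_ind _ (fun q : R => d (X i.+2 - X i.+1 - (X i.+1 - X i)) v
    + tau ^+ 2 / 2 * q * d (LX i.+2 + LX i) v = tau ^+ 2 * d (f (t i.+1)) v) H _ Eq).
have al_itv i : c <= alpha (t i) <= M.
  have /andP[h1 h2] := HA _ (tI i); rewrite (le_trans _ h1) ?ge_min ?lexx //=.
  exact: le_trans leMa.
have be_itv i : c <= beta (t i) <= M.
  have /andP[h1 h2] := HB _ (tI i); rewrite (le_trans _ h1) ?ge_min ?lexx ?orbT //=.
  exact: le_trans leMb.
have al_lip i : `|alpha (t i.+1) - alpha (t i)| <= M * tau.
  exact: le_trans (La _ _ (tI i.+1) (tI i)) (tstep _ i Ka0 leKa).
have be_lip i : `|beta (t i.+1) - beta (t i)| <= M * tau.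
  exact: le_trans (Lb _ _ (tI i.+1) (tI i)) (tstep _ i Kb0 leKb).
have L_bnd i : snorm d (L i) <= M.
  by case: (cL1 _ (tI i)) => _ h; exact: le_trans h leK.
have L_lip i : snorm d (L i.+1 - L i) <= M * tau.
  exact: le_trans (cL2 _ _ (tI i.+1) (tI i)) (tstep _ i K0 leK).
have x_lip i : snorm d (x i.+1 - x i) <= M * tau.
  exact: le_trans (cu2 _ _ (tI i.+1) (tI i)) (tstep _ i K0 leK).
have f_bnd' i : snorm d (f (t i)) <= M by exact: le_trans (HF _ (tI i)) leF.
have nE i : a (grad (x i)) (grad (x i)) = d (L i) (x i) by exact: gxx.
have gx_bnd i : snorm a (grad (x i)) <= M.
  apply: le_trans leK; rewrite -(ger0_norm K0) -sqrtr_sqr /snorm nE ler_wsqrtr //.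
  exact: le_trans (ler_norm _) (n1 _ (tI i)).
have gx_lip i : `|a (grad (x i.+1)) (grad (x i.+1)) - a (grad (x i)) (grad (x i))|
    <= M * tau.
  have K20 : 0 <= 2 * K ^+ 2 by rewrite mulr_ge0 ?exprn_ge0.
  rewrite !nE.
  exact: le_trans (n2 _ _ (tI i.+1) (tI i)) (tstep _ i K20 leK2).
have tP i : (0 < i)%N -> (i < m)%N -> t i.+1 = t i + tau /\ t i.-1 = t i - tau.
  case: i => // i _ im; rewrite /= !tE ?(ltnW im) //; last exact: leq_trans (leqnSn i) (ltnW im).
  by rewrite -!natr1 !mulrDl !mul1r addrK.
have res_bnd i : (0 < i < m)%N ->
    snorm d (residual a x L (fun i => f (t i)) (fun i => grad (x i))
      (fun i => alpha (t i)) (fun i => beta (t i)) tau i) <= M * tau ^+ 2.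
  move=> /andP[i0 im]; have [tp tm] := tP i i0 im.
  have pI := tI i.+1; have mI := tI i.-1; rewrite tp in pI; rewrite tm in mI.
  apply: (@le_trans _ _ (Cr * tau ^+ 2)); last by rewrite ler_wpM2r ?exprn_ge0 // ltW.
  rewrite /residual /exact_coeff /x /L tp tm.
  exact: Hres tau0 mI (tI i) pI.
have j0 : j 0%N = 0%N by exact: jE.
have j1 : j 1%N = 1%N by exact: jE.
have t0E : t 0%N = 0 by rewrite /t j0 mul0r.
have t1E : t 1%N = tau by rewrite /t j1 mul1r.
have X0E : X 0%N = U 0%N by rewrite /X j0.
have X1E : X 1%N = U 1%N by rewrite /X j1.
have x00 : eqL2 Omega (x 0%N) (X 0%N).
  rewrite /x t0E X0E; have [_ _ _ E _] := u_sol.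
  have E' := eqL2_sym HU0.
  move: E E'; apply: (@filterS2 _ _ (ae_filter_ringOfSetsType (mu2 R))) => p h1 h2 Op.
  by rewrite h1 // h2.
have z0 : snorm d (x 0%N - X 0%N) = 0 by exact: eqL2_snorm0 (Sx _) (SX _) x00.
have gz0 : snorm a (grad (x 0%N) - grad (X 0%N)) = 0.
  have -> : grad (x 0%N) = grad (X 0%N).
    apply: injective_projections.
      exact: (weakD_ae oO bO (@dirs1 R) (Sx _) (SX _) x00).
    exact: (weakD_ae oO bO (@dirs2 R) (Sx _) (SX _) x00).
  by rewrite subrr /snorm (sinner0l sa (sinner0 sa)) sqrtr0.
have tauI : tau \in `[0, T] by rewrite -t1E.
have XH1 := XH 1%N; rewrite X1E in XH1.
have [s1 s2] := Hstart tau (U 1%N) tau0 tauI XH1 HU1.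
have z1 : snorm d (x 1%N - X 1%N) <= M * tau ^+ 3.
  rewrite /x t1E X1E; apply: le_trans s1 _.
  by rewrite ler_wpM2r // exprn_ge0 // ltW.
have gz1 : snorm a (grad (x 1%N) - grad (X 1%N)) <= M * tau ^+ 2.
  have Sg := sinner_memB sa (Sgx 1%N) (SgX 1%N).
  apply: le_trans (snorm_pair_le sd Sg.1 Sg.2) _.
  apply: (@le_trans _ _ (Cs * tau ^+ 2 + Cs * tau ^+ 2)).
    rewrite /x t1E X1E; apply: lerD; [exact: s2 _ (@dirs1 R)|exact: s2 _ (@dirs2 R)].
  by rewrite -mulrDl ler_wpM2r // ltW.
have conv i : (i < m)%N ->
    snorm d (x i.+1 - X i.+1 - (x i - X i)) <= error_const M * tau ^+ 2 * tau.
  move=> im; exact: (scheme_convergence sd sa c0 M0 tau0 tau1 hm Sx SX SL SLX Sft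
    Sgx SgX gxx gxX gXx gXX scheme al_itv be_itv al_lip be_lip L_bnd L_lip gx_bnd
    gx_lip f_bnd' x_lip res_bnd z0 gz0 z1 gz1 im).
have [tp tm] := tP k k1 km.
have pI := tI k.+1; have mI := tI k.-1; rewrite tp in pI; rewrite tm in mI.
have cen := central (t k) tau (ltW tau0) mI (tI k) pI.
have conv1 := conv k km.
have := conv k.-1 (leq_ltn_trans (leq_pred k) km); rewrite (prednK k1) => conv2.
have XpE : X k.+1 = U k.+1 by rewrite /X jE.
have XmE : X k.-1 = U k.-1.
  by rewrite /X jE //; exact: leq_trans (leq_pred k) (ltnW km).
have S1t : S (timeD Omega T u (t k)).
  by have [_ /Ck_time_C0[h _]] := Ck_time_timeD u_C3; exact: h _ (tI k).
have Scen : S ((2 * tau) *: timeD Omega T u (t k) - (u (t k + tau) - u (t k - tau))).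
  apply: (sinner_memB sd); first exact: (sinner_memZ sd).
  by rewrite -tp -tm; exact: (sinner_memB sd (Sx k.+1) (Sx k.-1)).
have Sz i := sinner_memB sd (Sx i) (SX i).
have Sz1 := sinner_memB sd (Sz k.+1) (Sz k).
have Sz2 := sinner_memB sd (Sz k) (Sz k.-1).
have h2 : 0 < 2 * tau by rewrite mulr_gt0.
(* [2 * tau] times the error of the central difference of [U] is that of [u] plus
   two consecutive velocities of the error of the scheme. *)
pose E := (2 * tau) *: timeD Omega T u (t k) - (u (t k + tau) - u (t k - tau))
     + (x k.+1 - X k.+1 - (x k - X k)) + (x k - X k - (x k.-1 - X k.-1)).
have SE : S E by apply: (sinner_memD sd) Sz2; exact: (sinner_memD sd Scen Sz1).
have -> : (fun p : R * R => timeD Omega T u (k%:R * tau) p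
    - (U k.+1 p - U k.-1 p) / (2 * tau)) = (2 * tau)^-1 *: E.
  rewrite -(tE k (ltnW km)) -XpE -XmE /E -tp -tm -/(x k.+1) -/(x k.-1).
  have alg (h : R) (y l xp xk xm up uk um : R * R -> R) : h != 0 ->
    (fun p => y p - (up p - um p) / h) =
    h^-1 *: (h *: y - (xp - xm) + (xp - up - (xk - uk)) + (xk - uk - (xm - um))).
    by move=> h0; apply/funext => p; rewrite !fctE -![_ *: _]/(_ * _); field.
  apply: alg => //.
  by rewrite gt_eqF.
rewrite (normL2E (sinner_memZ sd _ SE)) (snormZ sd _ SE).
rewrite gtr0_norm ?invr_gt0 // mulrC ler_pdivrMr //.
have Eb : snorm d E <= C1 * tau ^+ 3 + error_const M * tau ^+ 2 * tau
    + error_const M * tau ^+ 2 * tau.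
  apply: le_trans (snormD sd (sinner_memD sd Scen Sz1) Sz2) _; apply: lerD conv2.
  exact: le_trans (snormD sd Scen Sz1) (lerD cen conv1).
apply: le_trans Eb _.
have C1t : 0 <= C1 * tau ^+ 3 by rewrite mulr_ge0 // exprn_ge0 // ltW.
have -> : (C1 + error_const M) * tau ^+ 2 * (2 * tau) =
  C1 * tau ^+ 3 + error_const M * tau ^+ 2 * tau + error_const M * tau ^+ 2 * tau
  + C1 * tau ^+ 3 by ring.
by rewrite lerDl.
Qed.
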